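(* Let $\alpha\in(0,\tfrac12)$, so that $\rho:=\alpha/(1-\alpha)<1$, and let $\mathbf{\Phi}$ be the Markov chain on $\mathbb{Z}_+$ defined by $\Phi(k+1)=\max(\Phi(k)+D(k+1),0)$, $k\ge0$, where $\{D(k)\}$ is i.i.d. with $\mathsf{P}\{D(k)=1\}=\alpha$ and $\mathsf{P}\{D(k)=-1\}=1-\alpha$ (the $M/M/1$ queue). Then: (i) The Markov chain $\mathbf{\Phi}$ is geometrically ergodic, and its invariant (marginal) distribution is geometric with parameter $\rho$, i.e. $\pi(i)=(1-\rho)\rho^i$, $i\in\mathbb{Z}_+$. (ii) Let $F(x)=x$, or $F(x)=e^{\beta x}$ for some fixed $\beta\in(0,|\log\rho|)$, $x\in\mathbb{Z}_+$, and let $\phi:=\pi(F)$. The Monte Carlo estimates are consistent: $L_n(F)\to\phi$ a.s. as $n\to\infty$. Moreover there exist $\overline{c}<\phi$ and a convex function $I:[\overline{c},\infty)\to\mathbb{R}_+$ such that for each nonempty open set $O\subset(\overline{c},\infty)$ with closure $\overline{O}$, and each initial condition $\Phi(0)=x\in\mathbb{Z}_+$, $$\lim_{n\to\infty}\frac1n\log\mathsf{P}_x\{L_n(F)\in O\}=\lim_{n\to\infty}\frac1n\log\mathsf{P}_x\{L_n(F)\in\overline{O}\}=-\inf_{c\in\overline{O}}I(c).$$ The rate function $I$ is strictly positive on $[\overline{c},\phi)$, is identically zero on $[\phi,\infty)$, and can be expressed as the convex dual $I(c)=\sup_{a\in\mathbb{R}}[ca-\Lambda(a)]$. Consequently, for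 each initial condition $x\in\mathbb{Z}_+$, $$\lim_{n\to\infty}\frac1n\log\mathsf{P}_x\{L_n(F)\le c\}=-I(c)<0,\qquad c\in(\overline{c},\phi),$$ $$\lim_{n\to\infty}\frac1n\log\mathsf{P}_x\{L_n(F)\ge c\}=0,\qquad c\ge\phi.$$
   Context: $L_n(F):=n^{-1}\sum_{k=0}^{n-1}F(\Phi(k))$; $\mathsf{P}_x$ is the law of the chain with $\Phi(0)=x$. Geometric ergodicity means that for some $r>1$ and some function $M:\mathbb{Z}_+\to(0,\infty)$, $\|P^k(x,\cdot)-\pi\|\le M(x)r^{-k}$ for all $x$, $k$, with $\|\cdot\|$ the total-variation norm. The pinned log moment generating function is $$\Lambda(a)=\lim_{n\to\infty}\frac1n\log\mathsf{E}_\nu\big[\exp(naL_n(F))\mathbb{I}\{\Phi(n)\in C\}\big]\in(-\infty,\infty],\qquad a\in\mathbb{R},$$ where $C$ is a small set and $\nu$ a small measure (the limit does not depend on their choice); here $(C,\nu)$ may be taken to be $C=\{0\}$ and $\nu$ the point mass at $0$. *)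

(* Defs.v *)
From HB Require Import structures.
From mathcomp Require Export all_boot all_order all_algebra.
From mathcomp Require Export all_classical all_reals all_analysis.
Export Order.TTheory GRing.Theory Num.Theory.
Export numFieldNormedType.Exports.

Set Implicit Arguments.
Unset Strict Implicit.
Unset Printing Implicit Defensive.

Global Open Scope classical_set_scope.
Global Open Scope ring_scope.

(* [int] with its power-set sigma-algebra, as the library has it for [nat] *)
HB.instance Definition _ := isPointed.Build int 0.
HB.instance Definition _ := @isMeasurable.Build default_measure_display
  int discrete_measurable discrete_measurable0
  discrete_measurableC discrete_measurableU.

Section chain.
Context d (Omega : measurableType d) (R : realType) (P : probability Omega R).
Implicit Types (D : nat -> {RV P >-> int}) (F : nat -> R).

(* product rule over every finite subfamily (here [J] has no repetition) *)
Definition mutually_independent D :=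
  forall (J : seq nat) (B : nat -> set int), uniq J ->
    (P (\bigcap_(k in [set` J]) (D k @^-1` B k)) =
     \prod_(k <- J) P (D k @^-1` B k))%E.

Definition iid_increments (alpha : R) D :=
  [/\ mutually_independent D,
      forall k, P (D k @^-1` [set 1]) = alpha%:E &
      forall k, P (D k @^-1` [set (-1)]) = (1 - alpha)%:E].

(* [Phi D x] is the chain started at [x]; hence P_x{Phi(k) in A} is the
   [P]-probability of [Phi D x k @^-1` A]. The argument of [absz] is always
   nonnegative. *)
Fixpoint Phi D (x k : nat) (w : Omega) : nat :=
  if k is k'.+1 then
    absz (Num.max ((Phi D x k' w)%:Z + D k'.+1 w) 0)
  else x.

Definition transition D (k x : nat) (A : set nat) : \bar R :=
  P (Phi D x k @^-1` A).

Definition invariant_distribution D (pi : probability nat R) :=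
  forall A : set nat, (pi A = \int[pi]_x transition D 1 x A)%E.

(* total variation norm of a signed measure [m] on [nat]:
   sup_A m(A) - inf_A m(A) = sup_{|g| <= 1} |m(g)| when m(nat) = 0 *)
Definition tv_norm (m : set nat -> \bar R) : \bar R :=
  (ereal_sup (range m) - ereal_inf (range m))%E.

Definition geometrically_ergodic D (pi : probability nat R) :=
  exists (r : R) (M : nat -> R),
    [/\ 1 < r, forall x, 0 < M x &
        forall x k, (tv_norm (fun A => transition D k x A - pi A)
                     <= (M x * r ^- k)%:E)%E].

(* L_n(F) along the chain started at [x]; its value at [n = 0] is irrelevant *)
Definition empirical_mean D F (x n : nat) (w : Omega) : R :=
  n%:R^-1 * \sum_(k < n) F (Phi D x k w).

(* n^-1 log of a quantity in [0, +oo], with [lne 0 = -oo] *)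
Definition scaled_log (u : nat -> \bar R) (n : nat) : \bar R :=
  ((n%:R^-1)%:E * lne (u n))%E.

Definition pinned_mgf D F (a : R) (n : nat) : \bar R :=
  'E_P[fun w => expR (n%:R * a * empirical_mean D F 0 n w)
                * \1_(Phi D 0 n @^-1` [set 0%N]) w].

Definition pinned_log_mgf D F (a : R) : \bar R :=
  limn (scaled_log (pinned_mgf D F a)).

(* P_x{L_n(F) in S} *)
Definition mean_prob D F (x : nat) (S : set R) (n : nat) : \bar R :=
  P (empirical_mean D F x n @^-1` S).

End chain.

Definition geometric_distribution (R : realType) (rho : R)
    (pi : probability nat R) :=
  forall i : nat, pi [set i] = ((1 - rho) * rho ^+ i)%:E.

(* Main.v *)
From HB Require Import structures.
Require Import Defs.
From mathcomp Require Import ring lra zify measurable_realfun.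

Set Implicit Arguments.
Unset Strict Implicit.
Unset Printing Implicit Defensive.

(** Write [S_n] for the cumulative cost [F(Phi(0)) + ... + F(Phi(n-1))].

    All probabilities involved depend on finitely many increments, hence on
    finitely many tosses of a coin of bias [alpha] driving a walk reflected
    at 0. The proof works with finite expectations [pathE] over sequences of
    tosses, and [prob_bits] and [integral_bits] transfer the results to the
    given increments.

    Ergodicity. The geometric law satisfies the balance equations, which are a
    recursion determining an invariant law from its mass at 0
    ([invariant_geometric]). Two copies of the walk driven by the same tosses
    can only get closer, and as long as they differ [z ^ max] contracts on
    average, for any [z] between 1 and [1 / rho] ([coupling]); this gives the
    geometric rate in total variation.

    The strong law. Poisson's equation [P g = g - F + phi] has explicit
    solutions for both costs (the record [admissible]), so [S_n - n phi] is a
    martingale up to a boundary term. Its increments may fail to have a second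
    moment under the geometric law when [F] is exponential, so steps from above
    a slowly growing level are left out, and leaving the region below that
    level is unlikely by a Lyapunov bound ([deviation_le]). Borel-Cantelli
    along the powers [k ^ q] and monotonicity of [S_n] conclude.

    Large deviations. Paths from 0 to 0 can be concatenated, so the pinned
    generating function [E(exp(a S_n); Phi(n) = 0)] and the pinned probability
    [P(S_n <= n c, Phi(n) = 0)] are supermultiplicative, and Fekete's lemma
    provides their exponential rates [Lam a] and [- rate c]. Concatenating
    paths of different means shows that [rate] is convex. Laplace's method and
    a supporting line identify [rate] with the convex dual of [Lam]
    ([rate_dual]). Positive parameters do not contribute, since a single high
    excursion makes the generating function grow faster than any exponential
    ([pinned_exp_superexp]).

    Pinning does not change the lower tail: for [a < 0] time spent at high
    states is penalised so much that the free generating function grows like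
    the pinned one ([free_exp_le]), and Chernoff's bound gives the upper bound.
    Monotonicity in the starting point makes the free one submultiplicative, so
    [Lam a] is at most [ln E exp(a S_N) / N] for every single [N]; expanding
    at [a = 0] and using that [E S_N / N] tends to [phi] shows that [rate] is
    positive below [phi].

    Above [phi] deviations are cheap. An excursion to height [h] costs a
    probability exponential in [h] but contributes a sum much larger than [h],
    so it lifts the mean of a path of length much larger than [h]
    ([heavy_block]). Finally, the rate decreases strictly up to [phi] and
    vanishes from there on, which turns the estimates for tails into those for
    open sets and their closures ([decays_open]). *)

(** * Expectations over coin-tossing paths *)

Section path_expectation.
Context {R : realType} (alpha : R).

(** Expectation of a function of [n] independent tosses, by recursion on the
    first toss, so that conditioning on one step, the Markov property and the
    Feynman-Kac recursions below hold by computation. *)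
Fixpoint pathE (n : nat) (H : seq bool -> R) : R :=
  if n is m.+1 then
    alpha * pathE m (fun s => H (true :: s))
    + (1 - alpha) * pathE m (fun s => H (false :: s))
  else H [::].

Definition pathP n (E : pred (seq bool)) := pathE n (fun s => (E s)%:R).

Lemma eq_pathE n H G : (forall s, size s = n -> H s = G s) ->
  pathE n H = pathE n G.
Proof.
elim: n H G => [|n IH] H G HG /=; first exact: HG.
by congr (_ * _ + _ * _); apply: IH => s ss; apply: HG; rewrite /= ss.
Qed.

Lemma pathED n H G : pathE n (fun s => H s + G s) = pathE n H + pathE n G.
Proof. by elim: n H G => [//|n IH] H G /=; rewrite !IH; ring. Qed.

Lemma pathEZ n c H : pathE n (fun s => c * H s) = c * pathE n H.
Proof. by elim: n H => [//|n IH] H /=; rewrite !IH; ring. Qed.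

Lemma pathE_cst n c : pathE n (fun=> c) = c.
Proof. by elim: n => [//|n IH] /=; rewrite !IH; ring. Qed.

Lemma pathE_cat m n H :
  pathE (m + n) H = pathE m (fun s => pathE n (fun t => H (s ++ t))).
Proof. by elim: m H => [//|m IH] H /=; rewrite !IH. Qed.

Lemma pathE_rcons n H : pathE n.+1 H =
  pathE n (fun s => alpha * H (rcons s true) + (1 - alpha) * H (rcons s false)).
Proof.
rewrite -addn1 pathE_cat; apply: eq_pathE => s _ /=.
by rewrite !cats1.
Qed.

Hypothesis alpha01 : 0 < alpha < 1.
Let alpha_ge0 : 0 <= alpha. Proof. by case/andP: alpha01 => /ltW. Qed.
Let alphaC_ge0 : 0 <= 1 - alpha.
Proof. by case/andP: alpha01 => _ /ltW; rewrite subr_ge0. Qed.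

Lemma ler_pathE n H G : (forall s, size s = n -> H s <= G s) ->
  pathE n H <= pathE n G.
Proof.
elim: n H G => [|n IH] H G HG /=; first exact: HG.
by apply: lerD; apply: ler_wpM2l => //; apply: IH => s ss; apply: HG;
  rewrite /= ss.
Qed.

Lemma pathE_ge0 n H : (forall s, size s = n -> 0 <= H s) -> 0 <= pathE n H.
Proof. by move=> H0; rewrite -(pathE_cst n 0); exact: ler_pathE. Qed.

Lemma pathP_ge0 n E : 0 <= pathP n E.
Proof. by apply: pathE_ge0 => s _. Qed.

Lemma pathP_le1 n E : pathP n E <= 1.
Proof. by rewrite -(pathE_cst n 1); apply: ler_pathE => s _; case: (E s). Qed.

Lemma sub_pathP n (E E' : pred (seq bool)) :
  (forall s, size s = n -> E s -> E' s) -> pathP n E <= pathP n E'.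
Proof.
move=> EE'; apply: ler_pathE => s ss;
  case: (boolP (E s)) => [/(EE' _ ss) -> //|].
by rewrite ler0n.
Qed.

Lemma pathPU n (E E' : pred (seq bool)) :
  pathP n (fun s => E s || E' s) <= pathP n E + pathP n E'.
Proof.
rewrite /pathP -pathED; apply: ler_pathE => s _.
by case: (E s); case: (E' s); rewrite //= ?addr0 ?add0r// lerDl.
Qed.

Lemma pathPC n (E : pred (seq bool)) :
  pathP n (fun s => ~~ E s) = 1 - pathP n E.
Proof.
rewrite -(pathE_cst n 1) -[- _]mulN1r /pathP -pathEZ -pathED.
by apply: eq_pathE => s _; case: (E s); rewrite /=; ring.
Qed.

Definition weight (t : seq bool) : R :=
  \prod_(b <- t) (if b then alpha else 1 - alpha).

Lemma weight_gt0 t : 0 < weight t.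
Proof.
case/andP: alpha01 => a0 a1.
by apply: prodr_gt0 => -[]; rewrite ?subr_gt0.
Qed.

Lemma weight_cat s t : weight (s ++ t) = weight s * weight t.
Proof. by rewrite /weight big_cat. Qed.

Lemma weight_nseq n b :
  weight (nseq n b) = (if b then alpha else 1 - alpha) ^+ n.
Proof. by rewrite /weight big_nseq; elim: n => //= n ->; rewrite exprS. Qed.

(** All the lower bounds on probabilities come from forcing an initial stretch
    of the path and using independence after it. *)
Lemma pathE_prefix t n H : (forall s, 0 <= H s) ->
  weight t * pathE n (fun s => H (t ++ s)) <= pathE (size t + n) H.
Proof.
elim: t H => [|b t IH] H H0 /=; first by rewrite /weight big_nil mul1r.
have /= IHb b' := IH (fun s => H (b' :: s)) (fun s => H0 _).
have E0 b' : 0 <= pathE (size t + n) (fun s => H (b' :: s)).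
  by apply: pathE_ge0.
rewrite /weight big_cons -mulrA; case: b;
  [rewrite -[leLHS]addr0|rewrite -[leLHS]add0r];
  by apply: lerD; rewrite ?mulr_ge0// ler_wpM2l// IHb.
Qed.

Lemma pathP_prefix t n (E : pred (seq bool)) :
  weight t * pathP n (fun s => E (t ++ s)) <= pathP (size t + n) E.
Proof. by apply: (@pathE_prefix t n (fun s => (E s)%:R)) => s. Qed.

Lemma pathP_markov n (H : seq bool -> R) c : 0 < c ->
  (forall s, 0 <= H s) -> pathP n (fun s => c <= H s) <= c^-1 * pathE n H.
Proof.
move=> c0 H0; rewrite -pathEZ; apply: ler_pathE => s _.
case: (leP c (H s)) => cH; first by rewrite ler_pdivlMl ?mulr1.
by rewrite mulr_ge0// invr_ge0 ltW.
Qed.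

End path_expectation.

(** * The reflected walk and its cumulative cost *)

Section walk.
Context {R : realType}.
Implicit Types (x y : nat) (s t : seq bool).

(** The truncated predecessor on [nat] is the reflection at 0. *)
Definition step x (b : bool) : nat := if b then x.+1 else x.-1.
Definition pos x s := foldl step x s.

Fixpoint cost (F : nat -> R) x s : R :=
  if s is b :: t then F x + cost F (step x b) t else 0.

Lemma pos_cat x s t : pos x (s ++ t) = pos (pos x s) t.
Proof. exact: foldl_cat. Qed.

Lemma pos_rcons x s b : pos x (rcons s b) = step (pos x s) b.
Proof. by rewrite -cats1 pos_cat. Qed.

Lemma cost_cat F x s t : cost F x (s ++ t) = cost F x s + cost F (pos x s) t.
Proof. by elim: s x => [|b s IH] x /=; rewrite ?add0r// IH addrA. Qed.

Lemma cost_rcons F x s b : cost F x (rcons s b) = cost F x s + F (pos x s).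
Proof. by rewrite -cats1 cost_cat /= addr0. Qed.

Lemma leq_step x y b : (x <= y)%N -> (step x b <= step y b)%N.
Proof. by case: b => /=; lia. Qed.

Lemma pos_up x n : pos x (nseq n true) = (x + n)%N.
Proof. by elim: n x => [|n IH] x; rewrite ?addn0//= IH /=; lia. Qed.

Lemma pos_down x n : pos x (nseq n false) = (x - n)%N.
Proof. by elim: n x => [|n IH] x; rewrite ?subn0//= IH /=; lia. Qed.

Context (F : nat -> R).
Hypotheses (F_mono : {homo F : x y / (x <= y)%N >-> x <= y})
  (F0_ge0 : 0 <= F 0%N).

Lemma nondecreasing_ge0 x : 0 <= F x.
Proof. by apply: (le_trans F0_ge0); apply: F_mono. Qed.

Lemma cost_ge0 x s : 0 <= cost F x s.
Proof. by elim: s x => //= b s IH x; rewrite addr_ge0// nondecreasing_ge0. Qed.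

Lemma ler_cost x y s : (x <= y)%N -> cost F x s <= cost F y s.
Proof.
elim: s x y => //= b s IH x y xy.
by apply: lerD; [exact: F_mono|apply/IH/leq_step].
Qed.

Lemma cost_ge_min x s : (size s)%:R * F 0%N <= cost F x s.
Proof.
elim: s x => [|b s IH] x /=; first by rewrite mul0r.
by rewrite -natr1 mulrDl mul1r addrC lerD// F_mono.
Qed.

Lemma cost_le x s : cost F x s <= (size s)%:R * F (x + size s)%N.
Proof.
elim: s x => [|b s IH] x /=; first by rewrite mul0r.
rewrite -natr1 mulrDl mul1r addrC lerD//; last by apply: F_mono; lia.
apply: (le_trans (IH _)); apply: ler_wpM2l => //; apply: F_mono.
by case: b => /=; lia.
Qed.

Lemma cost_down x n : cost F x (nseq n false) <= n%:R * F x.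
Proof.
elim: n x => [|n IH] x /=; first by rewrite mul0r.
rewrite -natr1 mulrDl mul1r addrC lerD//.
by apply: (le_trans (IH _)); apply: ler_wpM2l => //; apply: F_mono; lia.
Qed.

End walk.

(** * Exponential Lyapunov functions *)

Section drift.
Context {R : realType} (alpha : R).
Hypothesis halpha : 0 < alpha < 2^-1.

Lemma alpha01 : 0 < alpha < 1.
Proof. by move: halpha => /andP[? ?]; apply/andP; split; lra. Qed.

Let rho := alpha / (1 - alpha).

Lemma rho_gt0 : 0 < rho.
Proof. by move: alpha01 => /andP[? ?]; rewrite divr_gt0// subr_gt0. Qed.

Lemma rho_lt1 : rho < 1.
Proof.
move: halpha => /andP[? ?].
by rewrite /rho ltr_pdivrMr; lra.
Qed.

Lemma alpha_rho : alpha = rho * (1 - alpha).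
Proof.
by rewrite /rho mulfVK// gt_eqF// subr_gt0; case/andP: alpha01.
Qed.

(** One step from [x] multiplies [z ^ x] by this factor when [x] is positive. *)
Definition drift_rate (z : R) := alpha * z + (1 - alpha) / z.

Lemma drift_rate_gt0 z : 1 < z -> 0 < drift_rate z.
Proof.
move=> z1; move: alpha01 => /andP[a0 a1].
have z0 : 0 < z by lra.
by apply: addr_gt0; rewrite mulr_gt0 ?invr_gt0 ?subr_gt0.
Qed.

Lemma drift_rate_lt1 z : 1 < z -> alpha * z < 1 - alpha -> drift_rate z < 1.
Proof.
move=> z1 az; have z0 : 0 < z by lra.
rewrite -subr_gt0 -(pmulr_rgt0 _ z0).
have -> : z * (1 - drift_rate z) = (z - 1) * ((1 - alpha) - alpha * z).
  by rewrite /drift_rate; field; rewrite gt_eqF.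
by rewrite mulr_gt0// subr_gt0.
Qed.

Lemma drift z x : 1 < z ->
  alpha * z ^+ x.+1 + (1 - alpha) * z ^+ x.-1 <= drift_rate z * z ^+ x + z.
Proof.
move=> z1; move: alpha01 => /andP[a0 a1]; have z0 : 0 < z by lra.
case: x => [|x] /=.
  rewrite expr1 expr0 mulr1 mulr1.
  have := drift_rate_gt0 z1; nra.
suff -> : drift_rate z * z ^+ x.+1 =
    alpha * z ^+ x.+2 + (1 - alpha) * z ^+ x by rewrite lerDl ltW.
by rewrite /drift_rate !exprS; field; rewrite gt_eqF.
Qed.

Lemma pathE_expr_pos z n x : 1 < z -> alpha * z < 1 - alpha ->
  pathE alpha n (fun s => z ^+ pos x s) <= z ^+ x + z / (1 - drift_rate z).
Proof.
move=> z1 az; set k := drift_rate z.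
have k1 : k < 1 by exact: drift_rate_lt1.
have k0 : 0 < k by exact: drift_rate_gt0.
move: alpha01 => /andP[a0 a1]; have z0 : 0 < z by lra.
suff: pathE alpha n (fun s => z ^+ pos x s)
    <= k ^+ n * z ^+ x + z * (1 - k ^+ n) / (1 - k).
  move/le_trans; apply; apply: lerD.
    by rewrite ler_piMl ?exprn_ge0 ?exprn_ile1 // ltW.
  rewrite ler_pM2r ?invr_gt0 ?subr_gt0//.
  by rewrite ler_piMr ?(ltW z0)// gerBl exprn_ge0// ltW.
elim: n x => [|n IH] x /=.
  by rewrite expr0 mul1r subrr mulr0 mul0r addr0.
have := IH x.+1; have := IH x.-1; rewrite /step.
set e1 := pathE _ _ _; set e2 := pathE _ _ _ => i1 i2.
apply: (@le_trans _ _ (k ^+ n * (alpha * z ^+ x.+1 + (1 - alpha) * z ^+ x.-1)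
   + z * (1 - k ^+ n) / (1 - k))).
  have -> : k ^+ n * (alpha * z ^+ x.+1 + (1 - alpha) * z ^+ x.-1) +
     z * (1 - k ^+ n) / (1 - k)
   = alpha * (k ^+ n * z ^+ x.+1 + z * (1 - k ^+ n) / (1 - k)) +
     (1 - alpha) * (k ^+ n * z ^+ x.-1 + z * (1 - k ^+ n) / (1 - k)) by ring.
  by apply: lerD; apply: ler_wpM2l; rewrite ?subr_ge0// ltW.
have -> : k ^+ n.+1 * z ^+ x + z * (1 - k ^+ n.+1) / (1 - k) =
  k ^+ n * (k * z ^+ x + z) + z * (1 - k ^+ n) / (1 - k).
  by rewrite exprS; field; rewrite gt_eqF// subr_gt0.
by rewrite lerD2r ler_wpM2l ?drift// exprn_ge0// ltW.
Qed.

(** An additive functional whose one-step increments are at most [c z ^ x]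
    grows linearly in expectation, because [z ^ x] is a Lyapunov function. *)
Lemma drift_accumulation z : 1 < z -> alpha * z < 1 - alpha ->
  exists2 K, 0 < K & forall c (v : nat -> nat -> R), 0 <= c ->
    (forall x, v 0%N x <= c * z ^+ x) ->
    (forall n x, v n.+1 x <=
       c * z ^+ x + (alpha * v n x.+1 + (1 - alpha) * v n x.-1)) ->
    forall n x, v n x <= c * (K * (z ^+ x + n%:R)).
Proof.
move=> z1 az; set k := drift_rate z.
have k1 : k < 1 by exact: drift_rate_lt1.
have k0 : 0 < k by exact: drift_rate_gt0.
move: alpha01 => /andP[a0 a1]; have z0 : 0 < z by lra.
set A := (1 - k)^-1.
have A1 : 1 <= A by rewrite invf_ge1 ?subr_gt0//; lra.
have kA : 1 + A * k = A.
  by rewrite /A; field; rewrite gt_eqF// subr_gt0.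
exists (A * z) => [|c v c0 v0 vS n x]; first by nra.
suff: v n x <= c * (A * (z ^+ x + n%:R * z)).
  move/le_trans; apply; apply: ler_wpM2l => //.
  rewrite -mulrA; apply: ler_wpM2l; first by lra.
  rewrite mulrDr (mulrC z n%:R) lerD2r ler_peMl ?exprn_ge0// ltW//.
elim: n x => [|n IH] x.
  rewrite (le_trans (v0 x))// ler_wpM2l// mul0r addr0 ler_peMl// exprn_ge0//.
  exact: ltW.
apply: (le_trans (vS n x)).
apply: (@le_trans _ _ (c * z ^+ x + (alpha * (c * (A * (z ^+ x.+1 + n%:R * z)))
  + (1 - alpha) * (c * (A * (z ^+ x.-1 + n%:R * z)))))).
  by rewrite lerD2l lerD// ler_wpM2l ?IH// ?subr_ge0 ltW.
have -> : c * z ^+ x + (alpha * (c * (A * (z ^+ x.+1 + n%:R * z)))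
  + (1 - alpha) * (c * (A * (z ^+ x.-1 + n%:R * z)))) =
  c * (z ^+ x + A * (alpha * z ^+ x.+1 + (1 - alpha) * z ^+ x.-1) +
   A * (n%:R * z)) by ring.
rewrite ler_wpM2l// -natr1.
apply: (@le_trans _ _ (z ^+ x + A * (k * z ^+ x + z) + A * (n%:R * z))).
  by rewrite lerD2r lerD2l ler_wpM2l ?drift//; lra.
have -> : z ^+ x + A * (k * z ^+ x + z) + A * (n%:R * z) =
  (1 + A * k) * z ^+ x + A * z + A * (n%:R * z) by ring.
by rewrite kA le_eqVlt; apply/orP; left; apply/eqP; ring.
Qed.

(** The geometric tail is preserved by one step because
    [alpha = rho * (1 - alpha)], and a chain started at 0 satisfies it at
    time 0. *)
Lemma pathP_pos_ge n j : pathP alpha n (fun s => j <= pos 0 s)%N <= rho ^+ j.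
Proof.
have [r0 r1] := (rho_gt0, rho_lt1).
elim: n j => [|n IH] [|j]; rewrite ?expr0 ?pathP_le1 ?alpha01//.
  by rewrite /pathP /= exprn_ge0// ltW.
rewrite /pathP pathE_rcons.
rewrite (@eq_pathE _ _ _ _ (fun s => alpha * (j <= pos 0 s)%N%:R +
   (1 - alpha) * (j.+2 <= pos 0 s)%N%:R)); last first.
  move=> s _; rewrite !pos_rcons /=; congr (_ * _ + _ * _).
  by congr (_ (nat_of_bool _)); lia.
rewrite pathED !pathEZ.
have h1 := IH j; have h2 := IH j.+2; rewrite /pathP in h1 h2.
move: alpha01 => /andP[a0 a1].
apply: (@le_trans _ _ (alpha * rho ^+ j + (1 - alpha) * rho ^+ j.+2)).
  by apply: lerD; apply: ler_wpM2l; rewrite ?subr_ge0// ltW.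
suff -> : alpha * rho ^+ j + (1 - alpha) * rho ^+ j.+2 = rho ^+ j.+1 by [].
transitivity (rho * (1 - alpha) * rho ^+ j + (1 - alpha) * rho ^+ j.+2).
  by rewrite -alpha_rho.
rewrite (_ : _ + _ = rho * rho ^+ j * (1 - alpha + rho * (1 - alpha))).
  by rewrite -alpha_rho subrK mulr1 exprS.
by rewrite !exprS; ring.
Qed.

Lemma pathP_return n : 1 - rho <= pathP alpha n (fun s => pos 0 s == 0%N).
Proof.
have /= := @pathP_pos_ge n 1; rewrite expr1.
have -> : pathP alpha n (fun s => 0 < pos 0 s)%N =
          pathP alpha n (fun s => ~~ (pos 0 s == 0%N)).
  by apply: eq_pathE => s _; rewrite lt0n.
by rewrite pathPC; lra.
Qed.

End drift.

(** The cost functions treated, with a solution [g] of Poisson's equation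
    [P g = g - F + phi]; both grow at most like [b ^ x] for some [b < 1 / rho],
    which makes them integrable against the geometric law. *)
Record admissible {R : realType} (alpha : R) (F g : nat -> R) (phi b C : R) :
    Prop := Admissible {
  adm_mono : {homo F : x y / (x <= y)%N >-> x <= y};
  adm_ge0 : 0 <= F 0%N;
  adm_unbounded : forall K, exists k, K <= F k;
  adm_b_gt1 : 1 < b;
  adm_b_lt : alpha * b < 1 - alpha;
  adm_F_le : forall x, F x <= C * b ^+ x;
  adm_g_le : forall x, `|g x| <= C * b ^+ x;
  adm_poisson : forall x,
    alpha * g x.+1 + (1 - alpha) * g x.-1 = g x - F x + phi;
  adm_F0_lt : F 0%N < phi }.

(** * Poisson's equation and mean square deviations *)

Section moments.
Context {R : realType} (alpha : R) (F g : nat -> R) (phi b C : R).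
Hypothesis halpha : 0 < alpha < 2^-1.
Hypothesis adm : admissible alpha F g phi b C.

Let a01 := alpha01 halpha.
Let b1 := adm_b_gt1 adm.
Let ab := adm_b_lt adm.
Let F_ge0 := nondecreasing_ge0 (adm_mono adm) (adm_ge0 adm).
Let b0 : 0 < b. Proof. by have := b1; lra. Qed.

Lemma adm_phi_gt0 : 0 < phi.
Proof. exact: le_lt_trans (adm_ge0 adm) (adm_F0_lt adm). Qed.

Lemma adm_C_ge0 : 0 <= C.
Proof.
by have := adm_g_le adm 0; rewrite expr0 mulr1; apply: le_trans.
Qed.

Let expb_ge1 x : 1 <= b ^+ x. Proof. by rewrite exprn_ege1// ltW. Qed.

Lemma pathE_cost n x : pathE alpha n (cost F x) =
  n%:R * phi + g x - pathE alpha n (fun s => g (pos x s)).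
Proof.
elim: n x => [|n IH] x /=; first by rewrite mul0r add0r subrr.
have st c y : pathE alpha n (fun s => c + cost F y s) =
    c + pathE alpha n (cost F y) by rewrite pathED pathE_cst.
rewrite !st !IH /step -natr1.
have := adm_poisson adm x.
set e1 := pathE _ _ _; set e2 := pathE _ _ _ => P.
have -> : g x = F x - phi + alpha * g x.+1 + (1 - alpha) * g x.-1.
  by rewrite -addrA P; ring.
by ring.
Qed.

(** Poisson's equation gives [E S_n = n phi + O(1)] without any ergodic
    theorem. *)
Lemma pathE_cost_ge x : exists K, forall n,
  n%:R * phi - K <= pathE alpha n (cost F x).
Proof.
exists (C * (b ^+ x + b / (1 - drift_rate alpha b)) - g x) => n.
rewrite pathE_cost.
suff : pathE alpha n (fun s => g (pos x s)) <=
  C * (b ^+ x + b / (1 - drift_rate alpha b)) by lra.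
apply: (@le_trans _ _ (pathE alpha n (fun s => C * b ^+ pos x s))).
  by apply: (ler_pathE a01) => s _;
    exact: le_trans (ler_norm _) (adm_g_le adm _).
by rewrite pathEZ; apply: ler_wpM2l; rewrite ?adm_C_ge0 ?pathE_expr_pos.
Qed.

Definition mart_incr x d := g (step x d) - g x + F x - phi.

(** The martingale [g(Phi(n)) - g(x) + S_n - n phi], with the increments of
    the steps taken from above level [h] left out. It is still a martingale,
    and truncation is needed because the increments are of size [b ^ x], whose
    square need not be integrable for the geometric law. *)
Fixpoint mart h x (s : seq bool) : R :=
  if s is d :: t then
    (if (x <= h)%N then mart_incr x d else 0) + mart h (step x d) t
  else 0.

Fixpoint stays_low h x (s : seq bool) : bool :=
  (x <= h)%N && (if s is d :: t then stays_low h (step x d) t else true).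

Lemma stays_low_pos h x s : stays_low h x s -> (pos x s <= h)%N.
Proof. by elim: s x => [|d s IH] x /= /andP[// _ /IH]. Qed.

Lemma mart_low h x s : stays_low h x s ->
  mart h x s = g (pos x s) - g x + cost F x s - (size s)%:R * phi.
Proof.
elim: s x => [|d s IH] x /=; first by rewrite subrr mul0r addr0 subr0.
by move=> /andP[-> /IH ->]; rewrite /mart_incr -natr1; ring.
Qed.

Lemma pathE_mart h n x : pathE alpha n (mart h x) = 0.
Proof.
elim: n x => [//|n IH] x /=.
rewrite !pathED !pathE_cst !IH !addr0; case: ifP => _; last by ring.
by rewrite /mart_incr /=; have := adm_poisson adm x; lra.
Qed.

Let Kincr := C * (b + 2) + phi.

Lemma mart_incr_le x d : mart_incr x d ^+ 2 <= Kincr ^+ 2 * (b ^+ x * b ^+ x).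
Proof.
have H : `|mart_incr x d| <= Kincr * b ^+ x.
  have hs : `|g (step x d)| <= C * b * b ^+ x.
    apply: (le_trans (adm_g_le adm _)); rewrite -mulrA ler_wpM2l ?adm_C_ge0//.
    rewrite -exprS ler_weXn2l ?(ltW b1)//; case: d => /=; lia.
  have hg := adm_g_le adm x; have hF := adm_F_le adm x; have F0 := F_ge0 x.
  have hphi : phi <= phi * b ^+ x.
    by rewrite ler_peMr ?(ltW adm_phi_gt0)//.
  have p0 := adm_phi_gt0.
  rewrite /mart_incr /Kincr.
  have -> : (C * (b + 2) + phi) * b ^+ x =
    C * b * b ^+ x + C * b ^+ x + C * b ^+ x + phi * b ^+ x by ring.
  move: hs hg; rewrite !ler_norml => /andP[? ?] /andP[? ?].
  by apply/andP; split; lra.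
rewrite -real_normK ?num_real//.
have -> : Kincr ^+ 2 * (b ^+ x * b ^+ x) = (Kincr * b ^+ x) ^+ 2 by ring.
by rewrite ler_sqr ?nnegrE ?(le_trans _ H).
Qed.

(** Orthogonality of the increments; from below level [h] each of them has a
    square of size at most [b ^ h * b ^ x], and [b ^ x] is a Lyapunov
    function. *)
Lemma pathE_mart_sqr : exists2 K, 0 < K & forall h n x,
  pathE alpha n (fun s => mart h x s ^+ 2) <= K * b ^+ h * (b ^+ x + n%:R).
Proof.
have [K K0 HK] := drift_accumulation halpha b1 ab.
exists ((Kincr ^+ 2 + 1) * K) => [|h n x].
  by rewrite mulr_gt0// ltr_wpDl// sqr_ge0.
have := HK (Kincr ^+ 2 * b ^+ h)
  (fun n x => pathE alpha n (fun s => mart h x s ^+ 2)).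
have c0 : 0 <= Kincr ^+ 2 * b ^+ h.
  by rewrite mulr_ge0 ?sqr_ge0// (le_trans ler01).
move=> /(_ c0) H.
apply: (@le_trans _ _ (Kincr ^+ 2 * b ^+ h * (K * (b ^+ x + n%:R))));
  last first.
  have -> : (Kincr ^+ 2 + 1) * K * b ^+ h * (b ^+ x + n%:R) =
    (Kincr ^+ 2 * b ^+ h * (K * (b ^+ x + n%:R))) + K * b ^+ h * (b ^+ x +
      n%:R).
    by ring.
  by rewrite lerDl !mulr_ge0 ?addr_ge0// ?exprn_ge0 ?(ltW K0) ?(ltW b0).
apply: H => [{}x|{}n {}x] /=.
  by rewrite expr0n /= mulr_ge0// (le_trans ler01).
have sq c y : pathE alpha n (fun s => (c + mart h y s) ^+ 2) =
   c ^+ 2 + pathE alpha n (fun s => mart h y s ^+ 2).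
  rewrite (@eq_pathE _ _ _ _ (fun s => c ^+ 2 + (2 * c * mart h y s + mart h y
    s ^+ 2))).
    by rewrite !pathED pathE_cst pathEZ pathE_mart mulr0 add0r.
  by move=> s _; ring.
rewrite !sq /=.
set e1 := pathE _ _ _; set e2 := pathE _ _ _.
have -> (u v : R) : alpha * (u + e1) + (1 - alpha) * (v + e2) =
  (alpha * u + (1 - alpha) * v) + (alpha * e1 + (1 - alpha) * e2) by ring.
rewrite lerD2r; move/andP: a01 => [a0 a1].
suff E d : (if (x <= h)%N then mart_incr x d else 0) ^+ 2 <= Kincr ^+ 2 * b ^+
  h * b ^+ x.
  have E1 := E true; have E2 := E false.
  apply: (@le_trans _ _ (alpha * (Kincr ^+ 2 * b ^+ h * b ^+ x)
     + (1 - alpha) * (Kincr ^+ 2 * b ^+ h * b ^+ x))).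
    by apply: lerD; apply: ler_wpM2l; rewrite ?subr_ge0// ltW.
  by rewrite -mulrDl subrKC mul1r.
case: ifP => xh; last first.
  by rewrite expr0n /= mulr_ge0// (le_trans ler01).
apply: (le_trans (mart_incr_le x d)).
rewrite -mulrA ler_wpM2l ?sqr_ge0// ler_wpM2r ?(le_trans ler01)//.
by rewrite ler_weXn2l// ltW.
Qed.

Context (z : R).
Hypotheses (bz : b < z) (az : alpha * z < 1 - alpha).
Let z1 : 1 < z. Proof. exact: lt_trans b1 bz. Qed.
Let z0 : 0 < z. Proof. exact: lt_trans ltr01 z1. Qed.

(** Markov's inequality for [z ^ x], summed over the times of exit. *)
Lemma pathP_leaves_low : exists2 K, 0 < K & forall h n x,
  pathP alpha n (fun s => ~~ stays_low h x s) <= K * (z ^+ x + n%:R) / z ^+ h.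
Proof.
have [K K0 HK] := drift_accumulation halpha z1 az.
exists K => // h n x; rewrite mulrC.
have zh0 : 0 < z ^+ h by rewrite exprn_gt0.
have zx0 y : 0 < z ^+ y by rewrite exprn_gt0.
apply: (HK (z ^+ h)^-1 (fun n x => pathP alpha n (fun s => ~~ stays_low h x
  s))).
- by rewrite invr_ge0 ltW.
- move=> y; rewrite /pathP /= andbT -ltnNge.
  case: ltnP => hy; last by rewrite mulr_ge0// ?invr_ge0 ltW.
  by rewrite mulrC ler_pdivlMr// mul1r ler_weXn2l ?(ltW z1)// ltnW.
- move=> {}n y; rewrite /pathP /=; move/andP: a01 => [a0 a1].
  case: (leqP y h) => yh /=.
    by rewrite lerDr mulr_ge0// ?invr_ge0 ltW.
  rewrite !pathE_cst.
  apply: (@le_trans _ _ ((z ^+ h)^-1 * z ^+ y)).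
    rewrite !mulr1 addrC subrK mulrC ler_pdivlMr// mul1r.
    by rewrite ler_weXn2l ?(ltW z1)// ltnW.
  rewrite lerDl; apply: addr_ge0; apply: mulr_ge0;
    rewrite ?subr_ge0 ?(ltW a0) ?(ltW a1)//;
  by apply: pathP_ge0.
Qed.

(** Chebyshev's inequality for the martingale truncated at level [h], on the
    event that the chain stays below [h]. *)
Lemma deviation_le x : exists2 K, 0 < K & forall h n delta,
  0 < delta -> (0 < n)%N -> K * b ^+ h <= delta * n%:R ->
  pathP alpha n (fun s => delta * n%:R <= `|cost F x s - n%:R * phi|) <=
  K * (n.+1%:R / z ^+ h + b ^+ h * n.+1%:R / (delta * n%:R) ^+ 2).
Proof.
have [K1 K10 HK1] := pathE_mart_sqr.
have [K2 K20 HK2] := pathP_leaves_low.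
have zx1 : 1 <= z ^+ x by rewrite exprn_ege1// ltW.
have C0 := adm_C_ge0.
pose K := 2 * (C * (b ^+ x + 1)) + 4 * K1 * b ^+ x + K2 * z ^+ x.
have bx := expb_ge1 x.
have K_1 : 2 * (C * (b ^+ x + 1)) <= K.
  by rewrite /K -addrA lerDl addr_ge0// !mulr_ge0// ?ltW//; lra.
have K_2 : 4 * K1 * b ^+ x <= K.
  rewrite /K -addrA addrCA lerDl addr_ge0// !mulr_ge0 ?addr_ge0// ?ltW//; lra.
have K_3 : K2 * z ^+ x <= K.
  rewrite /K lerDr addr_ge0// !mulr_ge0 ?addr_ge0// ?ltW//; lra.
have K0 : 0 < K by rewrite (lt_le_trans _ K_3)// mulr_gt0//; lra.
exists K => // h n delta d0 n0 Kh.
have zh0 : 0 < z ^+ h by rewrite exprn_gt0.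
have dn0 : 0 < delta * n%:R by rewrite mulr_gt0// ltr0n.
have bh := expb_ge1 h.
apply: (@le_trans _ _ (pathP alpha n (fun s => ~~ stays_low h x s ||
   ((delta * n%:R / 2) ^+ 2 <= mart h x s ^+ 2)))).
  apply: (sub_pathP a01) => s ss dev.
  case: (boolP (stays_low h x s)) => //= lo.
  rewrite -[leRHS]real_normK ?num_real// ler_sqr ?nnegrE ?divr_ge0 ?(ltW dn0)//.
  rewrite (mart_low lo) ss.
  have gx := adm_g_le adm x.
  have gp : `|g (pos x s)| <= C * b ^+ h.
    rewrite (le_trans (adm_g_le adm _))// ler_wpM2l// ler_weXn2l ?(ltW b1)//.
    exact: stays_low_pos lo.
  have Kd : C * b ^+ x + C * b ^+ h <= delta * n%:R / 2.
    rewrite ler_pdivlMr// (le_trans _ Kh)//.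
    apply: (le_trans _ (ler_wpM2r _ K_1)); last by lra.
    have -> : 2 * (C * (b ^+ x + 1)) * b ^+ h =
      (C * (b ^+ x * b ^+ h) + C * b ^+ h) * 2 by ring.
    rewrite ler_wpM2r// lerD2r ler_wpM2l// ler_peMr//; lra.
  have -> : g (pos x s) - g x + cost F x s - n%:R * phi =
    (cost F x s - n%:R * phi) - (g x - g (pos x s)) by ring.
  apply: (le_trans _ (lerB_dist _ _)).
  have := ler_normB (g x) (g (pos x s)); lra.
apply: (le_trans (pathPU a01 _ _ _)); rewrite mulrDr; apply: lerD.
  apply: (le_trans (HK2 h n x)).
  rewrite mulrA ler_pM2r ?invr_gt0//.
  apply: (@le_trans _ _ (K2 * z ^+ x * n.+1%:R)).
    rewrite -mulrA ler_wpM2l ?(ltW K20)// -natr1 mulrDr mulr1 addrC lerD2r.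
    by rewrite ler_peMl.
  by rewrite ler_wpM2r.
apply: (le_trans (pathP_markov a01 _ _ _)).
- by rewrite exprn_gt0// divr_gt0.
- by move=> s; rewrite sqr_ge0.
have -> : ((delta * n%:R / 2) ^+ 2)^-1 = 4 / (delta * n%:R) ^+ 2.
  by field; rewrite gt_eqF ?ltr0n// gt_eqF.
rewrite mulrAC mulrA ler_pM2r ?invr_gt0 ?exprn_gt0// mulrC.
apply: (@le_trans _ _ (K1 * b ^+ h * (b ^+ x + n%:R) * 4)).
  by rewrite ler_wpM2r.
have -> : K1 * b ^+ h * (b ^+ x + n%:R) * 4 =
  (4 * K1) * (b ^+ x + n%:R) * b ^+ h by ring.
rewrite (mulrC (b ^+ h)) mulrA ler_wpM2r//; first lra.
apply: (@le_trans _ _ (4 * K1 * b ^+ x * n.+1%:R)); last by rewrite ler_wpM2r.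
rewrite -(mulrA _ (b ^+ x)) ler_wpM2l ?mulr_ge0 ?(ltW K10)//.
by rewrite -natr1 mulrDr mulr1 addrC lerD2r ler_peMl.
Qed.

End moments.

(** * Exponential rates *)

Section growth.
Context {R : realType}.
Implicit Types (f : nat -> R) (p q : nat -> R).

Lemma near_natM (K e : R) : 0 < e -> \forall n \near \oo, K <= n%:R * e.
Proof.
move=> e0; near=> n; rewrite -ler_pdivrMr//.
by near: n; exact: nbhs_infty_ger.
Unshelve. all: by end_near. Qed.

Lemma ler_natM_bounded (x y K : R) :
  (forall n, n%:R * x <= n%:R * y + K) -> x <= y.
Proof.
move=> H; rewrite leNgt; apply/negP => yx.
have xy0 : 0 < x - y by rewrite subr_gt0.
have [N _ HN] := near_natM (K + 1) xy0.
by have := HN N (leqnn N); have := H N; rewrite /= mulrBr; lra.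
Qed.

Lemma near_exp_le (K e : R) : 0 < e -> 0 < K ->
  \forall n \near \oo, expR (- n%:R * e) <= K.
Proof.
move=> e0 K0; near=> n.
rewrite -[K in leRHS]lnK ?posrE// ler_expR mulNr -[ln K]opprK lerN2.
by near: n; exact: near_natM.
Unshelve. all: by end_near. Qed.

Lemma near_exp_ge_lin (K e : R) : 0 < e ->
  \forall n \near \oo, K * n.+1%:R <= expR (n%:R * e).
Proof.
move=> e0; near=> n.
have n1 : (1 : R) <= n%:R.
  by near: n; exact: nbhs_infty_ger.
have nK : 8 * `|K| <= n%:R * (e * e).
  by near: n; apply: near_natM; rewrite mulr_gt0.
have -> : n%:R * e = n%:R * e / 2 + n%:R * e / 2 by field.
rewrite expRD.
have h := expR_ge1Dx (n%:R * e / 2).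
have h0 : 0 <= n%:R * e / 2 by rewrite divr_ge0// mulr_ge0 ?ltW//; lra.
apply: (@le_trans _ _ ((n%:R * e / 2) * (n%:R * e / 2))); last first.
  by apply: ler_pM => //; apply: le_trans h; rewrite lerDr.
apply: (@le_trans _ _ (`|K| * n.+1%:R)); first by rewrite ler_wpM2r// ler_norm.
apply: (@le_trans _ _ (`|K| * (2 * n%:R))).
  by rewrite ler_wpM2l// -natr1; lra.
have -> : n%:R * e / 2 * (n%:R * e / 2) = n%:R * (n%:R * (e * e)) / 4 by field.
by nra.
Unshelve. all: by end_near. Qed.

Section superadditive.
Variable f : nat -> R.
Hypothesis fD : forall m n, f m + f n <= f (m + n)%N.
Hypothesis f0 : 0 <= f 0%N.

(** Fekete's argument, with a bounded error: cut [n] into blocks of length [N]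
    and treat the remainder one unit at a time. *)
Lemma superadditive_lower N : (0 < N)%N ->
  exists K, forall n, n%:R * (f N / N%:R) - K <= f n.
Proof.
move=> N0; exists (N%:R * `|f N / N%:R - f 1%N|) => n.
have mul (q : nat) : q%:R * f N <= f (q * N)%N.
  elim: q => [|q IH]; first by rewrite mul0r mul0n.
  by rewrite mulSnr -natr1 mulrDl mul1r; apply: (le_trans _ (fD _ _));
    rewrite lerD2r.
have add m r : f m + r%:R * f 1%N <= f (m + r)%N.
  elim: r => [|r IH]; first by rewrite mul0r addr0 addn0.
  rewrite -natr1 mulrDl mul1r addrA addnS -(addn1 (m + r)).
  by apply: (le_trans _ (fD _ _)); rewrite lerD2r.
rewrite (divn_eq n N); set q := (n %/ N)%N; set r := (n %% N)%N.
apply: (le_trans _ (add _ _)); apply: (le_trans _ (lerD (mul q) (lexx _))).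
have rN : (r%:R : R) <= N%:R by rewrite ler_nat ltnW// ltn_mod.
rewrite natrD natrM mulrDl.
have -> : q%:R * N%:R * (f N / N%:R) = q%:R * f N.
  by field; rewrite pnatr_eq0 -lt0n.
rewrite -addrA lerD2l lerBlDr -lerBlDl -mulrBr.
apply: (@le_trans _ _ (r%:R * `|f N / N%:R - f 1%N|)).
  by rewrite ler_wpM2l// ler_norm.
by rewrite ler_wpM2r.
Qed.

End superadditive.

(** The exponential growth rate of a supermultiplicative sequence, as the
    supremum that Fekete's lemma shows to be a limit. *)
Definition growth f : R := sup (range (fun n => ln (f n.+1) / n.+1%:R)).

Section supermultiplicative.
Variable f : nat -> R.
Hypothesis f_gt0 : forall n, 0 < f n.
Hypothesis fM : forall m n, f m * f n <= f (m + n)%N.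
Hypothesis f0 : f 0%N = 1.

Lemma supermul_lower N : (0 < N)%N ->
  exists K, forall n, n%:R * (ln (f N) / N%:R) - K <= ln (f n).
Proof.
apply: (@superadditive_lower (fun n => ln (f n))); last by rewrite f0 ln1.
move=> m n; rewrite -lnM ?posrE ?f_gt0//.
by rewrite ler_ln ?posrE ?f_gt0// mulr_gt0.
Qed.

Hypothesis f_le1 : forall n, f n <= 1.

Let ubG : has_ubound (range (fun n => ln (f n.+1) / n.+1%:R)).
Proof.
exists 0 => _ [n _ <-].
by rewrite pmulr_lle0 ?invr_gt0 ?ltr0n// -ln1 ler_ln ?posrE ?f_gt0.
Qed.

Lemma growth_ge n : ln (f n) <= n%:R * growth f.
Proof.
case: n => [|n]; first by rewrite f0 ln1 mul0r.
rewrite mulrC -ler_pdivrMr ?ltr0n//.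
by apply: ub_le_sup => //; exists n.
Qed.

Lemma supermul_le_growth n : f n <= expR (n%:R * growth f).
Proof. by rewrite -[f n]lnK ?posrE ?f_gt0// ler_expR growth_ge. Qed.

Lemma growth_le0 : growth f <= 0.
Proof.
apply: ge_sup; first by exists (ln (f 1) / 1); exists 0%N.
move=> _ [n _ <-].
by rewrite pmulr_lle0 ?invr_gt0 ?ltr0n// -ln1 ler_ln ?posrE ?f_gt0.
Qed.

Lemma growth_lower e : 0 < e ->
  exists K, forall n, n%:R * (growth f - e) - K <= ln (f n).
Proof.
move=> e0.
have [_ [N _ <-] HN] := @sup_adherent _
  (range (fun n => ln (f n.+1) / n.+1%:R)) e e0
  (conj (ex_intro _ _ (ex_intro2 _ _ 0%N I erefl)) ubG).
have [K HK] := @supermul_lower N.+1 isT.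
exists K => n; apply: le_trans (HK n); rewrite lerD2r ler_wpM2l//.
exact: ltW.
Qed.

Lemma growth_le_of_bound v K : (forall n, f n <= K * expR (n%:R * v)) ->
  growth f <= v.
Proof.
move=> H; rewrite -[v]addr0; apply/ler_addgt0Pr => e e0; rewrite addr0.
have K0 : 0 < K.
  by have := H 0%N; rewrite mul0r expR0 mulr1 f0; apply: lt_le_trans.
have [K' HK'] := growth_lower e0.
have : forall n, n%:R * (growth f - e) <= n%:R * v + (ln K + K').
  move=> n; have := HK' n.
  have : ln (f n) <= ln K + n%:R * v.
    rewrite -[X in _ + X]expRK -lnM ?posrE ?expR_gt0//.
    by rewrite ler_ln ?posrE ?f_gt0// mulr_gt0 ?expR_gt0.
  lra.
move/ler_natM_bounded; lra.
Qed.

End supermultiplicative.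

(** The two halves of [ln (p n) / n --> - v]. They are kept apart because each
    is monotone in [p]: lower bounds come from forcing paths, upper bounds from
    Chernoff's inequality. *)
Definition decays_at_most p v := forall e, 0 < e ->
  \forall n \near \oo, expR (- n%:R * (v + e)) <= p n.

Definition decays_at_least p v := forall e, 0 < e ->
  \forall n \near \oo, p n <= expR (- n%:R * (v - e)).

Lemma decays_at_most_le p q v : (\forall n \near \oo, p n <= q n) ->
  decays_at_most p v -> decays_at_most q v.
Proof.
move=> pq H e e0; near=> n; apply: (@le_trans _ _ (p n)); near: n => //.
exact: H.
Unshelve. all: by end_near. Qed.

Lemma decays_at_least_le p q v : (\forall n \near \oo, p n <= q n) ->
  decays_at_least q v -> decays_at_least p v.
Proof.
move=> pq H e e0; near=> n; apply: (@le_trans _ _ (q n)); near: n => //.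
exact: H.
Unshelve. all: by end_near. Qed.

Lemma decays_at_most_lim p v : (forall e, 0 < e -> decays_at_most p (v + e)) ->
  decays_at_most p v.
Proof.
move=> H e e0; have e20 : 0 < e / 2 by rewrite divr_gt0.
have := H _ e20 _ e20; apply: filterS => n.
by rewrite -addrA -splitr.
Qed.

Lemma decays_at_most_weaken p v v' : v <= v' ->
  decays_at_most p v -> decays_at_most p v'.
Proof.
move=> vv' H e e0; apply: filterS (H e e0) => n; apply: le_trans.
by rewrite ler_expR !mulNr lerN2 ler_wpM2l// lerD2r.
Qed.

Lemma decays_at_least_weaken p v v' : v' <= v ->
  decays_at_least p v -> decays_at_least p v'.
Proof.
move=> vv' H e e0; apply: filterS (H e e0) => n /le_trans; apply.
by rewrite ler_expR !mulNr lerN2 ler_wpM2l// lerD2r.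
Qed.

Lemma decays_at_most_bound p v c : 0 < c ->
  (\forall n \near \oo, c * expR (- n%:R * v) <= p n) -> decays_at_most p v.
Proof.
move=> c0 H e e0; near=> n.
apply: (@le_trans _ _ (c * expR (- n%:R * v))); last by near: n.
rewrite mulrDr expRD mulrC ler_wpM2r ?expR_ge0//.
by near: n; exact: near_exp_le.
Unshelve. all: by end_near. Qed.

Lemma decays_at_most_shift p v c k : 0 < c ->
  decays_at_most p v -> decays_at_most (fun n => c * p (n - k)%N) v.
Proof.
move=> c0 H; apply: decays_at_most_lim => e e0.
apply: (@decays_at_most_bound _ _ (c * expR (k%:R * (v + e)))).
  by rewrite mulr_gt0 ?expR_gt0.
have [N _ HN] := H e e0; near=> n.
have kn : (k <= n)%N by near: n; exact: nbhs_infty_ge.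
have Nn : (N <= n - k)%N.
  by have : (N + k <= n)%N by [near: n; exact: nbhs_infty_ge]; lia.
rewrite -mulrA ler_wpM2l ?(ltW c0)// -expRD.
apply: le_trans (HN _ Nn); rewrite ler_expR natrB//.
by rewrite le_eqVlt; apply/orP; left; apply/eqP; ring.
Unshelve. all: by end_near. Qed.

Lemma decays_at_most_sub p q v v' : v < v' ->
  decays_at_most p v -> decays_at_least q v' ->
  decays_at_most (fun n => p n - q n) v.
Proof.
move=> vv' Hp Hq; apply: decays_at_most_lim => e e0.
pose d := Num.min e ((v' - v) / 3).
have d0 : 0 < d by rewrite lt_min e0 divr_gt0// subr_gt0.
have dv : d <= (v' - v) / 3 by rewrite ge_min lexx orbT.
have de : d <= e by rewrite ge_min lexx.
apply: (@decays_at_most_bound _ _ (1 / 2)) => //.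
near=> n.
have h1 : expR (- n%:R * (v + d)) <= p n by near: n; exact: Hp.
have h2 : q n <= expR (- n%:R * (v' - d)) by near: n; exact: Hq.
have h3 : expR (- n%:R * (v' - v - 2 * d)) <= 1 / 2.
  by near: n; apply: near_exp_le => //; lra.
have h4 : expR (- n%:R * (v' - d)) <= 1 / 2 * expR (- n%:R * (v + d)).
  have -> : - n%:R * (v' - d) = - n%:R * (v' - v - 2 * d) + - n%:R * (v + d).
    by ring.
  by rewrite expRD ler_wpM2r// expR_ge0.
have h5 : expR (- n%:R * (v + e)) <= expR (- n%:R * (v + d)).
  by rewrite ler_expR !mulNr lerN2 ler_wpM2l// lerD2l.
lra.
Unshelve. all: by end_near. Qed.

Lemma decays_at_least_lin p v K :
  (forall n, p n <= K * n.+1%:R * expR (- n%:R * v)) -> decays_at_least p v.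
Proof.
move=> H e e0; near=> n; apply: (le_trans (H n)).
have -> : - n%:R * (v - e) = n%:R * e + - n%:R * v by ring.
rewrite expRD ler_wpM2r ?expR_ge0//.
by near: n; exact: near_exp_ge_lin.
Unshelve. all: by end_near. Qed.

End growth.

(** * Deviations between consecutive powers *)

Section subsequence.
Context {R : realType}.

Lemma exprn_unbounded (y K : R) : 1 < y -> exists n, K <= y ^+ n.
Proof.
move=> y1; have [N _ HN] := @near_natM R K (ln y) (ln_gt0 y1).
exists N; apply: (le_trans (HN N (leqnn N))).
have y0 : 0 < y by lra.
apply: (@le_trans _ _ (expR (N%:R * ln y))); last first.
  by rewrite expRM_natl lnK.
by apply: le_trans (expR_ge1Dx _); rewrite lerDr.
Qed.

Lemma exists_root (q n N : nat) : (0 < q)%N -> (N.+1 ^ q <= n)%N ->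
  exists2 k, (N < k)%N & (k ^ q <= n < k.+1 ^ q)%N.
Proof.
move=> q0 Nn; have ex_k : exists k, (n < k.+1 ^ q)%N.
  exists n; apply: (@leq_trans (n.+1 ^ 1)); first by rewrite expn1.
  exact: leq_pexp2l.
case: (ex_minnP ex_k) => k nk mink.
have Nk : (N < k)%N.
  rewrite ltnNge; apply/negP => kN.
  have : (k.+1 ^ q <= N.+1 ^ q)%N by rewrite leq_exp2r.
  by rewrite leqNgt (leq_ltn_trans Nn nk).
exists k => //; rewrite nk andbT leqNgt; apply/negP => kn.
have k0 : (0 < k)%N by rewrite (leq_ltn_trans _ Nk).
by have := mink k.-1; rewrite prednK// => /(_ kn); lia.
Qed.

(** A truncation level [h] for which both error terms of [deviation_le],
    [b ^ h / n] and [n / z ^ h], are of order [k ^ - 2].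
      With [y ^ 5 = z / b] and
    [q] the least exponent such that [b <= y ^ (q - 2)], one has
    [y ^ (q + 2) <= z], and the integer part of [log_y k] is such a level. *)
Lemma exists_truncation_level (b z : R) : 1 < b -> b < z ->
  exists q, (0 < q)%N /\ exists2 K, 0 < K & forall k n : nat, (0 < k)%N ->
    (k ^ q <= n < k.+1 ^ q)%N -> exists h : nat,
      b ^+ h * k%:R ^+ 2 <= n%:R /\ n%:R * k%:R ^+ 2 <= K * z ^+ h.
Proof.
move=> b1 bz; have b0 : 0 < b by lra.
pose y := expR (ln (z / b) / 5).
have y5 : y ^+ 5 = z / b.
  rewrite /y -expRM_natl mulrC divfK ?pnatr_eq0// lnK// posrE divr_gt0//.
  by lra.
have y1 : 1 < y.
  by rewrite expR_gt1 divr_gt0// ln_gt0// ltr_pdivlMr// mul1r.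
have y0 : 0 < y by lra.
have yX0 i : 0 < y ^+ i by rewrite exprn_gt0.
have ex_m : exists m, b <= y ^+ m by exact: exprn_unbounded.
case: (ex_minnP ex_m) => m bm minm.
have m0 : (0 < m)%N.
  by rewrite lt0n; apply: contraL bm => /eqP ->; rewrite expr0 -ltNge.
have ym1 : y ^+ m.-1 < b.
  rewrite ltNge; apply/negP => /minm; lia.
have yz : y ^+ m.+4 <= z.
  have -> : m.+4 = (m.-1 + 5)%N by lia.
  rewrite exprD y5; apply: (@le_trans _ _ (b * (z / b))).
    by rewrite ler_wpM2r ?(ltW ym1)// divr_ge0; lra.
  by rewrite mulrCA divff ?mulr1// gt_eqF.
exists m.+2; split => //; exists (y ^+ m.+4 * 2 ^+ m.+2) => [|k n k0 /andP[kn
  nk]].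
  by rewrite mulr_gt0// exprn_gt0.
have kR0 : (0 : R) < k%:R by rewrite ltr0n.
have ex_h : exists h, (k%:R : R) < y ^+ h.+1.
  have [h kh] := @exprn_unbounded y (k%:R) y1.
  by exists h; rewrite (le_lt_trans kh)// ltr_eXn2l.
case: (ex_minnP ex_h) => h kh minh; exists h.
have hk : y ^+ h <= k%:R.
  case: h kh minh => [|h] kh minh; first by rewrite expr0 ler1n.
  by rewrite leNgt; apply/negP => /minh; rewrite ltnn.
split.
  apply: (@le_trans _ _ ((k ^ m.+2)%:R)); last by rewrite ler_nat.
  have -> : ((k ^ m.+2)%:R : R) = k%:R ^+ m * k%:R ^+ 2.
    by rewrite natrX -exprD addn2.
  rewrite ler_wpM2r ?exprn_ge0//.
  have yX0' i : 0 <= y ^+ i by rewrite ltW.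
  apply: (@le_trans _ _ ((y ^+ m) ^+ h)).
    by apply: lerXn2r; rewrite ?nnegrE ?(ltW b0).
  by rewrite exprAC; apply: lerXn2r; rewrite ?nnegrE.
apply: (@le_trans _ _ (2 ^+ m.+2 * k%:R ^+ m.+2 * k%:R ^+ 2)).
  rewrite ler_wpM2r ?exprn_ge0// -exprMn.
  apply: (@le_trans _ _ ((k.+1 ^ m.+2)%:R)); first by rewrite ler_nat ltnW.
  rewrite natrX lerXn2r ?nnegrE ?mulr_ge0//.
  by rewrite -natr1 mulrDl mul1r lerD2l ler1n.
have -> : y ^+ m.+4 * 2 ^+ m.+2 * z ^+ h = 2 ^+ m.+2 * (y ^+ m.+4 * z ^+ h).
  by ring.
rewrite -(mulrA (2 ^+ _)) -exprD addn2 ler_wpM2l ?exprn_ge0//.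
apply: (@le_trans _ _ ((y ^+ h.+1) ^+ m.+4)).
  by apply: lerXn2r; rewrite ?nnegrE// ltW.
rewrite exprAC (exprS (y ^+ _)) ler_wpM2l ?(ltW (yX0 _))//.
by apply: lerXn2r; rewrite ?nnegrE//; [exact: ltW|lra].
Qed.

Context (alpha : R) (F g : nat -> R) (phi b C : R).
Hypothesis halpha : 0 < alpha < 2^-1.
Hypothesis adm : admissible alpha F g phi b C.

(** A bound that is summable along [n = k ^ q] serves Borel-Cantelli; that it
    also holds between consecutive powers gives the weak law. *)
Lemma deviation_subseq x : exists q, (0 < q)%N /\
  forall delta, 0 < delta -> exists2 K, 0 < K & forall k n, (0 < k)%N ->
  (k ^ q <= n < k.+1 ^ q)%N ->
  pathP alpha n (fun s => delta * n%:R <= `|cost F x s - n%:R * phi|) <=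
  K / k%:R ^+ 2.
Proof.
have b1 := adm_b_gt1 adm; have ab := adm_b_lt adm.
have /andP[a0 a1] := alpha01 halpha.
(* [z] lies strictly between [b] and [1 / rho] *)
pose z := (b + (1 - alpha) / alpha) / 2.
have abz : b < (1 - alpha) / alpha by rewrite ltr_pdivlMr// mulrC.
have bz : b < z by rewrite /z; lra.
have az : alpha * z < 1 - alpha.
  by rewrite mulrC -ltr_pdivlMr// /z; lra.
have [q [q0 [K1 K10 HK1]]] := exists_truncation_level b1 bz.
have [K2 K20 HK2] := deviation_le halpha adm bz az x.
exists q; split => // delta d0.
pose K := K2 / delta + K2 * (2 * K1 + 2 / delta ^+ 2).
have d2 : 0 < delta ^+ 2 by rewrite exprn_gt0.
have Ka : 0 < K2 / delta by rewrite divr_gt0.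
have Kb : 0 < K2 * (2 * K1 + 2 / delta ^+ 2).
  by rewrite mulr_gt0// addr_gt0// ?mulr_gt0// invr_gt0.
exists K => [|k n k0 kn]; first by rewrite addr_gt0.
have kR0 : (0 : R) < k%:R ^+ 2 by rewrite exprn_gt0// ltr0n.
have [h [h1 h2]] := HK1 k n k0 kn.
have n0 : (0 < n)%N by case/andP: kn => kn _;
  rewrite (leq_trans _ kn)// expn_gt0 k0.
have nR0 : (0 : R) < n%:R by rewrite ltr0n.
have z0 : 0 < z by lra.
have zh0 : 0 < z ^+ h by rewrite exprn_gt0.
have [small|big] := leP (K2 * b ^+ h) (delta * n%:R); last first.
  apply: (le_trans (pathP_le1 (alpha01 halpha) _ _)).
  rewrite ler_pdivlMr// mul1r.
  have : delta * (b ^+ h * k%:R ^+ 2) < K2 * b ^+ h.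
    by apply: le_lt_trans big; rewrite ler_wpM2l// ltW.
  rewrite mulrCA [K2 * _]mulrC ltr_pM2l ?exprn_gt0//; last by lra.
  rewrite -ltr_pdivlMl// mulrC => /ltW; rewrite /K; lra.
apply: (le_trans (HK2 h n delta d0 n0 small)).
rewrite /K mulrDl -[leLHS]add0r lerD//; first by rewrite ltW// divr_gt0.
rewrite -(mulrA K2) ler_wpM2l ?(ltW K20)// mulrDl.
have n2 : (n.+1%:R : R) <= 2 * n%:R.
  by rewrite -natr1 mulrDl mul1r lerD2l ler1n.
apply: lerD.
  rewrite ler_pdivrMr// mulrAC ler_pdivlMr//.
  apply: (@le_trans _ _ (2 * (n%:R * k%:R ^+ 2))).
    by rewrite mulrA ler_wpM2r// ltW.
  by rewrite -mulrA ler_wpM2l.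
rewrite ler_pdivrMr ?exprn_gt0 ?mulr_gt0// mulrAC ler_pdivlMr//.
have -> : 2 / delta ^+ 2 * (delta * n%:R) ^+ 2 = n%:R * (2 * n%:R).
  by field; rewrite gt_eqF.
rewrite mulrAC; apply: ler_pM => //; rewrite mulr_ge0// ?exprn_ge0//; lra.
Qed.

Lemma weak_law x delta e : 0 < delta -> 0 < e -> \forall n \near \oo,
  pathP alpha n (fun s => delta * n%:R <= `|cost F x s - n%:R * phi|) <= e.
Proof.
move=> d0 e0; have [q [q0 /(_ _ d0) [K K0 HK]]] := deviation_subseq x.
have [N _ HN] := near_natM K e0.
near=> n.
have Nn : (N.+1 ^ q <= n)%N by near: n; exact: nbhs_infty_ge.
have [k Nk kn] := exists_root q0 Nn.
have k0 : (0 < k)%N by lia.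
apply: (le_trans (HK k n k0 kn)).
rewrite ler_pdivrMr ?exprn_gt0 ?ltr0n//.
have := HN N (leqnn N) => /=; rewrite mulrC => /le_trans; apply.
rewrite ler_wpM2l ?(ltW e0)// -natrX ler_nat.
by nia.
Unshelve. all: by end_near. Qed.

End subsequence.

(** * The rate function and the log moment generating function *)

Section rate.
Context {R : realType} (alpha : R) (F g : nat -> R) (phi b C : R).
Hypothesis halpha : 0 < alpha < 2^-1.
Hypothesis adm : admissible alpha F g phi b C.

Let a01 := alpha01 halpha.
Let rho := alpha / (1 - alpha).
Let F_mono := adm_mono adm.
Let F0_ge0 := adm_ge0 adm.
Let F_ge0 := nondecreasing_ge0 F_mono F0_ge0.
Let F0 : R := F 0%N.
Implicit Types (a c d e y delta : R).
Let alphaC_gt0 : 0 < 1 - alpha.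
Proof. by case/andP: a01 => _; rewrite subr_gt0. Qed.

Lemma weight_le_pathE t (H : seq bool -> R) : (forall s, 0 <= H s) ->
  weight alpha t * H t <= pathE alpha (size t) H.
Proof.
by move=> H0; have /= := pathE_prefix a01 t 0 H0; rewrite cats0 addn0.
Qed.

(** The average of an unbounded nondecreasing function is unbounded. *)
Lemma cost_up_superlinear K : exists h0, forall h, (h0 <= h)%N ->
  K * h%:R <= cost F 0 (nseq h true).
Proof.
have up x n : n%:R * F x <= cost F x (nseq n true).
  elim: n x => [|n IH] x /=; first by rewrite mul0r.
  rewrite -natr1 mulrDl mul1r addrC lerD2l.
  by apply: le_trans (IH _); apply: ler_wpM2l => //; apply: F_mono.
have [k Kk] := adm_unbounded adm (2 * `|K|).
exists (2 * k)%N => h kh.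
have -> : h = (k + (h - k))%N by lia.
rewrite nseqD cost_cat pos_up add0n.
apply: (@le_trans _ _ ((h - k)%:R * F k)); last first.
  by rewrite -[leLHS]add0r; apply: lerD => //; exact: cost_ge0.
apply: (@le_trans _ _ (`|K| * (k + (h - k))%:R)).
  by rewrite ler_wpM2r// ler_norm.
apply: (@le_trans _ _ ((h - k)%:R * (2 * `|K|))); last by rewrite ler_wpM2l.
rewrite mulrA [leRHS]mulrC ler_wpM2l// -natrM ler_nat; lia.
Qed.

Definition pinned_exp a n : R :=
  pathE alpha n (fun s => expR (a * cost F 0 s) * (pos 0 s == 0%N)%:R).

(** Asking the path to return to 0 makes this supermultiplicative, as it does
    for [pinned_exp]: paths from 0 to 0 can be concatenated. *)
Definition pinned_prob c n : R :=
  pathP alpha n (fun s => (cost F 0 s <= n%:R * c) && (pos 0 s == 0%N)).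

Definition free_exp a n : R := pathE alpha n (fun s => expR (a * cost F 0 s)).

(** [Lam a] is the pinned log moment generating function for [a <= 0]; for
    [a > 0] the supremum in [growth] is infinite and [Lam a] has no meaning. *)
Definition Lam a := growth (pinned_exp a).
Definition rate c := - growth (pinned_prob c).

Lemma pinned_exp0 a : pinned_exp a 0 = 1.
Proof. by rewrite /pinned_exp /= mulr0 expR0 mulr1. Qed.

Lemma pinned_exp_gt0 a n : 0 < pinned_exp a n.
Proof.
have := @weight_le_pathE (nseq n false)
  (fun s => expR (a * cost F 0 s) * (pos 0 s == 0%N)%:R).
rewrite size_nseq => H; apply: lt_le_trans (H _); last first.
  by move=> s; rewrite mulr_ge0 ?expR_ge0.
by rewrite pos_down sub0n eqxx mulr1 mulr_gt0 ?weight_gt0 ?expR_gt0.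
Qed.

Lemma pinned_expM a m n :
  pinned_exp a m * pinned_exp a n <= pinned_exp a (m + n).
Proof.
rewrite /pinned_exp pathE_cat mulrC -pathEZ; apply: (ler_pathE a01) => s _.
case: (eqVneq (pos 0 s) 0%N) => [p0|_]; last first.
  by rewrite !mulr0; apply: (pathE_ge0 a01) => t _; rewrite mulr_ge0 ?expR_ge0.
rewrite mulr1 mulrC -pathEZ; apply: (ler_pathE a01) => t _.
by rewrite cost_cat pos_cat p0 mulrDr expRD mulrA.
Qed.

Lemma pinned_exp_le1 a n : a <= 0 -> pinned_exp a n <= 1.
Proof.
move=> a0; rewrite -(pathE_cst alpha n 1); apply: (ler_pathE a01) => s _.
rewrite mulr_ile1 ?expR_ge0 ?lern1 ?leq_b1//.
by rewrite -expR0 ler_expR mulr_le0_ge0// cost_ge0.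
Qed.

Lemma Lam_le0 a : a <= 0 -> Lam a <= 0.
Proof.
move=> a0; apply: growth_le0 => n; first exact: pinned_exp_gt0.
exact: pinned_exp_le1.
Qed.

Lemma pinned_exp_le_Lam a n : a <= 0 -> pinned_exp a n <= expR (n%:R * Lam a).
Proof.
move=> a0; apply: supermul_le_growth => [k||k].
- exact: pinned_exp_gt0.
- exact: pinned_exp0.
- exact: pinned_exp_le1.
Qed.

Lemma pinned_exp_ge_Lam a e : a <= 0 -> 0 < e ->
  exists K, forall n, n%:R * (Lam a - e) - K <= ln (pinned_exp a n).
Proof.
move=> a0; apply: growth_lower.
- exact: pinned_exp_gt0.
- exact: pinned_expM.
- exact: pinned_exp0.
- by move=> n; exact: pinned_exp_le1.
Qed.

Lemma Lam_le_of_bound a v K : a <= 0 ->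
  (forall n, pinned_exp a n <= K * expR (n%:R * v)) -> Lam a <= v.
Proof.
move=> a0; apply: growth_le_of_bound.
- exact: pinned_exp_gt0.
- exact: pinned_expM.
- exact: pinned_exp0.
- by move=> n; exact: pinned_exp_le1.
Qed.

(** For [a > 0] a single high excursion has a cost superlinear in its length,
    so it beats any exponential. *)
Lemma pinned_exp_superexp a M : 0 < a -> exists K, forall n,
  n%:R * M - K <= ln (pinned_exp a n).
Proof.
move=> a0; pose w := alpha * (1 - alpha).
have w0 : 0 < w by rewrite mulr_gt0//; case/andP: a01.
have [h0 Hh] := cost_up_superlinear ((2 * M - ln w) / a).
pose h := h0.+1.
have hh : (0 : R) < h%:R by rewrite ltr0n.
pose e := nseq h true ++ nseq h false.
have se : size e = (h + h)%N by rewrite size_cat !size_nseq.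
have low : h%:R * (2 * M) <= ln (pinned_exp a (h + h)).
  have := @weight_le_pathE e
    (fun s => expR (a * cost F 0 s) * (pos 0 s == 0%N)%:R).
  rewrite se => H; have {H}H := H (fun s => mulr_ge0 (expR_ge0 _) (ler0n _ _)).
  rewrite pos_cat pos_up pos_down add0n subnn eqxx mulr1 in H.
  apply: (@le_trans _ _ (ln (weight alpha e * expR (a * cost F 0 e))));
    last first.
    by rewrite ler_ln ?posrE ?pinned_exp_gt0 ?mulr_gt0 ?weight_gt0 ?expR_gt0.
  rewrite lnM ?posrE ?weight_gt0 ?expR_gt0// expRK.
  have -> : ln (weight alpha e) = h%:R * ln w.
    by rewrite weight_cat !weight_nseq -exprMn lnXn// mulr_natl.
  have := Hh h (leqnSn _).
  have : cost F 0 (nseq h true) <= cost F 0 e.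
    by rewrite cost_cat lerDl; exact: cost_ge0.
  move=> c1 c2; have := le_trans c2 c1.
  rewrite mulrAC ler_pdivrMr// => c3; lra.
have [|K HK] := @supermul_lower _ (pinned_exp a) (pinned_exp_gt0 a)
  (pinned_expM a) (pinned_exp0 a) (h + h)%N; first by [].
exists K => n; apply: le_trans (HK n); rewrite lerD2r ler_wpM2l//.
rewrite ler_pdivlMr ?ltr0n// natrD mulrC; lra.
Qed.

(** Without pinning the generating function is submultiplicative: by
    monotonicity in the starting point, restarting from 0 lowers the cost. *)
Lemma free_exp_sub a m n : a <= 0 ->
  free_exp a (m + n) <= free_exp a m * free_exp a n.
Proof.
move=> a0; rewrite /free_exp pathE_cat mulrC -pathEZ.
apply: (ler_pathE a01) => s _; rewrite mulrC -pathEZ.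
apply: (ler_pathE a01) => t _; rewrite cost_cat mulrDr expRD.
by rewrite ler_wpM2l ?expR_ge0// ler_expR ler_wnM2l// ler_cost.
Qed.

Lemma free_exp_gt0 a n : 0 < free_exp a n.
Proof.
apply: lt_le_trans (pinned_exp_gt0 a n) _; apply: (ler_pathE a01) => s _.
by rewrite ler_piMr ?expR_ge0// lern1 leq_b1.
Qed.

Lemma Lam_le_free a N : a <= 0 -> (0 < N)%N -> Lam a <= ln (free_exp a N) /
  N%:R.
Proof.
move=> a0 N0; set v := _ / _.
have [||K HK] := @superadditive_lower R (fun n => - ln (free_exp a n)) _ _ N N0.
- move=> m n; rewrite -opprD lerN2 -lnM ?posrE ?free_exp_gt0//.
  by rewrite ler_ln ?posrE ?mulr_gt0 ?free_exp_gt0 ?free_exp_sub.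
- by rewrite /free_exp /= mulr0 expR0 ln1 oppr0.
apply: (@Lam_le_of_bound _ _ (expR K)) => // n.
apply: (@le_trans _ _ (free_exp a n)).
  apply: (ler_pathE a01) => s _.
  by rewrite ler_piMr ?expR_ge0// lern1 leq_b1.
rewrite -[leLHS]lnK ?posrE ?free_exp_gt0// -expRD ler_expR.
by have := HK n; rewrite mulNr mulrN -/v; lra.
Qed.

(** Being above a level [K] with [a F(K) <= Lam a] is penalised at least as
    much as [Lam a] allows, so only the part of a path that ends at its last
    visit below [K] matters; from there the chain returns to 0 at a cost that
    does not depend on [n]. *)
Lemma free_exp_le a : a < 0 -> exists K, forall n,
  free_exp a n <= K * n.+1%:R * expR (n%:R * Lam a).
Proof.
move=> a0; have [K HK] := adm_unbounded adm (Lam a / a).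
have {}HK : a * F K <= Lam a.
  by move: HK; rewrite ler_ndivrMr// mulrC.
pose low n := pathE alpha n
  (fun s => expR (a * cost F 0 s) * (pos 0 s <= K)%N%:R).
pose high n := pathE alpha n
  (fun s => expR (a * cost F 0 s) * (K < pos 0 s)%N%:R).
have splitE n : free_exp a n = low n + high n.
  rewrite /low /high -pathED; apply: eq_pathE => s _.
  by rewrite -mulrDr; case: leqP => _ /=; rewrite ?addr0 ?add0r mulr1.
(* a lower bound for the weighted probability of [K] steps straight down *)
pose k := (1 - alpha) ^+ K * expR (a * (K%:R * F K)).
have k0 : 0 < k by rewrite mulr_gt0 ?expR_gt0// exprn_gt0.
have lowP n : low n <= k^-1 * expR (n%:R * Lam a).
  rewrite ler_pdivlMl//.
  apply: (@le_trans _ _ (pinned_exp a (n + K))); last first.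
    apply: (le_trans (pinned_exp_le_Lam _ (ltW a0))).
    by rewrite ler_expR natrD mulrDl gerDl mulr_ge0_le0// Lam_le0// ltW.
  rewrite /pinned_exp pathE_cat -pathEZ; apply: (ler_pathE a01) => s _.
  case: (leqP (pos 0 s) K) => pK; last first.
    rewrite !mulr0; apply: (pathE_ge0 a01) => t _.
    by rewrite mulr_ge0 ?expR_ge0.
  have := @weight_le_pathE (nseq K false)
    (fun t => expR (a * cost F 0 (s ++ t)) * (pos 0 (s ++ t) == 0%N)%:R).
  rewrite size_nseq => H.
  apply: le_trans (H _) => [|t]; last by rewrite mulr_ge0 ?expR_ge0.
  rewrite pos_cat pos_down (_ : pos 0 s - K = 0)%N ?eqxx ?mulr1; last by lia.
  rewrite weight_nseq /k -mulrA ler_wpM2l ?exprn_ge0 ?(ltW alphaC_gt0)//.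
  rewrite cost_cat mulrDr expRD [leLHS]mulrC ler_wpM2l ?expR_ge0// ler_expR.
  rewrite ler_wnM2l ?(ltW a0)//.
  apply: (le_trans (cost_down F_mono F0_ge0 _ _)); apply: ler_wpM2l => //.
  exact: F_mono.
have highS n : high n.+1 <= low n + expR (Lam a) * high n.
  rewrite /high pathE_rcons /low -pathEZ -pathED.
  apply: (ler_pathE a01) => s _.
  rewrite !cost_rcons !pos_rcons mulrDr expRD.
  have E0 := expR_ge0 (a * cost F 0 s).
  have aF : expR (a * F (pos 0 s)) <= 1.
    by rewrite -expR0 ler_expR nmulr_rle0.
  have ab1 (u : R) (b1 b2 : bool) : 0 <= u ->
      alpha * (u * b1%:R) + (1 - alpha) * (u * b2%:R) <= u.
    move=> u0; have /andP[al0 al1] := a01.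
    apply: (@le_trans _ _ (alpha * u + (1 - alpha) * u)); last by lra.
    by apply: lerD; apply: ler_wpM2l; rewrite ?subr_ge0 ?(ltW al0) ?(ltW al1)//
      ler_piMr// lern1 leq_b1.
  apply: (le_trans (ab1 _ _ _ (mulr_ge0 E0 (expR_ge0 _)))).
  case: (leqP (pos 0 s) K) => pK; rewrite ?mulr1 ?mulr0 ?addr0 ?add0r.
    by rewrite ler_piMr.
  rewrite mulrC ler_wpM2r// ler_expR (le_trans _ HK)//.
  by rewrite ler_wnM2l ?(ltW a0)// F_mono// ltnW.
pose k' := k^-1 * expR (- Lam a).
have k'0 : 0 < k' by rewrite mulr_gt0 ?invr_gt0 ?expR_gt0.
have highP n : high n <= n%:R * (k' * expR (n%:R * Lam a)).
  elim: n => [|n IH].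
    by rewrite /high /= !mulr0 mul0r.
  apply: (le_trans (highS n)).
  apply: (@le_trans _ _ (k^-1 * expR (n%:R * Lam a) +
    expR (Lam a) * (n%:R * (k' * expR (n%:R * Lam a))))).
    by apply: lerD => //; rewrite ler_wpM2l ?expR_ge0.
  rewrite -natr1 !mulrDl !mul1r expRD.
  have e1 : expR (- Lam a) * expR (Lam a) = 1 by rewrite -expRD addNr expR0.
  have -> : k^-1 * expR (n%:R * Lam a) =
    k' * (expR (n%:R * Lam a) * expR (Lam a)).
    rewrite (_ : _ * (_ * _) = k^-1 * expR (n%:R * Lam a) *
      (expR (- Lam a) * expR (Lam a))); last by rewrite /k'; ring.
    by rewrite e1 mulr1.
  by rewrite le_eqVlt; apply/orP; left; apply/eqP; ring.
exists (k^-1 + k') => n; rewrite splitE.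
apply: (le_trans (lerD (lowP n) (highP n))).
rewrite mulrA -mulrDl ler_wpM2r ?expR_ge0// -natr1 mulrDl !mulrDr.
have ki : 0 <= k^-1 * n%:R by rewrite mulr_ge0// invr_ge0 ltW.
have : 0 <= k' by exact: ltW.
rewrite mulr1; lra.
Qed.

Let drop_quadratic (t : R) : 0 <= t -> expR (- t) <= 1 - t + t ^+ 2.
Proof.
move=> t0; have e1 := expR_ge1Dx t.
have et : 0 < expR t := expR_gt0 t.
rewrite expRN -div1r ler_pdivrMr//.
apply: (@le_trans _ _ ((1 - t + t ^+ 2) * (1 + t))).
  have -> : (1 - t + t ^+ 2) * (1 + t) = 1 + t ^+ 3 by ring.
  by rewrite lerDl exprn_ge0.
by rewrite ler_wpM2l//; nra.
Qed.

(** A first-order expansion at [a = 0] of [ln E exp(a S_N) / N], for one fixed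
    [N] with [E S_N / N] close to [phi]. *)
Lemma Lam_lt_linear c : c < phi -> exists2 a : R, a < 0 & Lam a < a * c.
Proof.
move=> cphi; pose e := (phi - c) / 2.
have e0 : 0 < e by rewrite divr_gt0// subr_gt0.
have [K HK] := pathE_cost_ge halpha adm 0.
have [N0 _ HN0] := near_natM K e0.
pose N := N0.+1; have HN := HN0 N (leqnSn _).
have NR : (0 : R) < N%:R by rewrite ltr0n.
pose m1 := pathE alpha N (cost F 0).
have m1P : N%:R * (c + e) <= m1.
  apply: le_trans (HK N); move: HN => /=; rewrite /e; lra.
pose M := N%:R * F N + 1.
have M1 : 1 <= M by rewrite lerDr mulr_ge0.
have M2 : 0 < M ^+ 2 by rewrite exprn_gt0//; lra.
(* the quadratic term [t ^ 2 * M ^ 2] then takes half of the gain [t * N * e] *)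
pose t := N%:R * e / 2 / M ^+ 2.
have t0 : 0 < t by rewrite !divr_gt0// mulr_gt0.
exists (- t); first by rewrite oppr_lt0.
have tn : - t <= 0 by rewrite oppr_le0 ltW.
apply: (le_lt_trans (Lam_le_free tn (ltn0Sn N0))).
rewrite ltr_pdivrMr//.
have wle : free_exp (- t) N <= 1 - t * m1 + t ^+ 2 * M ^+ 2.
  have -> : 1 - t * m1 + t ^+ 2 * M ^+ 2 =
      pathE alpha N (fun s => 1 - t * cost F 0 s + t ^+ 2 * M ^+ 2).
    rewrite (@eq_pathE _ _ _ _ (fun s => 1 + (- t * cost F 0 s + t ^+ 2 * M ^+
      2))).
      by rewrite !pathED !pathE_cst pathEZ -/m1; ring.
    by move=> s _; ring.
  apply: (ler_pathE a01) => s ss.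
  have c0 : 0 <= cost F 0 s by exact: cost_ge0.
  have cM : cost F 0 s <= M.
    have := cost_le F_mono F0_ge0 0 s; rewrite ss add0n /M -/N; lra.
  rewrite mulNr; apply: (le_trans (drop_quadratic _)).
    by rewrite mulr_ge0// ltW.
  rewrite lerD2l exprMn ler_wpM2l ?sqr_ge0//.
  by rewrite ler_sqr ?nnegrE// ltW; lra.
have w0 := free_exp_gt0 (- t) N.
have : ln (free_exp (- t) N) <= - t * m1 + t ^+ 2 * M ^+ 2.
  rewrite -ler_expR lnK//; apply: (le_trans wle).
  by apply: le_trans (expR_ge1Dx _); rewrite mulNr addrA.
have -> : t ^+ 2 * M ^+ 2 = t * (N%:R * e / 2).
  by rewrite /t; field; rewrite gt_eqF//; lra.
have : t * (N%:R * (c + e)) <= t * m1 by rewrite ler_wpM2l// ltW.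
have : 0 < t * (N%:R * e / 2) by rewrite mulr_gt0// divr_gt0// mulr_gt0.
move=> h1 h2 h3.
rewrite -/N; lra.
Qed.

Lemma pinned_prob_ge c n : F0 <= c -> (1 - alpha) ^+ n <= pinned_prob c n.
Proof.
move=> Fc; have := @weight_le_pathE (nseq n false)
  (fun s => ((cost F 0 s <= n%:R * c) && (pos 0 s == 0%N))%:R).
rewrite size_nseq => H; apply: le_trans (H _) => //.
rewrite pos_down sub0n eqxx andbT weight_nseq.
suff -> : cost F 0 (nseq n false) <= n%:R * c by rewrite mulr1.
by apply: (le_trans (cost_down F_mono F0_ge0 _ _)); rewrite ler_wpM2l.
Qed.

Lemma pinned_prob_gt0 c n : F0 <= c -> 0 < pinned_prob c n.
Proof. by move=> Fc; apply: lt_le_trans (pinned_prob_ge n Fc);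
  rewrite exprn_gt0. Qed.

Lemma pinned_prob0 c : pinned_prob c 0 = 1.
Proof. by rewrite /pinned_prob /pathP /= mul0r lexx. Qed.

Lemma pinned_prob_le1 c n : pinned_prob c n <= 1.
Proof. exact: pathP_le1. Qed.

Lemma pinned_probM c1 c2 c m n : m%:R * c1 + n%:R * c2 <= (m + n)%:R * c ->
  pinned_prob c1 m * pinned_prob c2 n <= pinned_prob c (m + n).
Proof.
move=> mn; rewrite /pinned_prob /pathP pathE_cat mulrC -pathEZ.
apply: (ler_pathE a01) => s _.
case: (boolP (_ && _)) => [/andP[cs /eqP p0]|_]; last first.
  by rewrite mulr0; apply: (pathE_ge0 a01).
rewrite mulr1; apply: (ler_pathE a01) => t _.
rewrite cost_cat pos_cat p0.
case: (boolP (_ && _)) => [/andP[ct pt]|_]; last by rewrite ler0n.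
by rewrite pt andbT (le_trans _ mn)// lerD.
Qed.

Lemma pinned_probMc c m n :
  pinned_prob c m * pinned_prob c n <= pinned_prob c (m + n).
Proof. by apply: pinned_probM; rewrite natrD mulrDl. Qed.

Lemma rate_ge0 c : F0 <= c -> 0 <= rate c.
Proof.
move=> Fc; rewrite oppr_ge0; apply: growth_le0 => n.
  exact: pinned_prob_gt0.
exact: pinned_prob_le1.
Qed.

Lemma pinned_prob_le_rate c n : F0 <= c ->
  pinned_prob c n <= expR (- n%:R * rate c).
Proof.
move=> Fc; rewrite mulrNN; apply: supermul_le_growth => [k||k].
- exact: pinned_prob_gt0.
- exact: pinned_prob0.
- exact: pinned_prob_le1.
Qed.

Lemma pinned_prob_ge_rate c e : F0 <= c -> 0 < e -> exists K, forall n,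
  - n%:R * (rate c + e) - K <= ln (pinned_prob c n).
Proof.
move=> Fc e0.
have [||||K HK] := @growth_lower _ (pinned_prob c) _ _ _ _ _ e0.
- by move=> n; exact: pinned_prob_gt0.
- exact: pinned_probMc.
- exact: pinned_prob0.
- exact: pinned_prob_le1.
by exists K => n; have := HK n; rewrite /rate; lra.
Qed.

Lemma rate_nonincreasing c c' : F0 <= c -> c <= c' -> rate c' <= rate c.
Proof.
move=> Fc cc'; rewrite lerN2; apply: (@growth_le_of_bound _ _ _ _ _ _ _ 1).
- by move=> n; exact: pinned_prob_gt0.
- exact: pinned_probMc.
- exact: pinned_prob0.
- exact: pinned_prob_le1.
move=> n; rewrite mul1r.
apply: (@le_trans _ _ (pinned_prob c' n)).
  apply: (sub_pathP a01) => s _ /andP[cs ->]; rewrite andbT.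
  by rewrite (le_trans cs)// ler_wpM2l.
apply: supermul_le_growth.
- by move=> k; apply: pinned_prob_gt0; exact: le_trans cc'.
- exact: pinned_prob0.
- exact: pinned_prob_le1.
Qed.

(** Concatenating a path of [n] steps with mean at most [c1] and one of
    [N - n] steps with mean at most [c2] makes the rate convex. *)
Lemma rate_convex3 c1 c c2 : F0 <= c1 -> c1 < c -> c < c2 ->
  (c2 - c1) * rate c <= (c2 - c) * rate c1 + (c - c1) * rate c2.
Proof.
move=> Fc1 c1c cc2; have Fc : F0 <= c by lra.
have Fc2 : F0 <= c2 by lra.
have d0 : 0 < c2 - c1 by lra.
pose t := (c2 - c) / (c2 - c1).
have t0 : 0 <= t by rewrite divr_ge0; lra.
have t1 : t <= 1 by rewrite ler_pdivrMr//; lra.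
suff H : rate c <= t * rate c1 + (1 - t) * rate c2.
  have := ler_wpM2l (ltW d0) H; congr (_ <= _); rewrite /t; field.
  by rewrite gt_eqF.
rewrite -[leRHS]addr0; apply/ler_addgt0Pr => e e0; rewrite addr0.
have [K1 HK1] := pinned_prob_ge_rate Fc1 e0.
have [K2 HK2] := pinned_prob_ge_rate Fc2 e0.
apply: (@ler_natM_bounded _ _ _ (K1 + K2 + (rate c1 + e))) => N.
have Nt0 : 0 <= N%:R * t by rewrite mulr_ge0.
(* just above [t * N], which errs towards the smaller mean [c1] *)
pose n := minn (Num.truncn (N%:R * t)).+1 N.
have nN : (n <= N)%N by rewrite geq_minr.
have /andP[tl tu] := truncn_itv Nt0.
have NtN : N%:R * t <= N%:R by rewrite ler_piMr.
have nlo : N%:R * t <= n%:R.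
  by rewrite /n /minn; case: ifP => _ //; exact: ltW.
have nup : n%:R <= N%:R * t + 1.
  apply: (@le_trans _ _ (Num.truncn (N%:R * t)).+1%:R).
    by rewrite ler_nat geq_minl.
  by rewrite -natr1 lerD2r.
have nm : (n%:R : R) + (N - n)%:R = N%:R by rewrite -natrD subnKC.
have mean : n%:R * c1 + (N - n)%:R * c2 <= (n + (N - n))%:R * c.
  rewrite natrD nm; have -> : (N - n)%:R = N%:R - n%:R :> R by rewrite -nm;
    ring.
  have : N%:R * t * (c2 - c1) <= n%:R * (c2 - c1) by rewrite ler_wpM2r// ltW.
  have -> : N%:R * t * (c2 - c1) = N%:R * (c2 - c).
    by rewrite /t; field; rewrite gt_eqF.
  lra.
have := pinned_probM mean; rewrite subnKC// => mul.
have lmul : ln (pinned_prob c1 n) + ln (pinned_prob c2 (N - n)) <=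
    - (N%:R * rate c).
  rewrite -lnM ?posrE ?pinned_prob_gt0// -ler_expR lnK ?posrE ?mulr_gt0
    ?pinned_prob_gt0//.
  by apply: (le_trans mul); rewrite -mulNr pinned_prob_le_rate.
have h1 := HK1 n; have h2 := HK2 (N - n)%N.
have r1 : n%:R * (rate c1 + e) <= (N%:R * t + 1) * (rate c1 + e).
  by rewrite ler_wpM2r// addr_ge0 ?rate_ge0// ltW.
have r2 : (N - n)%:R * (rate c2 + e) <= (N%:R * (1 - t)) * (rate c2 + e).
  rewrite ler_wpM2r// ?addr_ge0 ?rate_ge0 ?(ltW e0)//; lra.
lra.
Qed.

End rate.

(** * Duality and exponential bounds *)

Section rate_properties.
Context {R : realType} (alpha : R) (F g : nat -> R) (phi b C : R).
Hypothesis halpha : 0 < alpha < 2^-1.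
Hypothesis adm : admissible alpha F g phi b C.

Let a01 := alpha01 halpha.
Let rho := alpha / (1 - alpha).
Let F_mono := adm_mono adm.
Let F0_ge0 := adm_ge0 adm.
Let F_ge0 := nondecreasing_ge0 F_mono F0_ge0.
Let F0 : R := F 0%N.
Implicit Types (a c d e y delta : R).
Let F0_lt : F0 < phi := adm_F0_lt adm.
Let alphaC_gt0 : 0 < 1 - alpha.
Proof. by case/andP: a01 => _; rewrite subr_gt0. Qed.
Local Notation u := (pinned_exp alpha F).
Local Notation p := (pinned_prob alpha F).
Local Notation L := (Lam alpha F).
Local Notation J := (rate alpha F).

Lemma Lam_ge a c : a <= 0 -> F0 <= c -> c * a - L a <= J c.
Proof.
move=> a0 Fc; rewrite -[leRHS]addr0; apply/ler_addgt0Pr => e e0; rewrite addr0.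
have [K HK] := pinned_prob_ge_rate halpha adm Fc e0.
suff : - (J c + e) <= L a - c * a by lra.
apply: (@ler_natM_bounded _ _ _ K) => n.
have h : ln (p c n) + n%:R * (c * a) <= ln (u a n).
  have p0 := pinned_prob_gt0 halpha adm n Fc.
  rewrite -ler_expR expRD !lnK ?posrE ?pinned_exp_gt0//.
  rewrite mulrC /pinned_prob /pathP -pathEZ.
  apply: (ler_pathE a01) => s _.
  case: (boolP (_ && _)) => [/andP[cs ->]|_]; last first.
    by rewrite mulr0 mulr_ge0 ?expR_ge0.
  rewrite !mulr1 ler_expR mulrA mulrC.
  by rewrite ler_wnM2l.
have h1 := HK n.
have h2 : ln (u a n) <= n%:R * L a.
  rewrite -ler_expR lnK ?posrE ?pinned_exp_gt0//.
  exact: (pinned_exp_le_Lam halpha adm).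
by lra.
Qed.

(** A convex function that is finite at [F 0] is left-continuous beyond it. *)
Lemma rate_left_continuous c e : F0 < c -> 0 < e ->
  exists2 d : R, 0 < d & F0 < c - d /\ J (c - d) <= J c + e.
Proof.
move=> Fc e0.
have r0 : 0 <= J F0 by apply: (rate_ge0 halpha adm).
have rc0 : 0 <= J c by apply: (rate_ge0 halpha adm); exact: ltW.
pose d := Num.min ((c - F0) / 2) (e * (c - F0) / (J F0 + 1)).
have cF : 0 < c - F0 by rewrite subr_gt0.
have d0 : 0 < d.
  by rewrite lt_min !divr_gt0 ?mulr_gt0//; lra.
have d1 : d <= (c - F0) / 2 by rewrite ge_min lexx.
have d2 : d * J F0 <= e * (c - F0).
  have : d <= e * (c - F0) / (J F0 + 1) by rewrite ge_min lexx orbT.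
  by rewrite ler_pdivlMr; nra.
exists d => //; split; first by lra.
have h := @rate_convex3 _ _ _ _ _ _ _ halpha adm F0 (c - d) c (lexx _).
have {}h := h ltac:(lra) ltac:(lra).
rewrite -(ler_pM2l cF); nra.
Qed.

(** The weak law together with the positive probability [1 - rho] of being
    at 0. *)
Lemma typical_return delta : 0 < delta -> \forall n \near \oo,
  (1 - rho) / 2 <= pathP alpha n (fun s =>
     (`|cost F 0 s - n%:R * phi| <= delta * n%:R) && (pos 0 s == 0%N)).
Proof.
move=> d0; have r1 := rho_lt1 halpha; rewrite -/rho in r1.
have hr : 0 < (1 - rho) / 2 by rewrite divr_gt0// subr_gt0.
near=> n.
have h1 : pathP alpha n (fun s => delta * n%:R <= `|cost F 0 s - n%:R * phi|)
   <= (1 - rho) / 2 by near: n; exact: (weak_law halpha adm).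
have h2 := pathP_return halpha n; rewrite -/rho in h2.
set good := pathP _ _ _.
suff : pathP alpha n (fun s => pos 0 s == 0%N) <= good +
    pathP alpha n (fun s => delta * n%:R <= `|cost F 0 s - n%:R * phi|) by lra.
apply: le_trans (pathPU a01 _ _ _); apply: (sub_pathP a01) => s _ -> /=.
by rewrite andbT le_total.
Unshelve. all: by end_near. Qed.

(** Means slightly above [phi] are typical, and the value at [phi] itself
    follows by convexity. *)
Lemma rate_eq0 c : phi <= c -> J c = 0.
Proof.
have r1 := rho_lt1 halpha; rewrite -/rho in r1.
have gt_phi c' : phi < c' -> J c' = 0.
  move=> pc; have Fc : F0 <= c' by rewrite ltW// (lt_trans F0_lt).
  apply/eqP; rewrite eq_le; apply/andP; split;
    last exact: (rate_ge0 halpha adm).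
  rewrite leNgt; apply/negP => rc.
  have hr : 0 < (1 - rho) / 4 by rewrite divr_gt0// subr_gt0.
  have [n1 _ H1] := near_exp_le rc hr.
  have d0 : 0 < c' - phi by rewrite subr_gt0.
  have [n2 _ H2] := typical_return d0.
  pose n := maxn n1 n2.
  have := H1 n (leq_maxl _ _); have := H2 n (leq_maxr _ _) => /=.
  have := pinned_prob_le_rate halpha adm n Fc.
  set p1 := pinned_prob _ _ _ _; set p2 := pathP _ _ _.
  suff : p2 <= p1 by lra.
  apply: (sub_pathP a01) => s _ /andP[h ->]; rewrite andbT.
  by move: h; rewrite ler_norml => /andP[_]; lra.
rewrite le_eqVlt => /orP[/eqP <-|/gt_phi //].
apply/eqP; rewrite eq_le; apply/andP; split; last first.
  by apply: (rate_ge0 halpha adm); exact: ltW.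
rewrite -[0]addr0; apply/ler_addgt0Pr => e e0; rewrite add0r.
have r0 : 0 <= J F0 by apply: (rate_ge0 halpha adm).
pose d := e * (phi - F0) / (J F0 + 1).
have pF : 0 < phi - F0 by rewrite subr_gt0.
have d0 : 0 < d by rewrite divr_gt0 ?mulr_gt0//; lra.
have dr : d * J F0 <= e * (phi - F0).
  have : d * (J F0 + 1) = e * (phi - F0) by rewrite divfK// gt_eqF//; lra.
  lra.
have := @rate_convex3 _ _ _ _ _ _ _ halpha adm F0 phi (phi + d) (lexx _) F0_lt.
rewrite (gt_phi (phi + d)) ?ltrDl// mulr0 addr0 => /(_ d0) h.
rewrite -(ler_pM2l pF).
have rp : 0 <= J phi by apply: (rate_ge0 halpha adm); exact: ltW.
nra.
Qed.

Lemma rate_gt0 c : F0 <= c -> c < phi -> 0 < J c.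
Proof.
move=> Fc cphi; have [a a0 La] := Lam_lt_linear halpha adm cphi.
by apply: lt_le_trans (Lam_ge (ltW a0) Fc); rewrite subr_gt0 mulrC.
Qed.

(** Convexity, with a positive value at [c] and the value 0 at [phi]. *)
Lemma rate_decreasing (c' c : R) : F0 <= c' -> c' < c -> c < phi -> J c < J c'.
Proof.
move=> Fc' cc cphi; have Fc : F0 <= c := ltW (le_lt_trans Fc' cc).
have := rate_convex3 halpha adm Fc' cc cphi; rewrite (rate_eq0 (lexx phi)).
by have := rate_gt0 Fc cphi; nra.
Qed.

(** The slope is the supremum of the slopes of the chords to the left. *)
Lemma rate_subgradient c : F0 < c -> exists2 sigma : R, sigma <= 0 &
  forall y, F0 <= y -> J c + sigma * (y - c) <= J y.
Proof.
move=> Fc; pose S := [set (J c - J y) / (c - y) | y in `[F0, c[%classic].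
have S0 : S !=set0.
  by exists ((J c - J F0) / (c - F0)), F0 => //=; rewrite in_itv /= lexx.
have ubS r : (forall y, F0 <= y -> y < c -> (J c - J y) / (c - y) <= r) ->
    ubound S r.
  by move=> H _ [y + <-]; rewrite /= in_itv /= => /andP[? ?]; exact: H.
have ub0 : ubound S 0.
  apply: ubS => y Fy yc; rewrite ler_pdivrMr ?subr_gt0// mul0r subr_le0.
  exact: (rate_nonincreasing halpha adm Fy (ltW yc)).
exists (sup S); first exact: ge_sup.
move=> y Fy; case: (ltgtP y c) => [yc|cy|->]; last by rewrite subrr mulr0 addr0.
- have : (J c - J y) / (c - y) <= sup S.
    apply: ub_le_sup; first by exists 0.
    by exists y => //=; rewrite in_itv /= Fy yc.
  by rewrite ler_pdivrMr ?subr_gt0//; lra.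
- have : sup S <= (J y - J c) / (y - c).
    apply: ge_sup => //; apply: ubS => y' Fy' y'c.
    rewrite ler_pdivrMr ?subr_gt0// mulrAC ler_pdivlMr ?subr_gt0//.
    have := rate_convex3 halpha adm Fy' y'c cy; nra.
  by rewrite ler_pdivlMr ?subr_gt0//; lra.
Qed.

(** Laplace's method: cut the range of [S_n / n] into slices of width [eta] and
    bound the contribution of each slice by the J at its upper end. *)
Lemma Lam_le_of_subgradient c sigma : F0 <= c -> sigma < 0 ->
  (forall y, F0 <= y -> J c + sigma * (y - c) <= J y) ->
  L sigma <= c * sigma - J c.
Proof.
move=> Fc s0 sub; set v := c * sigma - J c.
rewrite -[leRHS]addr0; apply/ler_addgt0Pr => e e0; rewrite addr0.
pose eta := e / - sigma.
have eta0 : 0 < eta by rewrite divr_gt0// oppr_gt0.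
have se : sigma * eta = - e by rewrite /eta; field; rewrite lt_eqF.
pose lev i : R := F0 + i%:R * eta.
have levF i : F0 <= lev i by rewrite lerDl mulr_ge0// ltW.
have [I _ HI] := @near_natM R ((v + e) / sigma - F0) eta eta0.
have {HI}topI : sigma * lev I <= v + e.
  by have := HI I (leqnn I); rewrite /= lerBlDl ler_ndivrMr// mulrC.
apply: (@Lam_le_of_bound _ _ _ _ _ _ _ halpha adm _ _ (I%:R + 1 + 1));
  first exact: ltW.
move=> n.
have slices i : pathE alpha n (fun s => expR (sigma * cost F 0 s) *
    ((cost F 0 s <= n%:R * lev i) && (pos 0 s == 0%N))%:R) <=
    (i%:R + 1) * expR (n%:R * (v + e)).
  elim: i => [|i IH].
    rewrite add0r mul1r.
    apply: (@le_trans _ _ (expR (n%:R * (sigma * F0)) * p F0 n)).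
      rewrite /pinned_prob /pathP -pathEZ; apply: (ler_pathE a01) => s ss.
      rewrite /lev mul0r addr0 ler_wpM2r// ler_expR mulrCA ler_wnM2l ?(ltW
        s0)//.
      by rewrite -ss; exact: cost_ge_min.
    apply: (le_trans (ler_wpM2l (expR_ge0 _)
      (pinned_prob_le_rate halpha adm n (lexx F0)))).
    rewrite -expRD ler_expR mulNr -mulrN -mulrDr ler_wpM2l//.
    have := sub F0 (lexx _); rewrite /v; lra.
  rewrite -natr1 -addrA mulrDl; apply: (@le_trans _ _ ((i%:R + 1) *
    expR (n%:R * (v + e)) + expR (n%:R * (sigma * lev i)) * p (lev i.+1) n)).
    apply: (le_trans _ (lerD IH (lexx _))).
    rewrite /pinned_prob /pathP -pathEZ -pathED.
    apply: (ler_pathE a01) => s ss.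
    have E0 := expR_ge0 (sigma * cost F 0 s).
    have E1 := expR_ge0 (n%:R * (sigma * lev i)).
    case: (pos 0 s == 0%N); rewrite ?andbF ?mulr0 ?addr0// !andbT.
    case: (leP (cost F 0 s) (n%:R * lev i)) => h1.
      rewrite mulr1.
      case: (leP (cost F 0 s) (n%:R * lev i.+1)) => h2.
        by rewrite !mulr1 lerDl.
      by rewrite !mulr0 addr0.
    rewrite mulr0 add0r ler_wpM2r// ler_expR mulrCA ler_wnM2l ?(ltW s0)//.
    exact: ltW.
  rewrite mulrDl -addrA lerD2l mulrDl mul1r lerD2l.
  apply: (le_trans (ler_wpM2l (expR_ge0 _)
    (pinned_prob_le_rate halpha adm n (levF i.+1)))).
  rewrite -expRD ler_expR mulNr -mulrN -mulrDr ler_wpM2l//.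
  have := sub (lev i.+1) (levF _).
  have -> : lev i.+1 = lev i + eta by rewrite /lev -natr1; ring.
  rewrite /v; lra.
apply: (@le_trans _ _ (pathE alpha n (fun s => expR (sigma * cost F 0 s) *
    ((cost F 0 s <= n%:R * lev I) && (pos 0 s == 0%N))%:R) +
    expR (n%:R * (v + e)))); last first.
  by rewrite mulrDl mul1r; apply: lerD.
rewrite -(pathE_cst alpha n (expR _)) -pathED; apply: (ler_pathE a01) => s _.
have E0 := expR_ge0 (sigma * cost F 0 s).
have E1 := expR_ge0 (n%:R * (v + e)).
case: (pos 0 s == 0%N); rewrite ?andbF ?mulr0 ?add0r// !andbT.
case: (leP (cost F 0 s) (n%:R * lev I)) => h1; rewrite ?mulr1 ?mulr0.
  by rewrite lerDl.
rewrite add0r ler_expR.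
apply: (@le_trans _ _ (n%:R * (sigma * lev I))); last by rewrite ler_wpM2l.
by rewrite mulrCA ler_wnM2l ?(ltW s0)// ltW.
Qed.

(** The optimal parameter is the slope of a supporting line; a horizontal one
    occurs only where the rate vanishes. *)
Lemma rate_dual c : F0 < c -> exists2 sigma : R, sigma <= 0 &
  J c = c * sigma - L sigma /\ (sigma = 0 -> J c = 0).
Proof.
move=> Fc; have [sigma s0 sub] := rate_subgradient Fc.
have ge := Lam_ge s0 (ltW Fc).
have rc0 : 0 <= J c by apply: (rate_ge0 halpha adm); exact: ltW.
exists sigma => //; move: s0; rewrite le_eqVlt => /orP[/eqP sE|s0].
  have : J c <= 0.
    have := sub (Num.max c phi).
    rewrite sE mul0r addr0 (rate_eq0 (c := Num.max c phi)) ?le_max ?lexx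
      ?orbT//.
    by apply; rewrite ltW.
  move=> rc; have rE : J c = 0 by apply/eqP; rewrite eq_le rc rc0.
  split=> //; have := Lam_le0 halpha adm (lexx 0).
  move: ge; rewrite sE mulr0 rE; lra.
split; last by move=> sE; move: s0; rewrite sE ltxx.
by have := Lam_le_of_subgradient (ltW Fc) s0 sub; lra.
Qed.

(** Chernoff's bound at the optimal parameter. *)
Lemma lower_tail_upper x c : F0 < c ->
  decays_at_least (fun n => pathP alpha n (fun s => cost F x s <= n%:R * c))
    (J c).
Proof.
move=> Fc; have [sigma s0 [rE r0]] := rate_dual Fc.
move: s0; rewrite le_eqVlt => /orP[/eqP sE|s0].
  rewrite (r0 sE); apply: (@decays_at_least_lin _ _ _ 1) => n.
  rewrite mul1r mulr0 expR0 mulr1; apply: (le_trans (pathP_le1 a01 _ _)).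
  by rewrite ler1n.
have [K HK] := free_exp_le halpha adm s0.
apply: (@decays_at_least_lin _ _ _ K) => n.
apply: (@le_trans _ _ (expR (- (n%:R * (c * sigma))) * free_exp alpha F sigma
  n)).
  rewrite /free_exp -pathEZ; apply: (ler_pathE a01) => s _.
  case: (leP (cost F x s) (n%:R * c)) => h; last by rewrite mulr_ge0 ?expR_ge0.
  rewrite -expRD; apply: (@le_trans _ _ (expR 0)); first by rewrite expR0.
  rewrite ler_expR.
  have : sigma * (n%:R * c) <= sigma * cost F 0 s; last by lra.
  by rewrite ler_wnM2l ?(ltW s0)// (le_trans _ h)// ler_cost.
apply: (le_trans (ler_wpM2l (expR_ge0 _) (HK n))).
rewrite mulrCA -expRD rE le_eqVlt; apply/orP; left; apply/eqP.
by congr (_ * expR _); ring.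
Qed.

Lemma pinned_prob_decay c : F0 <= c -> decays_at_most (p c) (J c).
Proof.
move=> Fc; apply: decays_at_most_lim => e e0.
have [K HK] := pinned_prob_ge_rate halpha adm Fc e0.
apply: (@decays_at_most_bound _ _ _ (expR (- K))); first exact: expR_gt0.
near=> n; have pn := pinned_prob_gt0 halpha adm n Fc.
by rewrite -expRD -[leRHS]lnK ?posrE// ler_expR; have := HK n; lra.
Unshelve. all: by end_near. Qed.

Lemma start_down x n (E : pred (seq bool)) : (x <= n)%N ->
  (1 - alpha) ^+ x * pathP alpha (n - x) (fun s => E (nseq x false ++ s)) <=
  pathP alpha n E.
Proof.
move=> xn; have := pathP_prefix a01 (nseq x false) (n - x) E.
by rewrite weight_nseq size_nseq subnKC.
Qed.

(** Go down to 0, which has fixed probability and bounded cost, and absorb that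
    cost by a slightly smaller mean, using left continuity. *)
Lemma lower_tail_lower x c : F0 < c ->
  decays_at_most (fun n => pathP alpha n (fun s => cost F x s <= n%:R * c))
    (J c).
Proof.
move=> Fc; apply: decays_at_most_lim => e e0.
have [d d0 [Fcd rd]] := rate_left_continuous Fc e0.
apply: (@decays_at_most_le _
    (fun n => (1 - alpha) ^+ x * p (c - d) (n - x)%N)).
  near=> n.
  have xn : (x <= n)%N by near: n; exact: nbhs_infty_ge.
  have nd : x%:R * F x <= n%:R * d by near: n; exact: near_natM.
  apply: le_trans (start_down _ xn);
    rewrite ler_wpM2l ?exprn_ge0 ?(ltW alphaC_gt0)//.
  apply: (sub_pathP a01) => s _ /andP[cs _].
  rewrite cost_cat pos_down subnn.
  apply: (le_trans (lerD (cost_down F_mono F0_ge0 x x) cs)).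
  apply: (@le_trans _ _ (n%:R * d + n%:R * (c - d)));
    last by rewrite -mulrDr subrKC.
  apply: lerD => //; rewrite ler_wpM2r ?ler_nat ?leq_subr//.
  by rewrite (le_trans F0_ge0)// ltW.
apply: decays_at_most_shift; first by rewrite exprn_gt0.
apply: (decays_at_most_weaken rd).
exact/pinned_prob_decay/ltW.
Unshelve. all: by end_near. Qed.

(** The tail below [c - d] decays strictly faster than the tail below [c]. *)
Lemma interval_lower x c d : F0 < c - d -> c < phi -> 0 < d ->
  decays_at_most (fun n => pathP alpha n (fun s =>
    (n%:R * (c - d) < cost F x s) && (cost F x s <= n%:R * c))) (J c).
Proof.
move=> Fcd cphi d0; have cd : c - d < c by rewrite ltrBlDr ltrDl.
have Fc := lt_trans Fcd cd.
apply: decays_at_most_le (decays_at_most_sub (rate_decreasing (ltW Fcd) cd cphi)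
  (lower_tail_lower x Fc) (lower_tail_upper x Fcd)).
near=> n; rewrite lerBlDr; apply: le_trans (pathPU a01 _ _ _).
apply: (sub_pathP a01) => s _ ->.
by rewrite andbT; case: (ltP (n%:R * (c - d)) (cost F x s)).
Unshelve. all: by end_near. Qed.

(** One excursion up to height [h] and back has a cost [G] much larger than
    [h]; followed by about [G / (c - phi)] typical steps it brings the mean up
    to [c], at a price that is exponential in [h] only. *)
Lemma heavy_block c d e : phi < c -> 0 < d -> 0 < e ->
  exists2 N, (0 < N)%N & expR (- N%:R * e) <= pathP alpha N (fun s =>
    (`|cost F 0 s - N%:R * c| <= N%:R * d) && (pos 0 s == 0%N)).
Proof.
move=> phic d0 e0.
have /andP[al0 al1] := a01.
have r1 := rho_lt1 halpha; rewrite -/rho in r1.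
have hr : 0 < (1 - rho) / 2 by rewrite divr_gt0// subr_gt0.
have phi0 : 0 < phi := adm_phi_gt0 adm.
have c0 : 0 < c by exact: lt_trans phic.
have cphi0 : 0 < c - phi by rewrite subr_gt0.
pose A : R := `|ln (alpha * (1 - alpha))| + `|ln ((1 - rho) / 2)|.
(* [Q] bounds [m / h] from below: its first term makes the length of the
   excursion negligible in the mean, its second one makes its price so *)
pose Q := 6 * c / d + A / e + 1.
have A0 : 0 <= A by rewrite addr_ge0.
have Q1 : 1 <= Q.
  by rewrite lerDr addr_ge0// divr_ge0 ?mulr_ge0// ltW.
have [h1 H1] := cost_up_superlinear halpha adm ((Q + 1) * (c - phi)).
have d20 : 0 < d / 2 by rewrite divr_gt0.
have [n1 _ H2] := typical_return d20.
have [h [h_gt0 h1h n1h]] : exists h, [/\ (0 < h)%N, (h1 <= h)%N & (n1 <= h)%N].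
  by exists (maxn h1 n1).+1; split=> //; rewrite leqW ?leq_maxl ?leq_maxr.
pose ex := nseq h true ++ nseq h false.
pose G := cost F 0 ex.
have h_ge1 : (1 : R) <= h%:R by rewrite ler1n.
have hG : (Q + 1) * (c - phi) * h%:R <= G.
  apply: (le_trans (H1 h h1h)).
  by rewrite /G cost_cat lerDl; exact: (cost_ge0 F_mono F0_ge0).
pose m := Num.truncn (G / (c - phi)).
have G0 : 0 <= G / (c - phi).
  by rewrite divr_ge0 ?(ltW cphi0)//; exact: (cost_ge0 F_mono F0_ge0).
have /andP[ml mu] := truncn_itv G0.
have {ml}ml : m%:R * (c - phi) <= G by rewrite -ler_pdivlMr.
have {mu}mu : G < m%:R * (c - phi) + (c - phi).
  by move: mu; rewrite ltr_pdivrMr// -natr1 mulrDl mul1r.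
have mQ : Q * h%:R <= m%:R.
  have : (Q + 1) * h%:R * (c - phi) < (m%:R + 1) * (c - phi).
    by rewrite mulrAC; apply: (le_lt_trans hG); rewrite mulrDl mul1r.
  by rewrite ltr_pM2r//; lra.
have mh : (h <= m)%N.
  by rewrite -(ler_nat R); apply: le_trans mQ; rewrite ler_peMl.
exists (size ex + m)%N.
  by rewrite addn_gt0 (leq_trans h_gt0 mh) orbT.
have sexE : (size ex + m)%:R = 2 * h%:R + m%:R :> R.
  by rewrite size_cat !size_nseq !natrD; ring.
apply: le_trans (pathP_prefix a01 _ _ _).
apply: (@le_trans _ _ (weight alpha ex * ((1 - rho) / 2))); last first.
  rewrite ler_wpM2l ?(ltW (weight_gt0 a01 _))//.
  apply: (le_trans (H2 m (leq_trans n1h mh))).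
  apply: (sub_pathP a01) => s _ /andP[cs ps].
  rewrite cost_cat !pos_cat pos_up pos_down add0n subnn ps andbT -/G sexE.
  have hc : 3 * c * h%:R <= m%:R * (d / 2).
    have : 6 * c / d * h%:R <= m%:R.
      apply: le_trans mQ; rewrite ler_wpM2r// /Q -addrA lerDl.
      by rewrite addr_ge0// divr_ge0// ltW.
    rewrite mulrAC ler_pdivrMr//; lra.
  have hd : 0 <= h%:R * d by rewrite mulr_ge0// ltW.
  have cch : c <= c * h%:R by rewrite ler_peMr// ltW.
  move: cs; rewrite !ler_norml => /andP[? ?]; apply/andP; split; lra.
rewrite weight_cat !weight_nseq -exprMn.
have w0 : 0 < alpha * (1 - alpha) by rewrite mulr_gt0.
set W := (alpha * (1 - alpha)) ^+ h * _;
  have W0 : 0 < W by rewrite mulr_gt0 ?exprn_gt0.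
suff : - (size ex + m)%:R * e <= ln W.
  by move=> le_lnW; rewrite -[leRHS]lnK ?posrE// ler_expR.
rewrite /W.
rewrite lnM ?posrE ?exprn_gt0// lnXn// -mulr_natl sexE.
have l1 := ler_norm (- ln (alpha * (1 - alpha))); rewrite normrN in l1.
have l2 := ler_norm (- ln ((1 - rho) / 2)); rewrite normrN in l2.
have l3 : - (h%:R * ln (alpha * (1 - alpha))) <=
    h%:R * `|ln (alpha * (1 - alpha))| by rewrite -mulrN ler_wpM2l.
have l4 : `|ln ((1 - rho) / 2)| <= h%:R * `|ln ((1 - rho) / 2)| by rewrite
  ler_peMl.
have l5 : h%:R * A <= m%:R * e.
  have : A / e * h%:R <= m%:R.
    apply: le_trans mQ; rewrite ler_wpM2r// /Q addrAC lerDr.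
    by rewrite addr_ge0// divr_ge0 ?mulr_ge0// ltW.
  by rewrite mulrAC ler_pdivrMr// mulrC.
have l6 : 0 <= 2 * h%:R * e by rewrite !mulr_ge0// ltW.
move: l5; rewrite /A mulrDr => l5; lra.
Qed.

(** Heavy blocks are concatenated; the remaining steps, fewer than one block,
    are spent at 0. *)
Lemma upper_interval_lower x c d : phi < c -> 0 < d ->
  decays_at_most (fun n => pathP alpha n (fun s =>
    `|cost F x s - n%:R * c| <= n%:R * d)) 0.
Proof.
move=> phic d0; apply: decays_at_most_lim => e e0; rewrite add0r.
have d20 : 0 < d / 2 by rewrite divr_gt0.
have [N N0 HN] := heavy_block phic d20 e0.
set blk := pathP _ _ _ in HN.
have blk0 : 0 <= blk by exact: pathP_ge0.
have phi0 : 0 < phi := adm_phi_gt0 adm.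
have c0 : 0 < c by exact: lt_trans phic.
have blocks q r : blk ^+ q * (1 - alpha) ^+ r <= pathP alpha (q * N + r)
   (fun s => `|cost F 0 s - (q * N + r)%:R * c| <=
               (q * N)%:R * (d / 2) + r%:R * (F0 + c)).
  elim: q => [|q IH].
    rewrite expr0 mul1r mul0n add0n mul0r add0r.
    have := pathP_prefix a01 (nseq r false) 0 (fun s =>
       `|cost F 0 s - r%:R * c| <= r%:R * (F0 + c)).
    rewrite size_nseq addn0 weight_nseq; apply: le_trans.
    rewrite /pathP /= cats0.
    suff -> : `|cost F 0 (nseq r false) - r%:R * c| <= r%:R * (F0 + c).
      by rewrite mulr1.
    have cd := cost_down F_mono F0_ge0 0 r.
    have cp := cost_ge0 F_mono F0_ge0 0 (nseq r false).
    have rc : 0 <= r%:R * c by rewrite mulr_ge0// ltW.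
    have rF : 0 <= r%:R * F0 by rewrite mulr_ge0.
    rewrite -/F0 in cd.
    by rewrite ler_norml; apply/andP; split; lra.
  rewrite exprS -mulrA; apply: (le_trans (ler_wpM2l blk0 IH)).
  rewrite mulSn -addnA {1}/blk /pathP [leRHS]pathE_cat mulrC -pathEZ.
  apply: (ler_pathE a01) => s _.
  case: (boolP (_ && _)) => [/andP[cs /eqP ps]|_]; last first.
    by rewrite mulr0; apply: (pathE_ge0 a01).
  rewrite mulr1; apply: (sub_pathP a01) => t _ ct.
  rewrite cost_cat ps !natrD; move: cs ct; rewrite !natrD !ler_norml.
  by move=> /andP[? ?] /andP[? ?]; apply/andP; split; lra.
apply: (@decays_at_most_bound _ _ _ ((1 - alpha) ^+ x * (1 - alpha) ^+ N)).
  by rewrite mulr_gt0 ?exprn_gt0.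
near=> n.
have xn : (x <= n)%N by near: n; exact: nbhs_infty_ge.
have big : x%:R * (F x + c) + N%:R * (F0 + c) <= n%:R * (d / 2).
  by near: n; exact: near_natM.
apply: le_trans (start_down _ xn).
rewrite -mulrA ler_wpM2l ?exprn_ge0 ?(ltW alphaC_gt0)//.
pose k := (n - x)%N; pose q := (k %/ N)%N; pose r := (k %% N)%N.
have kE : k = (q * N + r)%N by exact: divn_eq.
have rN : (r <= N)%N by rewrite ltnW// ltn_mod.
have qNn : (q * N <= n)%N.
  by rewrite (leq_trans (leq_addr r _))// -kE leq_subr.
apply: (@le_trans _ _ (blk ^+ q * (1 - alpha) ^+ r)).
  rewrite mulrC; apply: ler_pM;
    rewrite ?expR_ge0 ?exprn_ge0 ?(ltW alphaC_gt0)//.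
    apply: (@le_trans _ _ (expR (- N%:R * e) ^+ q)).
      have : (q * N)%:R * e <= n%:R * e.
        by rewrite ler_wpM2r ?(ltW e0)// ler_nat.
      by rewrite -expRM_natl ler_expR natrM; lra.
    by apply: lerXn2r; rewrite ?nnegrE ?expR_ge0.
  apply: ler_wiXn2l; rewrite ?(ltW alphaC_gt0)//.
  by rewrite gerBl; case/andP: a01 => /ltW.
apply: (le_trans (blocks q r)); rewrite -kE.
apply: (sub_pathP a01) => s _.
rewrite cost_cat pos_down subnn.
have cd := cost_down F_mono F0_ge0 x x.
have cp := cost_ge0 F_mono F0_ge0 x (nseq x false).
have xc : 0 <= x%:R * c by rewrite mulr_ge0// ltW.
have xF : 0 <= x%:R * F x by rewrite mulr_ge0.
have nE : n%:R = x%:R + k%:R :> R by rewrite -natrD subnKC.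
have h1 : (q * N)%:R * (d / 2) <= n%:R * (d / 2).
  by rewrite ler_wpM2r ?(ltW d20)// ler_nat.
have h2 : r%:R * (F0 + c) <= N%:R * (F0 + c).
  by rewrite ler_wpM2r ?ler_nat// addr_ge0// ltW.
move: big; rewrite mulrDr => big.
have nc : n%:R * c = x%:R * c + k%:R * c by rewrite nE mulrDl.
have nd : n%:R * d = n%:R * (d / 2) + n%:R * (d / 2) by field.
rewrite nc nd !ler_norml => /andP[? ?]; apply/andP; split; lra.
Unshelve. all: by end_near. Qed.

End rate_properties.

(** * The identity and the exponential as costs *)

Section observables.
Context {R : realType} (alpha : R).
Hypothesis halpha : 0 < alpha < 2^-1.
Let rho := alpha / (1 - alpha).

Let bernoulli_le (t : R) n : 0 <= t -> 1 + n%:R * t <= (1 + t) ^+ n.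
Proof.
move=> t0; elim: n => [|n IH]; first by rewrite mul0r addr0 expr0.
rewrite exprS -natr1.
have : (1 + t) * (1 + n%:R * t) <= (1 + t) * (1 + t) ^+ n.
  by rewrite ler_wpM2l//; lra.
have : 0 <= n%:R * t * t by rewrite !mulr_ge0.
lra.
Qed.

Lemma admissible_id : exists (g : nat -> R) phi b C,
  admissible alpha (fun x => x%:R) g phi b C.
Proof.
have /andP[a0 a2] := halpha; pose mu := 1 - 2 * alpha.
have mu0 : 0 < mu by rewrite /mu; lra.
have mu1 : mu < 1 by rewrite /mu; lra.
(* a square, so that Bernoulli's inequality bounds [x ^ 2] by [b ^ x] *)
pose b := (2 * (1 - alpha)) ^+ 2.
have bE : b = (1 + mu) ^+ 2 by rewrite /b /mu; congr (_ ^+ 2); lra.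
have sq x : (x%:R * mu) ^+ 2 <= b ^+ x.
  rewrite bE exprAC ler_sqr ?nnegrE ?exprn_ge0 ?mulr_ge0 ?(ltW mu0)//;
    last by lra.
  apply: le_trans (bernoulli_le x (ltW mu0)); lra.
have xx x : (x%:R : R) <= x%:R ^+ 2.
  by case: x => [|x]; rewrite ?expr0n// expr2 ler_peMl// ler1n.
have x2 x : x%:R ^+ 2 <= b ^+ x / mu ^+ 2.
  by rewrite ler_pdivlMr ?exprn_gt0// -exprMn.
exists (fun x => (x%:R ^+ 2 + x%:R) / (2 * mu)), (alpha / mu), b, (mu ^- 3).
have m3 : mu ^- 2 <= mu ^- 3.
  by rewrite lef_pV2 ?posrE ?exprn_gt0// exprSr ler_piMr ?exprn_ge0 ?ltW.
split => //=.
- by move=> x y xy; rewrite ler_nat.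
- by move=> K; have [N _ /(_ N (leqnn N)) h] := @nbhs_infty_ger R K; exists N.
- by rewrite bE exprn_egt1//; lra.
- rewrite -subr_gt0 (_ : _ - _ = (1 - alpha) * mu ^+ 2); last first.
    by rewrite /b /mu; ring.
  by rewrite mulr_gt0 ?exprn_gt0//; lra.
- move=> x; apply: (le_trans (xx x)); apply: (le_trans (x2 x)).
  by rewrite mulrC ler_wpM2r// bE exprn_ge0// exprn_ge0//; lra.
- move=> x; rewrite ger0_norm ?divr_ge0 ?addr_ge0 ?exprn_ge0//; last by lra.
  apply: (@le_trans _ _ (x%:R ^+ 2 / mu)).
    rewrite ler_pdivrMr; last by lra.
    rewrite mulrCA divfK; last by rewrite gt_eqF.
    have := xx x; lra.
  rewrite ler_pdivrMr//; apply: (le_trans (x2 x)).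
  rewrite [leRHS]mulrAC (_ : mu ^- 3 * mu = mu ^- 2); last first.
    by field; rewrite gt_eqF.
  by rewrite mulrC.
- move=> [|x] /=.
    by rewrite /mu; field; rewrite gt_eqF.
  by rewrite -!natr1 /mu; field; rewrite gt_eqF.
- by rewrite divr_gt0.
Qed.

Lemma admissible_exp beta : 0 < beta < `|ln rho| -> exists (g : nat -> R) phi b
  C,
  admissible alpha (fun x => expR (beta * x%:R)) g phi b C.
Proof.
move=> /andP[b0 brho]; have /andP[a0 a2] := halpha.
have [r0 r1] := (rho_gt0 halpha, rho_lt1 halpha); rewrite -/rho in r0 r1.
pose b := expR beta.
have b1 : 1 < b by rewrite expR_gt1.
have ab : alpha * b < 1 - alpha.
  have : b < rho^-1.
    rewrite -[rho^-1]lnK ?posrE ?invr_gt0// ltr_expR lnV//.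
    by move: brho; rewrite ltr0_norm// ln_lt0// r0.
  by rewrite /rho invf_div ltr_pdivlMr// mulrC.
pose q := 1 - alpha - alpha * b; have q0 : 0 < q by rewrite /q; lra.
(* the multiple of [b ^ x] inverts the drift above 0, and the linear term
   corrects the equation at 0 *)
pose A := b / ((b - 1) * q); pose Bc := q^-1.
have b10 : 0 < b - 1 by lra.
have A0 : 0 <= A by rewrite divr_ge0 ?mulr_ge0//; lra.
have Bc0 : 0 <= Bc by rewrite invr_ge0 ltW.
have xb x : x%:R <= b ^+ x / (b - 1).
  rewrite ler_pdivlMr//; have := bernoulli_le x (ltW b10); rewrite subrKC; lra.
have FE x : expR (beta * x%:R) = b ^+ x by rewrite mulrC expRM_natl.
have bx0 x : 0 <= b ^+ x by rewrite exprn_ge0//; lra.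
exists (fun x => A * b ^+ x - Bc * x%:R), ((1 - 2 * alpha) / q), b,
  (A + Bc / (b - 1) + 1).
split => //=.
- by move=> x y xy; rewrite ler_expR ler_wpM2l ?ler_nat// ltW.
- move=> K; have [n Kn] := exprn_unbounded K b1.
  by exists n; rewrite FE.
- move=> x; rewrite FE ler_peMl// lerDr addr_ge0//.
  by rewrite divr_ge0// ltW.
- move=> x; apply: (le_trans (ler_normB _ _)).
  rewrite (ger0_norm (mulr_ge0 A0 (bx0 x))) ger0_norm ?mulr_ge0//.
  have : Bc * x%:R <= Bc * (b ^+ x / (b - 1)) by rewrite ler_wpM2l.
  rewrite mulrCA mulrC; have := bx0 x; lra.
- move=> x; rewrite FE; case: x => [|x] /=.
    by rewrite /A /Bc /q; field; rewrite ?gt_eqF//; lra.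
  rewrite -!natr1 !exprS /A /Bc /q; field; rewrite ?gt_eqF//; lra.
- rewrite mulr0 expR0 ltr_pdivlMr// mul1r /q; nra.
Qed.

End observables.

(** * From the increments to coin tosses *)

Section increments.
Context d (Omega : measurableType d) (R : realType) (P : probability Omega R).
Context (D : nat -> {RV P >-> int}).

Definition increments m n (w : Omega) : seq int :=
  [seq D k.+1 w | k <- iota m n].

Lemma increments_rcons n w :
  increments 0 n.+1 w = rcons (increments 0 n w) (D n.+1 w).
Proof. by rewrite /increments -[n.+1 in LHS]addn1 iotaD map_cat add0n /= cats1.
  Qed.

(** Finite sequences of integers being countable, every event that depends on
    finitely many increments is measurable. *)
Lemma measurable_increments m n (Q : seq int -> Prop) :
  measurable [set w | Q (increments m n w)].
Proof.
elim: n m Q => [|n IH] m Q.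
  have [q|nq] := pselect (Q [::]).
    by rewrite (_ : mkset _ = setT)//; apply/seteqP; split.
  by rewrite (_ : mkset _ = set0)//; apply/seteqP; split.
rewrite (_ : mkset _ = \bigcup_(z : int) ((D m.+1 @^-1` [set z]) `&`
   [set w | Q (z :: increments m.+1 n w)])).
  apply: countable_bigcupT_measurable; first exact: countableP.
  move=> z; apply: measurableI; last exact: (IH _ (fun s => Q (z :: s))).
  by rewrite -[X in measurable X]setTI; exact: measurable_funP.
apply/seteqP; split => w /=.
  by move=> Qw; exists (D m.+1 w).
by move=> [z _ [/= <-]].
Qed.

Lemma measurable_fun_increments d' (T : measurableType d') m n (f : seq int ->
  T) :
  measurable_fun setT (fun w => f (increments m n w)).
Proof.
move=> _ Y mY; rewrite setTI.
exact: (measurable_increments m n (fun s => Y (f s))).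
Qed.

Definition queue_step (x : nat) (z : int) : nat := absz (Num.max (x%:Z + z) 0).

Lemma Phi_increments x k w : Phi D x k w = foldl queue_step x (increments 0 k
  w).
Proof.
by elim: k => [//|k IH]; rewrite increments_rcons foldl_rcons -IH.
Qed.

Lemma measurable_Phi x k (A : set nat) : measurable (Phi D x k @^-1` A).
Proof.
rewrite (_ : _ @^-1` _ = [set w | A (foldl queue_step x (increments 0 k w))]).
  exact: (measurable_increments 0 k (fun s => A (foldl queue_step x s))).
by apply/seteqP; split => w /=; rewrite Phi_increments.
Qed.

Lemma measurable_empirical_mean F x n (S : set R) :
  measurable (empirical_mean D F x n @^-1` S).
Proof.
pose f (s : seq int) := n%:R^-1 *
  \sum_(k < n) F (foldl queue_step x (take k s)).
have meanE w : empirical_mean D F x n w = f (increments 0 n w).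
  congr (_ * _); apply: eq_bigr => k _.
  rewrite Phi_increments /increments -map_take take_iota.
  by rewrite (minn_idPl (ltnW (ltn_ord k))).
rewrite (_ : _ @^-1` _ = [set w | S (f (increments 0 n w))]).
  exact: (measurable_increments 0 n (fun s => S (f s))).
by apply/seteqP; split => w /=; rewrite meanE.
Qed.

(** A toss is the event that the increment is 1; its complement has probability
    [1 - alpha] exactly, so tosses are coin tosses even on the null set where an
    increment is neither 1 nor -1. *)
Definition bits m n (w : Omega) : seq bool :=
  [seq D k.+1 w == 1 | k <- iota m n].

Lemma bits_rcons n w : bits 0 n.+1 w = rcons (bits 0 n w) (D n.+1 w == 1).
Proof. by rewrite /bits -[n.+1 in LHS]addn1 iotaD map_cat add0n /= cats1. Qed.

Lemma bits_increments m n w :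
  bits m n w = [seq z == 1 | z <- increments m n w].
Proof. by rewrite /increments -map_comp. Qed.

Lemma size_bits m n w : size (bits m n w) = n.
Proof. by rewrite size_map size_iota. Qed.

Lemma measurable_fun_bits d' (T : measurableType d') m n (f : seq bool -> T) :
  measurable_fun setT (fun w => f (bits m n w)).
Proof.
under eq_fun do rewrite bits_increments.
exact: (measurable_fun_increments m n (fun s => f [seq z == 1 | z <- s])).
Qed.

Definition ideal (w : Omega) := forall k, D k w = 1 \/ D k w = -1.

Lemma queue_step_ideal x (z : int) : z = 1 \/ z = -1 ->
  queue_step x z = step x (z == 1).
Proof. by rewrite /queue_step; case=> -> /=; [|case: x => [|x]]; lia. Qed.

Lemma Phi_bits x k w : ideal w -> Phi D x k w = pos x (bits 0 k w).
Proof.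
move=> iw; elim: k => [//|k IH].
rewrite bits_rcons pos_rcons -IH -(queue_step_ideal _ (iw _)).
by [].
Qed.

Lemma sum_cost F x n w : ideal w ->
  \sum_(k < n) F (Phi D x k w) = cost F x (bits 0 n w) :> R.
Proof.
move=> iw; elim: n => [|n IH]; first by rewrite big_ord0.
rewrite big_ord_recr bits_rcons cost_rcons Phi_bits// -IH.
by [].
Qed.

Context (alpha : R).
Hypothesis hD : iid_increments alpha D.

Let mD k (B : set int) : measurable (D k @^-1` B).
Proof. by rewrite -[X in measurable X]setTI; exact: measurable_funP. Qed.

Lemma ae_ideal : {ae P, forall w, ideal w}.
Proof.
have [_ h1 h2] := hD.
apply: ae_foralln => k; exists (~` (D k @^-1` [set 1] `|` D k @^-1` [set -1])).
split.
- by apply: measurableC; apply: measurableU; exact: mD.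
- set U := _ `|` _; have mU : measurable U by apply: measurableU; exact: mD.
  transitivity (1 - P U)%E; first exact: probability_setC.
  have -> : P U = 1%E; last by rewrite subee.
  transitivity (alpha%:E + (1 - alpha)%:E)%E; last by rewrite -EFinD subrKC.
  rewrite -(h1 k) -(h2 k); apply: measureU; [exact: mD|exact: mD|].
  by apply/seteqP; split => w //= [->].
- by move=> w /=; apply: contra_not => -[->|->]; [left|right].
Qed.

Definition cyl (t : seq bool) := [set w | bits 0 (size t) w = t].

Let mcyl t : measurable (cyl t).
Proof.
rewrite (_ : cyl t = [set w | [seq z == 1 | z <- increments 0 (size t) w] = t]).
  exact: (measurable_increments 0 (size t) (fun s => [seq z == 1 | z <- s] =
    t)).
by apply/seteqP; split => w; rewrite /cyl /= bits_increments.
Qed.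

Lemma prob_cyl t : P (cyl t) = (weight alpha t)%:E.
Proof.
have [ind h1 _] := hD.
pose B k : set int := if nth true t k.-1 then [set 1] else ~` [set 1].
have -> : cyl t = \bigcap_(k in [set` iota 1 (size t)]) (D k @^-1` B k).
  apply/seteqP; split => w; rewrite /cyl /=.
    move=> wt k /=; rewrite mem_iota add1n ltnS => /andP[k0 kn].
    have kt : (k.-1 < size t)%N by rewrite prednK.
    have -> : B k = if D k w == 1 then [set 1] else ~` [set 1].
      rewrite /B -[in LHS]wt /bits (nth_map 0%N) ?size_iota// nth_iota// add0n.
      by rewrite prednK.
    by case: eqP.
  move=> H; apply: (@eq_from_nth _ true); first by rewrite size_bits.
  rewrite size_bits => i it;
    rewrite /bits (nth_map 0%N) ?size_iota// nth_iota// add0n.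
  have := H i.+1; rewrite /B /= => /(_ _)/wrap[].
    by rewrite mem_iota add1n !ltnS.
  by case: nth => /= [->//|/eqP/negbTE].
rewrite ind ?iota_uniq//.
have PB k : P (D k @^-1` B k) = (if nth true t k.-1 then alpha else 1 -
  alpha)%:E.
  rewrite /B; case: nth; first exact: h1.
  rewrite -preimage_setC; transitivity (1 - P (D k @^-1` [set 1%R]))%E.
    exact/probability_setC/mD.
  by rewrite h1 -EFinB.
under eq_bigr do rewrite PB.
rewrite prodEFin /weight; congr (_%:E).
rewrite -[1%N]addn0 iotaDl big_map /= (big_nth true) /index_iota subn0.
by [].
Qed.

(** Integration over a cylinder follows the recursion of [pathE], splitting the
    cylinder by the next toss. *)
Lemma integral_cyl t n (H : seq bool -> R) : (forall s, 0 <= H s) ->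
  (\int[P]_(w in cyl t) (H (bits (size t) n w))%:E =
   (weight alpha t * pathE alpha n H)%:E)%E.
Proof.
elim: n t H => [|n IH] t H H0.
  rewrite -[X in integral _ _ X]/(cst (H [::])%:E) integral_cst//=.
  by rewrite prob_cyl -EFinM mulrC.
have cylU : cyl t = cyl (rcons t true) `|` cyl (rcons t false).
  have E w b : cyl (rcons t b) w <-> bits 0 (size t) w = t /\
       (D (size t).+1 w == 1) = b.
    rewrite /cyl /mkset size_rcons bits_rcons.
    by split=> [/rcons_inj[]|[-> ->]].
  apply/seteqP; split => w.
    by move=> wt; case Db : (D (size t).+1 w == 1); [left|right]; apply/E;
      split.
  by move=> [/E[]|/E[]].
rewrite [in LHS]cylU ge0_integral_setU//; first last.
- rewrite disj_set2E; apply/eqP/seteqP; split => w //=.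
  rewrite /cyl /= !size_rcons => -[-> /eqP].
  by rewrite eqseq_rcons andbF.
- by move=> w _; rewrite lee_fin.
- apply/measurable_EFinP; apply: measurable_funTS.
  exact: (measurable_fun_bits (size t) n.+1 H).
have piece b : (\int[P]_(w in cyl (rcons t b)) (H (bits (size t) n.+1 w))%:E =
   (weight alpha (rcons t b) * pathE alpha n (fun s => H (b :: s)))%:E)%E.
  rewrite -(IH (rcons t b) (fun s => H (b :: s)))//.
  apply: eq_integral => w; rewrite inE /cyl /= => wt; congr (H _)%:E.
  rewrite size_rcons /bits /=; congr (_ :: _).
  have := congr1 (nth true ^~ (size t)) wt.
  rewrite /= size_rcons (nth_map 0%N) ?size_iota// nth_iota// add0n => ->.
  by rewrite nth_rcons ltnn eqxx.
rewrite !piece -EFinD; congr (_%:E).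
by rewrite -!cats1 !weight_cat /weight !big_seq1 /=; ring.
Qed.

Lemma integral_bits n (X : Omega -> R) (H : seq bool -> R) :
  measurable_fun setT X -> (forall w, 0 <= X w) -> (forall s, 0 <= H s) ->
  (forall w, ideal w -> X w = H (bits 0 n w)) ->
  (\int[P]_w (X w)%:E = (pathE alpha n H)%:E)%E.
Proof.
move=> mX X0 H0 XH; have := integral_cyl [::] n H0.
rewrite /weight big_nil mul1r (_ : cyl [::] = setT); last first.
  by apply/seteqP; split.
move=> <-; apply: ge0_ae_eq_integral => //.
- exact/measurable_EFinP.
- exact/measurable_EFinP/(measurable_fun_bits 0 n H).
- by move=> w _; rewrite lee_fin.
- by move=> w _; rewrite lee_fin.
- by apply: filterS ae_ideal => w iw _; rewrite XH.
Qed.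

Lemma prob_bits n (A : set Omega) (E : pred (seq bool)) : measurable A ->
  (forall w, ideal w -> A w <-> E (bits 0 n w)) -> P A = (pathP alpha n E)%:E.
Proof.
move=> mA AE; have := integral_indic P measurableT mA; rewrite setIT => <-.
apply: integral_bits => //.
move=> w iw; rewrite indicE; congr (nat_of_bool _)%:R.
by apply/idP/idP; rewrite inE => /AE; exact.
Qed.

Lemma transitionE k x A : transition D k x A =
  (pathP alpha k (fun s => pos x s \in A))%:E.
Proof.
apply: prob_bits; first exact: measurable_Phi.
by move=> w iw; rewrite /= Phi_bits// inE.
Qed.

Lemma mean_probE F x S n : mean_prob D F x S n =
  (pathP alpha n (fun s => n%:R^-1 * cost F x s \in S))%:E.
Proof.
apply: prob_bits; first exact: measurable_empirical_mean.
by move=> w iw; rewrite /= /empirical_mean sum_cost// inE.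
Qed.

Lemma pinned_mgfE F a n : pinned_mgf D F a n = (pinned_exp alpha F a n)%:E.
Proof.
have mem : measurable_fun setT (fun w : Omega => empirical_mean D F 0 n w).
  by move=> _ Y mY; rewrite setTI; exact: measurable_empirical_mean.
rewrite /pinned_mgf unlock /pinned_exp; apply: integral_bits.
- apply: measurable_funM; last exact: measurable_indic (measurable_Phi _ _ _).
  apply: measurableT_comp => //; exact: measurable_funM.
- by move=> w; rewrite mulr_ge0 ?expR_ge0.
- by move=> s; rewrite mulr_ge0 ?expR_ge0.
move=> w iw; congr (expR _ * _).
  rewrite /empirical_mean sum_cost//.
  case: n {mem} => [|n]; first by rewrite /= !mul0r mulr0.
  by rewrite mulrACA divff ?mul1r// pnatr_eq0.
rewrite indicE; congr (nat_of_bool _)%:R.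
by apply/idP/eqP; rewrite inE /= Phi_bits.
Qed.

End increments.

(** * The strong law of large numbers *)

Section interpolation.
Context {R : realType}.

Let pow_ratio (eta : R) (q : nat) : 0 < eta -> exists N, forall k, (N < k)%N ->
  (k.+1 ^ q)%:R <= (1 + eta) * (k ^ q)%:R :> R.
Proof.
move=> eta0.
have pow (t : R) : 0 <= t -> t <= 1 -> (1 + t) ^+ q <= 1 + (2 ^+ q - 1) * t.
  move=> t0 t1; elim: q => [|m IH]; first by rewrite !expr0; lra.
  have m1 : 1 <= (2 : R) ^+ m by rewrite exprn_ege1//; lra.
  rewrite exprS; apply: (@le_trans _ _ ((1 + t) * (1 + (2 ^+ m - 1) * t))).
    by rewrite ler_wpM2l//; lra.
  rewrite exprS; set c := 2 ^+ m in m1 *.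
  have : (c - 1) * t * t <= (c - 1) * t * 1.
    by rewrite ler_wpM2l// mulr_ge0//; lra.
  lra.
have [N _ HN] := @near_natM R (2 ^+ q - 1) eta eta0.
exists N => k Nk; have k0 : (0 : R) < k%:R by rewrite ltr0n (leq_ltn_trans _
  Nk).
have -> : (k.+1 ^ q)%:R = (1 + k%:R^-1) ^+ q * (k ^ q)%:R :> R.
  rewrite !natrX -exprMn mulrDl mul1r mulVf ?gt_eqF//.
  by rewrite natr1.
rewrite ler_wpM2r//; apply: (le_trans (pow _ _ _)).
- by rewrite invr_ge0 ltW.
- by rewrite invf_le1// ler1n (leq_ltn_trans _ Nk).
rewrite lerD2l ler_pdivrMr// mulrC.
exact: HN (ltnW Nk).
Qed.

(** A nondecreasing sequence is controlled by its values along [k ^ q], since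
    consecutive [q]-th powers have ratio tending to 1. *)
Lemma cvg_mean_subseq (S : nat -> R) (phi : R) q : (0 < q)%N -> 0 <= phi ->
  {homo S : m n / (m <= n)%N >-> m <= n} ->
  (forall delta, 0 < delta -> \forall k \near \oo,
     `|S (k ^ q)%N - (k ^ q)%:R * phi| <= delta * (k ^ q)%:R) ->
  (fun n => n%:R^-1 * S n) @ \oo --> phi.
Proof.
move=> q0 phi0 mono H; apply/cvgrPdist_le => e e0.
(* [delta] and [eta] are such that [(1 + eta) * (phi + delta) = phi + e / 2] *)
pose delta := e / 4; have d0 : 0 < delta by rewrite divr_gt0.
pose eta := e / (4 * phi + e).
have pe : 0 < 4 * phi + e by lra.
have eta0 : 0 < eta by rewrite divr_gt0.
have etaE : eta * (4 * phi + e) = e by rewrite divfK// gt_eqF.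
have [N1 HN1] := pow_ratio q eta0.
have [N2 _ HN2] := H delta d0.
pose N := maxn N1 N2.
near=> n.
have Nn : (N.+1 ^ q <= n)%N by near: n; exact: nbhs_infty_ge.
have [k Nk /andP[kn nk]] := exists_root q0 Nn.
have N1k : (N1 < k)%N by rewrite (leq_ltn_trans (leq_maxl _ N2)).
have N2k : (N2 <= k)%N by rewrite (leq_trans (leq_maxr N1 _))// ltnW.
have k0 : (0 < k)%N by exact: leq_ltn_trans Nk.
have n0 : (0 : R) < n%:R.
  by rewrite ltr0n (leq_trans _ kn)// expn_gt0 k0.
have := HN2 k N2k; have := HN2 k.+1 (leqW N2k) => /=.
have := HN1 k N1k.
have := mono _ _ kn; have := mono _ _ (ltnW nk).
have kn' : (k ^ q)%:R <= n%:R :> R by rewrite ler_nat.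
have nk' : n%:R <= (k.+1 ^ q)%:R :> R by rewrite ler_nat ltnW.
move: kn' nk'.
set a := (k ^ q)%:R; set b := (k.+1 ^ q)%:R.
set Sa := S (k ^ q)%N; set Sb := S (k.+1 ^ q)%N; set Sn := S n.
move=> an nb SnSb SaSn ba; rewrite !ler_norml => /andP[_ Hb] /andP[Ha _].
have up : Sn <= n%:R * (phi + e).
  apply: (@le_trans _ _ (b * (phi + delta))); first by lra.
  apply: (@le_trans _ _ ((1 + eta) * a * (phi + delta))).
    by rewrite ler_wpM2r//; rewrite /delta; lra.
  rewrite -mulrA mulrCA; apply: ler_pM => //.
  - by rewrite mulr_ge0//; rewrite /delta; lra.
  - by rewrite /delta; lra.
have lo : n%:R * (phi - e) <= Sn.
  apply: le_trans SaSn; apply: (@le_trans _ _ (a * (phi - delta))); last by lra.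
  have a0 : 0 <= a by rewrite /a.
  case: (leP 0 (phi - e)) => pe0.
    apply: (@le_trans _ _ ((1 + eta) * a * (phi - e))).
      by rewrite ler_wpM2r// (le_trans nb).
    rewrite -mulrA mulrCA ler_wpM2l//.
    have : 0 <= eta * e by rewrite mulr_ge0// ltW.
    rewrite /delta; lra.
  apply: (@le_trans _ _ (a * (phi - e))).
    by rewrite ler_wnM2r// ltW.
  by rewrite ler_wpM2l// /delta; lra.
have up' : n%:R^-1 * Sn <= phi + e by rewrite ler_pdivrMl.
have lo' : phi - e <= n%:R^-1 * Sn by rewrite ler_pdivlMl.
by apply/andP; split; lra.
Unshelve. all: by end_near. Qed.

Lemma sum_inv_sqr_le (K : R) n : 0 <= K ->
  \sum_(0 <= k < n) K / k.+1%:R ^+ 2 <= 2 * K.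
Proof.
move=> K0; suff : \sum_(0 <= k < n) K / k.+1%:R ^+ 2 <= 2 * K - 2 * K / n.+1%:R.
  by move/le_trans; apply; rewrite gerBl divr_ge0// mulr_ge0.
elim: n => [|n IH]; first by rewrite big_nil divr1 subrr.
rewrite big_nat_recr//=; apply: (le_trans (lerD IH (lexx _))).
have x1 : (1 : R) <= n.+1%:R by rewrite ler1n.
rewrite -[n.+2%:R]natr1; move: x1; set x : R := n.+1%:R => x1.
have x0 : 0 < x by lra.
rewrite -subr_ge0.
have -> : 2 * K - 2 * K / (x + 1) - (2 * K - 2 * K / x + K / x ^+ 2) =
  K * (x - 1) / (x ^+ 2 * (x + 1)).
  by field; rewrite ?gt_eqF//; lra.
rewrite divr_ge0// mulr_ge0//; first by lra.
- by rewrite exprn_ge0// ltW.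
- by lra.
Qed.

End interpolation.

Section strong_law.
Context d (Omega : measurableType d) (R : realType) (P : probability Omega R).
Context (D : nat -> {RV P >-> int}) (alpha : R).
Hypothesis halpha : 0 < alpha < 2^-1.
Hypothesis hD : iid_increments alpha D.
Context (F g : nat -> R) (phi b C : R).
Hypothesis adm : admissible alpha F g phi b C.

(** Borel-Cantelli along [k ^ q], then interpolation, the cumulative cost being
    nondecreasing. *)
Lemma strong_law x :
  {ae P, forall w, empirical_mean D F x n w @[n --> \oo] --> phi}.
Proof.
have [q [q0 dev]] := deviation_subseq halpha adm x.
pose E delta k := [set w | delta * (k.+1 ^ q)%:R <=
   `|cost F x (bits D 0 (k.+1 ^ q) w) - (k.+1 ^ q)%:R * phi|].
have mE delta k : measurable (E delta k).
  pose f (s : seq bool) := `|cost F x s - (k.+1 ^ q)%:R * phi|.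
  rewrite (_ : E delta k = (fun w => f (bits D 0 (k.+1 ^ q) w)) @^-1` [set y |
    delta * (k.+1 ^ q)%:R <= y]); last first.
    by apply/seteqP; split.
  rewrite -[X in measurable X]setTI; apply: measurable_fun_bits => //.
  by rewrite -set_itvcy; exact: measurable_itv.
have io delta : 0 < delta -> {ae P, forall w, \forall k \near \oo, ~ E delta k
  w}.
  move=> d0; have [K K0 HK] := dev delta d0.
  exists (lim_sup_set (E delta)); split.
  - apply: bigcap_measurable => // n _; apply: bigcup_measurable => k _.
    exact: mE.
  - apply: lim_sup_set_cvg0; first exact: mE.
    apply: (@le_lt_trans _ _ (2 * K)%:E); last exact: ltry.
    apply: lime_le; first by apply: is_cvg_nneseries => *; exact: measure_ge0.
    apply: nearW => n.
    apply: (@le_trans _ _ (\sum_(0 <= k < n) (K / k.+1%:R ^+ 2)%:E)%E).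
      apply: lee_sum => k _.
      have PE : P (E delta k) = (pathP alpha (k.+1 ^ q) (fun s =>
          delta * (k.+1 ^ q)%:R <= `|cost F x s - (k.+1 ^ q)%:R * phi|))%:E.
        by apply: (prob_bits hD).
      rewrite -[X in (X <= _)%E]/(P (E delta k)) PE.
      rewrite lee_fin; apply: HK => //.
      by apply/andP; split; [exact: leqnn|rewrite ltn_exp2r].
    by rewrite sumEFin lee_fin sum_inv_sqr_le// ltW.
  - move=> w /= nw n _; apply: contrapT => ne; apply: nw;
    exists n => // k nk Ek.
    by apply: ne; exists k.
have ae_all : {ae P, forall w, forall j : nat, \forall k \near \oo,
    ~ E (j.+1%:R^-1) k w}.
  by apply: ae_foralln => j; apply: io; rewrite invr_gt0.
apply: filterS2 (ae_ideal hD) ae_all => w iw Ew.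
have meanE n : empirical_mean D F x n w = n%:R^-1 * cost F x (bits D 0 n w).
  by rewrite /empirical_mean sum_cost.
under eq_fun do rewrite meanE.
apply: (@cvg_mean_subseq _ (fun n => cost F x (bits D 0 n w)) phi q) => //.
- exact: (ltW (adm_phi_gt0 adm)).
- move=> m n mn; rewrite /bits -(subnKC mn) iotaD map_cat cost_cat lerDl.
  exact: (cost_ge0 (adm_mono adm) (adm_ge0 adm)).
move=> delta d0.
have [j _ Hj] := @near_natM R 1 delta d0.
have [N _ HN] := Ew j.
near=> k.
have k0 : (0 < k)%N by near: k; exact: nbhs_infty_gt.
have Nk : (N <= k.-1)%N.
  have : (N < k)%N by near: k; exact: nbhs_infty_gt.
  by case: (k) k0.
have := HN k.-1 Nk; rewrite /E /= prednK// => /negP;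
  rewrite -ltNge => /ltW/le_trans.
apply; rewrite ler_wpM2r// invf_ple ?posrE ?ltr0n//.
by rewrite -[leLHS]mul1r ler_pdivrMr// Hj /=.
Unshelve. all: by end_near. Qed.

End strong_law.

(** * The large deviation limits *)

Section scaled_log.
Context {R : realType}.
Implicit Types (p : nat -> R) (v : R).

Lemma scaled_log_gt0 p n : 0 < p n ->
  scaled_log (fun k => (p k)%:E) n = (n%:R^-1 * ln (p n))%:E.
Proof. by move=> p0; rewrite /scaled_log lne_EFin. Qed.

Lemma cvg_scaled_log p v : decays_at_most p v -> decays_at_least p v ->
  scaled_log (fun n => (p n)%:E) @ \oo --> (- v)%:E.
Proof.
move=> lo up.
have pos : \forall n \near \oo, 0 < p n.
  by apply: filterS (lo 1 ltr01) => n; apply: lt_le_trans; exact: expR_gt0.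
have eqn : \forall n \near \oo,
    (n%:R^-1 * ln (p n))%:E = scaled_log (fun k => (p k)%:E) n.
  by apply: filterS pos => n pn; rewrite scaled_log_gt0.
apply: cvg_trans (near_eq_cvg eqn) _.
apply: cvg_EFin; first by apply: nearW.
apply/cvgrPdist_le => e e0; near=> n.
have n0 : (0 : R) < n%:R by rewrite ltr0n; near: n; exact: nbhs_infty_gt.
have pn : 0 < p n by near: n.
have h1 : expR (- n%:R * (v + e)) <= p n by near: n; exact: lo.
have h2 : p n <= expR (- n%:R * (v - e)) by near: n; exact: up.
have l1 : - n%:R * (v + e) <= ln (p n) by rewrite -ler_expR lnK.
have l2 : ln (p n) <= - n%:R * (v - e) by rewrite -ler_expR lnK.
have m1 : - (v + e) <= n%:R^-1 * ln (p n) by rewrite ler_pdivlMl// mulrN -mulNr.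
have m2 : n%:R^-1 * ln (p n) <= - (v - e) by rewrite ler_pdivrMl// mulrN -mulNr.
by rewrite /= ler_norml; apply/andP; split; lra.
Unshelve. all: by end_near. Qed.

End scaled_log.

Section large_deviations.
Context d (Omega : measurableType d) (R : realType) (P : probability Omega R).
Context (D : nat -> {RV P >-> int}) (alpha : R).
Hypothesis halpha : 0 < alpha < 2^-1.
Hypothesis hD : iid_increments alpha D.
Context (F g : nat -> R) (phi b C : R).
Hypothesis adm : admissible alpha F g phi b C.

Let a01 := alpha01 halpha.
Let F0 : R := F 0%N.
Let F0_lt : F0 < phi := adm_F0_lt adm.
Local Notation J := (rate alpha F).
Local Notation L := (Lam alpha F).
Implicit Types (a c e : R) (S : set R).

Let prob x S n := pathP alpha n (fun s => n%:R^-1 * cost F x s \in S).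

Let mean_probE' x S : mean_prob D F x S = fun n => (prob x S n)%:E.
Proof. by apply/funext => n; exact: mean_probE. Qed.

Let prob_le_tail x S c n : (0 < n)%N -> (forall y, S y -> y <= c) ->
  prob x S n <= pathP alpha n (fun s => cost F x s <= n%:R * c).
Proof.
move=> n0 Sc; apply: (sub_pathP a01) => s _; rewrite inE => /Sc.
by rewrite ler_pdivrMl// ltr0n.
Qed.

Lemma pinned_log_mgf_cvg a : a <= 0 ->
  scaled_log (pinned_mgf D F a) @ \oo --> (L a)%:E.
Proof.
move=> a0; rewrite (_ : pinned_mgf D F a = fun n => (pinned_exp alpha F a
  n)%:E).
  rewrite -[L a]opprK; apply: cvg_scaled_log.
    apply: decays_at_most_lim => e e0.
    have [K HK] := pinned_exp_ge_Lam halpha adm a0 e0.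
    apply: (@decays_at_most_bound _ _ _ (expR (- K))); first exact: expR_gt0.
    near=> n; rewrite -expRD -[leRHS]lnK ?posrE ?(pinned_exp_gt0 F halpha)//.
    by rewrite ler_expR; have := HK n; lra.
  apply: (@decays_at_least_lin _ _ _ 1) => n.
  apply: (le_trans (pinned_exp_le_Lam halpha adm n a0)).
  by rewrite mulrNN mul1r ler_peMl ?expR_ge0// ler1n.
by apply/funext => n; exact: pinned_mgfE.
Unshelve. all: by end_near. Qed.

Lemma pinned_log_mgf_cvgy a : 0 < a ->
  scaled_log (pinned_mgf D F a) @ \oo --> +oo%E.
Proof.
move=> a0; rewrite (_ : pinned_mgf D F a = fun n => (pinned_exp alpha F a
  n)%:E).
  apply/cvgeyPge => M; have [K HK] := pinned_exp_superexp halpha adm (M + 1) a0.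
  near=> n.
  have n0 : (0 : R) < n%:R by rewrite ltr0n; near: n; exact: nbhs_infty_gt.
  have nK : K <= n%:R * 1 by near: n; exact: near_natM.
  rewrite scaled_log_gt0 ?(pinned_exp_gt0 F halpha)// lee_fin.
  by rewrite ler_pdivlMl//; have := HK n; lra.
by apply/funext => n; exact: pinned_mgfE.
Unshelve. all: by end_near. Qed.

Lemma pinned_log_mgfE a : a <= 0 -> pinned_log_mgf D F a = (L a)%:E.
Proof. by move=> a0; apply: cvg_lim => //; exact: pinned_log_mgf_cvg. Qed.

Lemma pinned_log_mgf_pinfty a : 0 < a -> pinned_log_mgf D F a = +oo%E.
Proof. by move=> a0; apply: cvg_lim => //; exact: pinned_log_mgf_cvgy. Qed.

Lemma rate_eq_dual c : F0 < c -> (J c)%:E =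
  ereal_sup (range (fun a => (c * a)%:E - pinned_log_mgf D F a)%E).
Proof.
move=> Fc; apply/eqP; rewrite eq_le; apply/andP; split.
  have [sigma s0 [-> _]] := rate_dual halpha adm Fc.
  apply: ereal_sup_ubound; exists sigma => //.
  by rewrite pinned_log_mgfE// -EFinB.
apply: ge_ereal_sup => _ [a _ <-].
have [a0|a0] := leP a 0; last by rewrite pinned_log_mgf_pinfty// leNye.
by rewrite pinned_log_mgfE// -EFinB lee_fin (Lam_ge halpha adm a0 (ltW Fc)).
Qed.

Lemma rate_convexR (t x y : R) : F0 <= x -> F0 <= y -> 0 <= t -> t <= 1 ->
  J (t * x + (1 - t) * y) <= t * J x + (1 - t) * J y.
Proof.
wlog xy : t x y / x <= y.
  move=> H Fx Fy t0 t1; have [xy|/ltW yx] := leP x y; first exact: H.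
  have t2 : 0 <= 1 - t by lra.
  have t3 : 1 - t <= 1 by lra.
  have := H _ y x yx Fy Fx t2 t3; rewrite subKr.
  by rewrite (addrC (_ * y)) (addrC (_ * J y)).
move=> Fx _ t0 t1.
move: xy; rewrite le_eqVlt => /orP[/eqP <-|xy].
  by rewrite -!mulrDl subrKC !mul1r.
move: t0; rewrite le_eqVlt => /orP[/eqP <-|t0].
  by rewrite !mul0r !add0r subr0 !mul1r.
move: t1; rewrite le_eqVlt => /orP[/eqP ->|t1].
  by rewrite subrr !mul0r !addr0 !mul1r.
have yx0 : 0 < y - x by rewrite subr_gt0.
have h1 : x < t * x + (1 - t) * y.
  have : 0 < (1 - t) * (y - x) by rewrite mulr_gt0// subr_gt0.
  lra.
have h2 : t * x + (1 - t) * y < y.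
  by have : 0 < t * (y - x) by [rewrite mulr_gt0//]; lra.
rewrite -(ler_pM2l yx0); apply: (le_trans (rate_convex3 halpha adm Fx h1 h2)).
by rewrite le_eqVlt; apply/orP; left; apply/eqP; ring.
Qed.

Lemma rate_convex cbar : F0 <= cbar ->
  convex_function `[cbar, +oo[ (J : R^o -> R^o).
Proof.
move=> Fb i x y; rewrite !inE /= !in_itv /= !andbT => bx by'.
rewrite !convRE; apply: rate_convexR => //; exact: le_trans Fb _.
Qed.

Lemma decays_lower_tail x c : F0 < c ->
  decays_at_most (prob x [set y | y <= c]) (J c) /\
  decays_at_least (prob x [set y | y <= c]) (J c).
Proof.
move=> Fc.
have E n : (0 < n)%N -> prob x [set y | y <= c] n =
    pathP alpha n (fun s => cost F x s <= n%:R * c).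
  move=> n0; apply: eq_pathE => s _; congr (nat_of_bool _)%:R.
  by apply/idP/idP; rewrite inE /= ler_pdivrMl// ltr0n.
split.
  apply: decays_at_most_le (lower_tail_lower halpha adm x Fc).
  by near=> n; rewrite E//; near: n; exact: nbhs_infty_gt.
apply: decays_at_least_le (lower_tail_upper halpha adm x Fc).
by near=> n; rewrite E//; near: n; exact: nbhs_infty_gt.
Unshelve. all: by end_near. Qed.

(** Around a point [c < phi] the rate is attained just below [c], as the rate
    decreases strictly; above [phi] it vanishes. *)
Lemma open_lower x S c : open S -> S c -> F0 < c ->
  decays_at_most (prob x S) (J c).
Proof.
move=> oS Sc Fc.
have [e /= e0 HS] : exists2 e, 0 < e & ball c e `<=` S.
  by have /nbhs_ballP[e e0 H] := open_nbhs_nbhs (conj oS Sc); exists e.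
have inS y : `|c - y| < e -> S y by move=> h; exact: HS.
have [cphi|phic] := ltP c phi.
  pose d' := Num.min (e / 2) ((c - F0) / 2).
  have d0 : 0 < d' by rewrite lt_min !divr_gt0// subr_gt0.
  have d1 : d' <= e / 2 by rewrite ge_min lexx.
  have d2 : d' <= (c - F0) / 2 by rewrite ge_min lexx orbT.
  have Fcd : F0 < c - d' by lra.
  apply: decays_at_most_le (interval_lower halpha adm x Fcd cphi d0).
  near=> n; have n0 : (0 : R) < n%:R.
    by rewrite ltr0n; near: n; exact: nbhs_infty_gt.
  apply: (sub_pathP a01) => s _ /andP[h1 h2]; rewrite inE; apply: inS.
  have g1 : c - d' < n%:R^-1 * cost F x s by rewrite ltr_pdivlMl.
  have g2 : n%:R^-1 * cost F x s <= c by rewrite ler_pdivrMl.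
  by rewrite ltr_norml; apply/andP; split; lra.
rewrite (rate_eq0 halpha adm phic).
have e40 : 0 < e / 4 by rewrite divr_gt0.
have phic' : phi < c + e / 2 by rewrite (le_lt_trans phic)// ltrDl divr_gt0.
apply: decays_at_most_le (upper_interval_lower halpha adm x phic' e40).
near=> n; have n0 : (0 : R) < n%:R.
  by rewrite ltr0n; near: n; exact: nbhs_infty_gt.
apply: (sub_pathP a01) => s _; rewrite inE ler_norml => /andP[h1 h2].
apply: inS.
have g1 : c + e / 4 <= n%:R^-1 * cost F x s by rewrite ler_pdivlMl//; lra.
have g2 : n%:R^-1 * cost F x s <= c + 3 * e / 4 by rewrite ler_pdivrMl//; lra.
by rewrite ltr_norml; apply/andP; split; lra.
Unshelve. all: by end_near. Qed.

(** The rate being nonincreasing, the infimum over the closure is its value at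
    [sup O] when [O] lies below [phi], and 0 when the closure meets
    [[phi, +oo[]. The lower bound transfers from the closure to [O] by left
    continuity. *)
Lemma decays_open cbar x O : F0 < cbar -> O !=set0 -> open O ->
  O `<=` `]cbar, +oo[ ->
  [/\ decays_at_most (prob x O) (inf (J @` closure O)),
      decays_at_most (prob x (closure O)) (inf (J @` closure O)),
      decays_at_least (prob x O) (inf (J @` closure O)) &
      decays_at_least (prob x (closure O)) (inf (J @` closure O))].
Proof.
move=> Fb [y0 Oy0] oO Ob; set v := inf _.
have clO c : closure O c -> cbar <= c.
  have h : O `<=` [set y | cbar <= y].
    by move=> y /Ob /=; rewrite in_itv /= andbT => /ltW.
  move=> /(closureS h).
  by rewrite -(iffLR (closure_id _) (@closed_ge _ cbar)).
have J0 c : closure O c -> 0 <= J c.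
  move=> /clO bc; apply: (rate_ge0 halpha adm).
  exact: le_trans (ltW Fb) bc.
have lbJ : has_lbound (J @` closure O) by exists 0 => _ [c Oc <-]; exact: J0.
have neJ : J @` closure O !=set0.
  by exists (J y0), y0 => //; exact: subset_closure.
have v_le c : closure O c -> v <= J c by move=> Oc; apply: ge_inf => //;
  exists c.
have sub n : prob x O n <= prob x (closure O) n.
  apply: (sub_pathP a01) => s _; rewrite !inE; exact: subset_closure.
have lo : decays_at_most (prob x O) v.
  apply: decays_at_most_lim => e e0.
  have e20 : 0 < e / 2 by rewrite divr_gt0.
  have [_ [c' Oc' <-] Jc'] := inf_adherent e20 (conj neJ lbJ).
  have Fc' : F0 < c' by exact: lt_le_trans Fb (clO _ Oc').
  have [r r0 [Fr Jr]] := rate_left_continuous halpha adm Fc' e20.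
  have [c [cO cc']] := Oc' _ (nbhsx_ballx c' r r0).
  have cr : c' - r < c by move: cc'; rewrite /ball /= ltr_norml => /andP[]; lra.
  have Fc : F0 < c by exact: lt_trans Fr cr.
  apply: decays_at_most_weaken (open_lower x oO cO Fc).
  have : J c <= J (c' - r).
    exact: (rate_nonincreasing halpha adm (ltW Fr) (ltW cr)).
  by rewrite -/v in Jc'; lra.
have up : decays_at_least (prob x (closure O)) v.
  have [[c [cO phic]]|noc] := pselect (exists c, closure O c /\ phi <= c).
    have v0 : v <= 0 by rewrite -(rate_eq0 halpha adm phic); exact: v_le.
    move=> e e0; near=> n; apply: (le_trans (pathP_le1 a01 _ _)).
    rewrite -[leLHS]expR0 ler_expR mulNr -mulrN mulr_ge0//; lra.
  have Ophi c : closure O c -> c < phi.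
    by move=> Oc; rewrite ltNge; apply/negP => pc; apply: noc; exists c.
  have ubO : has_ubound O.
    by exists phi => y Oy; apply/ltW/Ophi; exact: subset_closure.
  have Om : closure O (sup O) by apply: closure_sup => //; exists y0.
  have cm c : closure O c -> c <= sup O.
    have h : O `<=` [set y | y <= sup O] by move=> y Oy; exact: ub_le_sup.
    move=> /(closureS h).
    by rewrite -(iffLR (closure_id _) (@closed_le _ (sup O))).
  have Fm : F0 < sup O by exact: lt_le_trans Fb (clO _ Om).
  apply: (decays_at_least_weaken (v_le _ Om)).
  apply: decays_at_least_le (lower_tail_upper halpha adm x Fm).
  by near=> n; apply: prob_le_tail => //; near: n; exact: nbhs_infty_gt.
split => //.
- by apply: decays_at_most_le lo; apply: nearW.
- by apply: decays_at_least_le up; apply: nearW.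
Unshelve. all: by end_near. Qed.

Lemma decays_upper_tail x c : phi <= c ->
  decays_at_most (prob x [set y | c <= y]) 0 /\
  decays_at_least (prob x [set y | c <= y]) 0.
Proof.
move=> phic; split.
  have phic1 : phi < c + 1 by lra.
  apply: decays_at_most_le (upper_interval_lower halpha adm x phic1 ltr01).
  near=> n; have n0 : (0 : R) < n%:R.
    by rewrite ltr0n; near: n; exact: nbhs_infty_gt.
  apply: (sub_pathP a01) => s _; rewrite inE /= ler_norml => /andP[h _].
  by rewrite ler_pdivlMl//; lra.
move=> e e0; apply: nearW => n; apply: (le_trans (pathP_le1 a01 _ _)).
by rewrite -[leLHS]expR0 ler_expR sub0r mulrNN mulr_ge0// ltW.
Unshelve. all: by end_near. Qed.

(** The left end [cbar] is taken strictly above [F 0], where the rate is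
    continuous. *)
Theorem large_deviations : exists (cbar : R) (I : R -> R),
  [/\ cbar < phi,
      convex_function `[cbar, +oo[ (I : R^o -> R^o) &
      forall c, cbar <= c -> 0 <= I c] /\
  (forall (O : set R) (x : nat),
     O !=set0 -> open O -> O `<=` `]cbar, +oo[ ->
     scaled_log (mean_prob D F x O) @ \oo
       --> (- inf (I @` closure O))%:E /\
     scaled_log (mean_prob D F x (closure O)) @ \oo
       --> (- inf (I @` closure O))%:E) /\
  [/\ forall c, cbar <= c < phi -> 0 < I c,
      forall c, phi <= c -> I c = 0 &
      forall c, cbar <= c ->
        (I c)%:E =
        ereal_sup (range (fun a : R =>
                            (c * a)%:E - pinned_log_mgf D F a)%E)] /\
  (forall (x : nat) (c : R), cbar < c < phi ->
     scaled_log (mean_prob D F x [set y | y <= c]) @ \oo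
       --> (- I c)%:E /\ - I c < 0) /\
  (forall (x : nat) (c : R), phi <= c ->
     scaled_log (mean_prob D F x [set y | c <= y]) @ \oo --> (0 : R)%:E).
Proof.
have lt_mid := midf_lt F0_lt.
pose cbar := (F0 + phi) / 2.
have Fb : F0 < cbar by rewrite lt_mid.
have Fc c : cbar <= c -> F0 < c by exact: lt_le_trans.
exists cbar, J; split; [|split; [|split; [|split]]].
- split; first by rewrite lt_mid.
    exact: rate_convex (ltW Fb).
  by move=> c /Fc/ltW; apply: (rate_ge0 halpha adm).
- move=> O x O0 oO Ob.
  have [? ? ? ?] := decays_open x Fb O0 oO Ob.
  by rewrite !mean_probE'; split; apply: cvg_scaled_log.
- split.
  + move=> c /andP[/Fc/ltW Fc' cphi]; exact: (rate_gt0 halpha adm).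
  + by move=> c; apply: (rate_eq0 halpha adm).
  + by move=> c /Fc; exact: rate_eq_dual.
- move=> x c /andP[/ltW/Fc Fc' cphi].
  have [? ?] := decays_lower_tail x Fc'; rewrite mean_probE'; split.
    exact: cvg_scaled_log.
  by rewrite oppr_lt0; apply: (rate_gt0 halpha adm) => //; exact: ltW.
- move=> x c phic; have [? ?] := decays_upper_tail x phic.
  by rewrite mean_probE' -[0%R in X in _ --> X]oppr0; exact: cvg_scaled_log.
Qed.

End large_deviations.

(** * The geometric law *)

Section nat_measures.
Context {R : realType}.
Implicit Types (mu : {measure set nat -> \bar R}).

Lemma nneseries_EFin (u : nat -> R) (l : R) :
  (fun n => \sum_(0 <= i < n) u i) @ \oo --> l ->
  (\sum_(i <oo) (u i)%:E = l%:E)%E.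
Proof.
move=> ul; apply: cvg_lim => //.
under eq_fun do rewrite sumEFin.
by apply: cvg_EFin; [exact: nearW|exact: ul].
Qed.

Lemma measure_nat mu (A : set nat) :
  (mu A = \sum_(i <oo | i \in A) mu [set i])%E.
Proof.
have AE : A = \bigcup_(i in A) [set i].
  by apply/seteqP; split=> [x Ax|x [i Ai ->]//]; exists x.
rewrite {1}AE; apply: measure_bigcup => //.
by apply/trivIsetP => i j _ _ ij; apply/seteqP; split => x //= [-> /eqP];
  rewrite (negbTE ij).
Qed.

Lemma eq_measure_nat mu mu' : (forall i, mu [set i] = mu' [set i]) -> mu = mu'
  :> (set nat -> \bar R).
Proof.
move=> E; apply/funext => A; rewrite !measure_nat.
by apply: eq_eseriesr => i _; rewrite E.
Qed.

End nat_measures.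

Section geometric.
Context {R : realType} (alpha : R).
Hypothesis halpha : 0 < alpha < 2^-1.
Let rho := alpha / (1 - alpha).
Let a01 := alpha01 halpha.
Let rho0 : 0 < rho := rho_gt0 halpha.
Let rho1 : rho < 1 := rho_lt1 halpha.
Let alphaE : alpha = rho * (1 - alpha) := alpha_rho halpha.

Definition geom_weight i : R := (1 - rho) * rho ^+ i.

Lemma geom_weight_ge0 i : 0 <= geom_weight i.
Proof. by rewrite mulr_ge0 ?exprn_ge0 ?subr_ge0 ?ltW. Qed.

Let geom_sum (r : R) n : r != 1 ->
  \sum_(0 <= i < n) r ^+ i = (1 - r ^+ n) / (1 - r).
Proof.
move=> r1; have r10 : 1 - r != 0 by rewrite subr_eq0 eq_sym.
elim: n => [|n IH]; first by rewrite big_nil expr0 subrr mul0r.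
rewrite big_nat_recr//= IH; apply: (mulIf r10).
by rewrite mulrDl !divfK// exprSr; ring.
Qed.

Lemma cvg_geom_sum (r : R) : 0 <= r -> r < 1 ->
  (fun n => \sum_(0 <= i < n) r ^+ i) @ \oo --> (1 - r)^-1.
Proof.
move=> r0 r1; under eq_fun do rewrite geom_sum ?lt_eqF//.
suff : (fun n => (1 - r ^+ n) / (1 - r)) @ \oo --> (1 - 0) / (1 - r).
  by rewrite subr0 mul1r.
apply: cvgMr_tmp; apply: cvgB; first exact: cvg_cst.
by apply: cvg_expr; rewrite ger0_norm.
Qed.

Lemma cvg_geom_weight :
  (fun n => \sum_(0 <= i < n) geom_weight i) @ \oo --> (1 : R).
Proof.
under eq_fun do rewrite -mulr_sumr.
have h : (1 - rho) * (1 - rho)^-1 = 1 by rewrite divff// subr_eq0 gt_eqF.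
by rewrite -[X in nbhs X]h; apply: cvgMl_tmp; apply: cvg_geom_sum => //;
  exact: ltW.
Qed.

Lemma geometric_probability : exists pi : probability nat R,
  forall f : nat -> \bar R, (forall x, (0 <= f x)%E) ->
  (\int[pi]_x f x = \sum_(i <oo) ((geom_weight i)%:E * f i))%E.
Proof.
pose m : {measure set nat -> \bar R} := mseries (fun i => mscale (NngNum
  (geom_weight_ge0 i)) \d_i) 0.
have intm (f : nat -> \bar R) : (forall x, (0 <= f x)%E) ->
    (\int[m]_x f x = \sum_(i <oo) ((geom_weight i)%:E * f i))%E.
  move=> f0; rewrite ge0_integral_measure_series//.
  apply: eq_eseriesr => i _.
  by rewrite ge0_integral_mscale// integral_dirac// diracT mul1e.
have mT : m setT = 1%E.
  transitivity (\int[m]_x (cst 1%E) x)%E; first by rewrite integral_cst ?mul1e.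
  rewrite intm//; under eq_eseriesr => i _ do rewrite mule1.
  by apply: nneseries_EFin; exact: cvg_geom_weight.
pose mP := Measure_isProbability.Build _ _ _ m mT.
pose pi := HB.pack_for (probability nat R) (Measure.sort m) mP.
by exists pi.
Qed.

Variable pi : probability nat R.
Hypothesis pi_int : forall f : nat -> \bar R, (forall x, (0 <= f x)%E) ->
  (\int[pi]_x f x = \sum_(i <oo) ((geom_weight i)%:E * f i))%E.

Lemma geom_integral (f : nat -> R) l : (forall x, 0 <= f x) ->
  (fun n => \sum_(0 <= i < n) geom_weight i * f i) @ \oo --> l ->
  (\int[pi]_x (f x)%:E = l%:E)%E.
Proof.
move=> f0 fl; rewrite pi_int//.
under eq_eseriesr => i _ do rewrite -EFinM.
exact: nneseries_EFin.
Qed.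

Lemma geom_set1 : geometric_distribution rho pi.
Proof.
move=> i; have := integral_indic pi measurableT (A := [set i]) I.
rewrite setIT => <-.
apply: (@geom_integral (\1_[set i])) => //.
apply: cvg_near_cst; near=> n.
have ni : (i < n)%N by near: n; exact: nbhs_infty_gt.
rewrite big_mkord (bigD1 (Ordinal ni))//= indicE mem_set// mulr1 big1 ?addr0//
  => j ji.
rewrite indicE memNset ?mulr0// => /= ij; move/eqP: ji; apply.
exact: val_inj.
Unshelve. all: by end_near. Qed.

(** Stationarity in flux form: the increments over the first [n] states
    telescope to the net flux across the last edge. *)
Lemma geom_flux (f : nat -> R) n :
  \sum_(0 <= i < n.+1) geom_weight i *
     (alpha * f i.+1 + (1 - alpha) * f i.-1 - f i) =
  alpha * geom_weight n * (f n.+1 - f n).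
Proof.
elim: n => [|n IH].
  by rewrite big_nat_recr//= big_nil add0r /geom_weight; ring.
rewrite big_nat_recr//= IH /geom_weight.
have e : alpha * ((1 - rho) * rho ^+ n) =
   (1 - alpha) * ((1 - rho) * rho ^+ n.+1).
  by rewrite [in LHS]alphaE exprS; ring.
by rewrite e; ring.
Qed.

Let flux_cvg0 (f : nat -> R) b C : 1 < b -> alpha * b < 1 - alpha ->
  (forall x, `|f x| <= C * b ^+ x) ->
  (fun n => alpha * geom_weight n * (f n.+1 - f n)) @ \oo --> (0 : R).
Proof.
move=> b1 ab fC; have /andP[a0 a1] := a01.
have b0 : 0 < b by lra.
have rb1 : rho * b < 1 by rewrite /rho mulrAC ltr_pdivrMr ?mul1r//; lra.
pose K := alpha * (1 - rho) * (C * (b + 1)).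
have rb : `|rho * b| < 1 by rewrite ger0_norm// mulr_ge0 ?(ltW rho0) ?(ltW b0).
have h : (fun n => K * (rho * b) ^+ n) @ \oo --> (0 : R).
  by have := cvgMl_tmp (a := K) (cvg_expr rb); rewrite mulr0; exact.
apply/norm_cvg0P; apply: (squeeze_cvgr _ _ h); last exact: cvg_cst.
near=> n; rewrite normr_ge0 /=.
have aw : 0 <= alpha * geom_weight n := mulr_ge0 (ltW a0) (geom_weight_ge0 n).
rewrite normrM ger0_norm//.
rewrite (_ : K * _ = alpha * geom_weight n * (C * b ^+ n.+1 + C * b ^+ n)).
  apply: ler_wpM2l => //.
  by apply: (le_trans (ler_normB _ _)); apply: lerD.
by rewrite /K /geom_weight exprMn exprS; ring.
Unshelve. all: by end_near. Qed.

(** Poisson's equation makes [F - phi] the increment of the flux of [g], which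
    vanishes at infinity. *)
Lemma geom_mean F g phi b C : admissible alpha F g phi b C ->
  (\int[pi]_x (F x)%:E = phi%:E)%E.
Proof.
move=> adm.
apply: geom_integral; first exact: nondecreasing_ge0 (adm_mono adm) (adm_ge0
  adm).
rewrite -cvg_shiftS /=.
have -> : (fun n => \sum_(0 <= i < n.+1) geom_weight i * F i) =
  (fun n => phi * \sum_(0 <= i < n.+1) geom_weight i
     - alpha * geom_weight n * (g n.+1 - g n)).
  apply/funext => n; rewrite -geom_flux mulr_sumr -sumrB.
  by apply: eq_bigr => i _; rewrite (adm_poisson adm); ring.
have w1 : (fun n => \sum_(0 <= i < n.+1) geom_weight i) @ \oo --> (1 : R).
  rewrite (cvg_shiftS (fun n => \sum_(0 <= i < n) geom_weight i)).
  exact: cvg_geom_weight.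
have := cvgB (cvgMl_tmp (a := phi) w1)
  (flux_cvg0 (adm_b_gt1 adm) (adm_b_lt adm) (adm_g_le adm)).
by rewrite mulr1 subr0; exact.
Qed.

(** Invariance for bounded functions, the flux across the edge from [n] to
    [n + 1] tending to 0. *)
Lemma geom_step (f : nat -> R) : (forall x, 0 <= f x <= 1) ->
  (\int[pi]_x (alpha * f x.+1 + (1 - alpha) * f x.-1)%:E =
   \int[pi]_x (f x)%:E)%E.
Proof.
move=> f01; have /andP[a0 a1] := a01.
have f0 x : 0 <= f x by case/andP: (f01 x).
have ac : 0 < 1 - alpha by rewrite subr_gt0.
pose s n := \sum_(0 <= i < n) geom_weight i * f i.
have cs : cvgn s.
  apply: nondecreasing_is_cvgn.
    apply/nondecreasing_seqP => n; rewrite /s big_nat_recr//= lerDl.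
    by rewrite mulr_ge0// geom_weight_ge0.
  exists 1 => _ [n _ <-].
  apply: (@le_trans _ _ (\sum_(0 <= i < n) geom_weight i)).
    apply: ler_sum => i _; rewrite ler_piMr ?geom_weight_ge0//.
    by case/andP: (f01 i).
  rewrite -mulr_sumr geom_sum ?lt_eqF// mulrC divfK; last first.
    by rewrite subr_eq0 eq_sym lt_eqF.
  by rewrite gerBl exprn_ge0// ltW.
rewrite (geom_integral f0 cs); apply: geom_integral.
  by move=> x; rewrite addr_ge0// mulr_ge0// ltW.
rewrite -cvg_shiftS /=.
have -> : (fun n => \sum_(0 <= i < n.+1) geom_weight i *
    (alpha * f i.+1 + (1 - alpha) * f i.-1)) =
  (fun n => s n.+1 + alpha * geom_weight n * (f n.+1 - f n)).
  apply/funext => n; rewrite -geom_flux /s -big_split /=.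
  by apply: eq_bigr => i _; ring.
pose b := ((1 - alpha) / alpha + 1) / 2.
have r1 : 1 < (1 - alpha) / alpha.
  by rewrite ltr_pdivlMr// mul1r; move: halpha => /andP[? ?]; lra.
have b1 : 1 < b by rewrite /b; lra.
have ab : alpha * b < 1 - alpha by rewrite mulrC -ltr_pdivlMr// /b; lra.
have fb x : `|f x| <= 1 * b ^+ x.
  rewrite mul1r ger0_norm//.
  apply: (@le_trans _ _ 1); first by case/andP: (f01 x).
  by rewrite exprn_ege1// ltW.
have sS : (fun n => s n.+1) @ \oo --> limn s by rewrite (cvg_shiftS s).
by have := cvgD sS (flux_cvg0 b1 ab fb); rewrite addr0; exact.
Qed.

Lemma geom_expr (z : R) : 0 <= z -> rho * z < 1 ->
  (\int[pi]_x (z ^+ x)%:E = ((1 - rho) / (1 - rho * z))%:E)%E.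
Proof.
move=> z0 rz; apply: geom_integral; first by move=> x; rewrite exprn_ge0.
rewrite (_ : (fun n => _) =
    (fun n => (1 - rho) * \sum_(0 <= i < n) (rho * z) ^+ i)); last first.
  apply/funext => n; rewrite mulr_sumr; apply: eq_bigr => i _.
  by rewrite /geom_weight (exprMn _ rho z) mulrA.
by apply: cvgMl_tmp; apply: cvg_geom_sum => //; rewrite mulr_ge0// ltW.
Qed.

End geometric.

(** * Invariance, uniqueness and geometric ergodicity *)

Section ergodicity.
Context d (Omega : measurableType d) (R : realType) (P : probability Omega R).
Context (D : nat -> {RV P >-> int}) (alpha : R).
Hypothesis halpha : 0 < alpha < 2^-1.
Hypothesis hD : iid_increments alpha D.
Let rho := alpha / (1 - alpha).
Let a01 := alpha01 halpha.

Let T k x (A : set nat) := pathP alpha k (fun s => pos x s \in A).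

(** Two copies driven by the same increments keep their distance until the
    lower one is reflected at 0, and then get closer; while they differ, the
    higher one is positive and [z ^ max] contracts. *)
Lemma coupling z k x y : 1 < z ->
  pathP alpha k (fun s => pos x s != pos y s) <=
  drift_rate alpha z ^+ k * z ^+ maxn x y.
Proof.
move=> z1; have /andP[a0 a1] := a01.
have k0 := drift_rate_gt0 halpha z1; have z0 : 0 < z by lra.
elim: k x y => [|k IH] x y.
  rewrite /pathP /= expr0 mul1r; apply: (@le_trans _ _ 1).
    by rewrite lern1 leq_b1.
  by rewrite exprn_ege1// ltW.
have [->|xy] := eqVneq x y.
  rewrite (_ : pathP _ _ _ = 0); last first.
    rewrite -(pathE_cst alpha k.+1 0); apply: eq_pathE => s _.
    by rewrite eqxx.
  by rewrite mulr_ge0 ?exprn_ge0// ltW.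
have m0 : (0 < maxn x y)%N by lia.
rewrite /pathP /=; set m := maxn x y in m0 *.
apply: (@le_trans _ _ (alpha * (drift_rate alpha z ^+ k * z ^+ m.+1) +
   (1 - alpha) * (drift_rate alpha z ^+ k * z ^+ m.-1))).
  apply: lerD; apply: ler_wpM2l; rewrite ?subr_ge0 ?(ltW a0) ?(ltW a1)//.
    by have := IH x.+1 y.+1; rewrite maxnSS.
  by have := IH x.-1 y.-1; rewrite (_ : maxn _ _ = m.-1)// /m; lia.
rewrite le_eqVlt; apply/orP; left; apply/eqP.
rewrite -(prednK m0) /= /drift_rate !exprS; field.
by rewrite gt_eqF.
Qed.

Lemma pathP_starting_point z k x y (A : set nat) : 1 < z ->
  T k x A <= T k y A + drift_rate alpha z ^+ k * (z ^+ x + z ^+ y).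
Proof.
move=> z1; have z0 : 0 < z by lra.
have k0 := drift_rate_gt0 halpha z1.
apply: (@le_trans _ _ (T k y A + pathP alpha k (fun s => pos x s != pos y s))).
  apply: le_trans (pathPU a01 _ _ _); apply: (sub_pathP a01) => s _.
  by case: eqVneq => [->|_ _]; rewrite ?orbF// orbT.
rewrite lerD2l; apply: (le_trans (coupling k x y z1)).
rewrite ler_wpM2l ?exprn_ge0 ?(ltW k0)//.
by rewrite /maxn; case: ifP => _; rewrite ?lerDl ?lerDr exprn_ge0// ltW.
Qed.

Let transition1E x (A : set nat) : transition D 1 x A =
  (alpha * \1_A x.+1 + (1 - alpha) * \1_A x.-1)%:E.
Proof. by rewrite (transitionE hD) /pathP /= !indicE. Qed.

Section geometric_law.
Variable pi : probability nat R.
Hypothesis pi_int : forall f : nat -> \bar R, (forall x, (0 <= f x)%E) ->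
  (\int[pi]_x f x = \sum_(i <oo) ((geom_weight alpha i)%:E * f i))%E.

Lemma geometric_invariant : invariant_distribution D pi.
Proof.
move=> A; under eq_integral => x _ do rewrite transition1E.
rewrite (geom_step halpha pi_int) ?integral_indic ?setIT//.
by move=> x; rewrite indicE ler0n lern1 leq_b1.
Qed.

Lemma geometric_invariant_iter k (A : set nat) :
  (pi A = \int[pi]_x (T k x A)%:E)%E.
Proof.
elim: k => [|k IH].
  transitivity (\int[pi]_x (\1_A x)%:E)%E;
    first by rewrite integral_indic// setIT.
  by apply: eq_integral => x _; rewrite indicE.
rewrite IH -(geom_step halpha pi_int)//.
by move=> x; rewrite pathP_ge0 ?pathP_le1.
Qed.

(** By coupling with a stationary copy, averaging [z ^ y] over the geometric
    law. *)
Lemma geometric_ergodic : geometrically_ergodic D pi.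
Proof.
have /andP[a0 a1] := a01.
have ac : 0 < 1 - alpha by rewrite subr_gt0.
(* any [z] strictly between 1 and [1 / rho] *)
pose z := ((1 - alpha) / alpha + 1) / 2.
have r1 : 1 < (1 - alpha) / alpha.
  by rewrite ltr_pdivlMr// mul1r; move: halpha => /andP[? ?]; lra.
have z1 : 1 < z by rewrite /z; lra.
have az : alpha * z < 1 - alpha by rewrite mulrC -ltr_pdivlMr// /z; lra.
have rz : rho * z < 1 by rewrite /rho mulrAC ltr_pdivrMr// mul1r.
pose lam := drift_rate alpha z.
have l0 : 0 < lam by exact: drift_rate_gt0.
have l1 : lam < 1 by exact: drift_rate_lt1.
have r0 := rho_gt0 halpha; have r1' := rho_lt1 halpha.
pose kap := (1 - rho) / (1 - rho * z).
have kap0 : 0 < kap by rewrite divr_gt0 ?subr_gt0.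
have z0 : 0 < z by lra.
pose K x := z ^+ x + kap.
have K0 x : 0 < K x by rewrite addr_gt0 ?exprn_gt0.
have int_bound k x : (\int[pi]_y (lam ^+ k * (z ^+ x + z ^+ y))%:E =
    (lam ^+ k * K x)%:E)%E.
  under eq_integral => y _ do rewrite EFinM EFinD.
  rewrite ge0_integralZl//; last 2 first.
  - by move=> y _; rewrite adde_ge0// lee_fin exprn_ge0// ltW.
  - by rewrite lee_fin exprn_ge0// ltW.
  rewrite ge0_integralD//; last 2 first.
  - by move=> y _; rewrite lee_fin exprn_ge0// ltW.
  - by move=> y _; rewrite lee_fin exprn_ge0// ltW.
  have := integral_cst pi measurableT (z ^+ x)%:E;
    rewrite /= probability_setT mule1 => ->.
  by rewrite (geom_expr halpha pi_int (ltW z0) rz) -EFinD -EFinM.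
have T0 k y (A : set nat) : 0 <= T k y A by exact: pathP_ge0.
have up k x (A : set nat) : (pi A <= (T k x A + lam ^+ k * K x)%:E)%E.
  rewrite (geometric_invariant_iter k).
  have := integral_cst pi measurableT (T k x A)%:E;
    rewrite /= probability_setT mule1 => intT.
  rewrite EFinD -int_bound -intT -ge0_integralD//; first last.
  - by move=> y _; rewrite lee_fin mulr_ge0 ?addr_ge0 ?exprn_ge0// ltW.
  - by move=> y _; rewrite lee_fin.
  apply: ge0_le_integral => //.
  - by move=> y _; rewrite lee_fin.
  - by move=> y _; rewrite -EFinD lee_fin [z ^+ x + _]addrC;
    exact: pathP_starting_point.
have lo k x (A : set nat) : ((T k x A)%:E <= pi A + (lam ^+ k * K x)%:E)%E.
  rewrite (geometric_invariant_iter k).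
  have := integral_cst pi measurableT (T k x A)%:E;
    rewrite /= probability_setT mule1 => intT.
  rewrite -int_bound -intT -ge0_integralD//; first last.
  - by move=> y _; rewrite lee_fin mulr_ge0 ?addr_ge0 ?exprn_ge0// ltW.
  - by move=> y _; rewrite lee_fin.
  apply: ge0_le_integral => //.
  - by move=> y _; rewrite lee_fin.
  - by move=> y _; rewrite -EFinD lee_fin; exact: pathP_starting_point.
exists lam^-1, (fun x => 2 * K x); split.
- by rewrite invf_gt1.
- by move=> x; rewrite mulr_gt0.
move=> x k; rewrite /tv_norm exprVn invrK.
have piE (A : set nat) : pi A = (fine (pi A))%:E by rewrite fineK//
  fin_num_measure.
set m := fun A => _.
have mE A : m A = (T k x A - fine (pi A))%:E.
  by rewrite /m (transitionE hD) {1}piE.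
have sup_le : (ereal_sup (range m) <= (lam ^+ k * K x)%:E)%E.
  apply: ge_ereal_sup => _ [A _ <-]; rewrite mE lee_fin.
  by have := lo k x A; rewrite piE -EFinD lee_fin; lra.
have inf_ge : ((- (lam ^+ k * K x))%:E <= ereal_inf (range m))%E.
  apply: le_ereal_inf_tmp => _ [A _ <-]; rewrite mE lee_fin.
  by have := up k x A; rewrite piE lee_fin; lra.
apply: (le_trans (leeB sup_le inf_ge)).
by rewrite -EFinB lee_fin; lra.
Qed.

End geometric_law.

(** The balance equations are a two-term recursion that determines an invariant
    law from its mass at 0. *)
Lemma invariant_geometric (nu : probability nat R) :
  invariant_distribution D nu -> geometric_distribution rho nu.
Proof.
move=> inv; have /andP[a0 a1] := a01.
have ac : 0 < 1 - alpha by rewrite subr_gt0.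
have r0 : 0 < rho := rho_gt0 halpha; have r1 : rho < 1 := rho_lt1 halpha.
pose q j := fine (nu [set j]).
have qE j : nu [set j] = (q j)%:E by rewrite fineK// fin_num_measure.
have balance A : nu A = (alpha%:E * nu [set x | A x.+1] +
    (1 - alpha)%:E * nu [set x | A x.-1])%E.
  rewrite [LHS]inv; under eq_integral => x _ do rewrite transition1E EFinD
    !EFinM.
  have ind (h : nat -> nat) (c : R) : 0 <= c ->
      (\int[nu]_x (c%:E * (\1_A (h x))%:E) = c%:E * nu [set x | A (h x)])%E.
    move=> c0; rewrite ge0_integralZl//.
    by rewrite -[in RHS](setIT [set x | _]) -integral_indic.
  rewrite ge0_integralD//; last 2 first.
  - by move=> x _; rewrite -EFinM lee_fin mulr_ge0 ?(ltW a0).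
  - by move=> x _; rewrite -EFinM lee_fin mulr_ge0 ?(ltW ac).
  by rewrite !ind// ltW.
have bal0 : q 0%N = (1 - alpha) * (q 0%N + q 1%N).
  have := balance [set 0%N].
  rewrite (_ : [set x | [set 0%N] x.+1] = set0); last by apply/seteqP; split.
  rewrite (_ : [set x | [set 0%N] x.-1] = [set 0%N] `|` [set 1%N]); last first.
    apply/seteqP; split => [[|[|x]]|x] /=; [by left|by right|by []|].
    by case=> ->.
  have -> : nu ([set 0%N] `|` [set 1%N]) = (nu [set 0%N] + nu [set 1%N])%E.
    by apply: measureU => //; apply/seteqP; split => x //= [->].
  rewrite measure0 mule0 add0e.
  by rewrite !qE -EFinD -EFinM => -[].
have balS j : q j.+1 = alpha * q j + (1 - alpha) * q j.+2.
  have := balance [set j.+1].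
  rewrite (_ : [set x | [set j.+1] x.+1] = [set j]); last first.
    by apply/seteqP; split => x /= => [[]|->].
  rewrite (_ : [set x | [set j.+1] x.-1] = [set j.+2]); last first.
    by apply/seteqP; split => x /= => [|->//]; lia.
  by rewrite !qE -!EFinM -EFinD => -[].
have aE : alpha = rho * (1 - alpha) := alpha_rho halpha.
have qS j : q j.+1 = rho * q j.
  elim: j => [|j IH]; apply: (mulIf (lt0r_neq0 ac)).
    by rewrite mulrAC -aE; lra.
  have e : alpha * q j = (1 - alpha) * q j.+1.
    by rewrite IH [in LHS]aE mulrAC mulrC.
  by rewrite mulrAC -aE; have := balS j; rewrite e; lra.
have qX j : q j = q 0%N * rho ^+ j.
  by elim: j => [|j IH]; rewrite ?expr0 ?mulr1// qS IH exprS mulrCA.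
have q0E : q 0%N = 1 - rho.
  have := probability_setT nu; rewrite measure_nat.
  rewrite (eq_eseriesl (Q := xpredT)); last by move=> i; exact: in_setT.
  rewrite (eq_eseriesr (g := fun i => (q 0%N * rho ^+ i)%:E)); last first.
    by move=> i _; rewrite -qX; exact: qE.
  rewrite (nneseries_EFin (l := q 0%N * (1 - rho)^-1)).
    by move=> [/(canRL (mulfVK _)) ->]; rewrite ?mul1r// subr_eq0 gt_eqF.
  under eq_fun do rewrite -mulr_sumr.
  by apply: cvgMl_tmp; apply: cvg_geom_sum => //; exact: ltW.
by move=> j; rewrite qE qX q0E.
Qed.

End ergodicity.

(** * Ergodicity and large deviations of the queue *)

Unset Implicit Arguments.

Theorem proposition1p1 (R : realType) (alpha : R)
    (halpha : 0 < alpha < 2^-1)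
    (d : measure_display) (Omega : measurableType d) (P : probability Omega R)
    (D : nat -> {RV P >-> int}) (hD : iid_increments alpha D) :
  let rho := alpha / (1 - alpha) in
  exists pi : probability nat R,
    (* (i) *)
    [/\ geometrically_ergodic D pi,
        invariant_distribution D pi,
        (forall pi' : probability nat R, invariant_distribution D pi' ->
           forall A, pi' A = pi A) &
        geometric_distribution rho pi] /\
    (* (ii) *)
    forall F : nat -> R,
      (F = (fun x => x%:R) \/
       exists2 beta : R, 0 < beta < `|ln rho| &
                         F = (fun x => expR (beta * x%:R))) ->
      let phi := (\int[pi]_x F x)%R in
      pi.-integrable setT (EFin \o F) /\
      (forall x : nat,
         {ae P, forall w, empirical_mean D F x n w @[n --> \oo] --> phi}) /\
      (* the limit defining the pinned log moment generating function exists
         in (-oo, +oo] *)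
      (forall a : R,
         cvgn (scaled_log (pinned_mgf D F a)) /\
         (-oo < pinned_log_mgf D F a)%E) /\
      exists (cbar : R) (I : R -> R),
        [/\ cbar < phi,
            convex_function `[cbar, +oo[ (I : R^o -> R^o) &
            forall c, cbar <= c -> 0 <= I c] /\
        (forall (O : set R) (x : nat),
           O !=set0 -> open O -> O `<=` `]cbar, +oo[ ->
           scaled_log (mean_prob D F x O) @ \oo
             --> (- inf (I @` closure O))%:E /\
           scaled_log (mean_prob D F x (closure O)) @ \oo
             --> (- inf (I @` closure O))%:E) /\
        [/\ forall c, cbar <= c < phi -> 0 < I c,
            forall c, phi <= c -> I c = 0 &
            forall c, cbar <= c ->
              (I c)%:E =
              ereal_sup (range (fun a : R =>
                                  (c * a)%:E - pinned_log_mgf D F a)%E)] /\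
        (forall (x : nat) (c : R), cbar < c < phi ->
           scaled_log (mean_prob D F x [set y | y <= c]) @ \oo
             --> (- I c)%:E /\ - I c < 0) /\
        (forall (x : nat) (c : R), phi <= c ->
           scaled_log (mean_prob D F x [set y | c <= y]) @ \oo --> (0 : R)%:E).
Proof.
move=> rho; have [pi pi_int] := geometric_probability halpha.
exists pi; split.
  split.
  - exact: (geometric_ergodic halpha hD pi_int).
  - exact: (geometric_invariant halpha hD pi_int).
  - move=> nu /(invariant_geometric halpha hD) nuE A.
    congr (_ A); apply: eq_measure_nat => i.
    by rewrite [LHS]nuE [RHS](geom_set1 pi_int).
  - exact: (geom_set1 pi_int).
move=> F hF phi0.
have [g [phi [b [C adm]]]] : exists (g : nat -> R) phi b C,
    admissible alpha F g phi b C.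
  case: hF => [->|[beta hbeta ->]]; first exact: admissible_id.
  exact: admissible_exp.
have intF := geom_mean halpha pi_int adm.
have F_ge0 := nondecreasing_ge0 (adm_mono adm) (adm_ge0 adm).
have -> : phi0 = phi by rewrite /phi0 /Rintegral intF.
split.
  apply/integrableP; split=> //.
  rewrite (eq_integral (fun x => (F x)%:E)); first by rewrite intF ltry.
  by move=> x _ /=; rewrite ger0_norm.
split; first by move=> x; exact: (strong_law halpha hD adm).
split; last exact: (large_deviations halpha hD adm).
move=> a; have [a0|a0] := leP a 0.
  have h := pinned_log_mgf_cvg halpha hD adm a0.
  rewrite (pinned_log_mgfE halpha hD adm a0) ltNyr.
  by split=> //; apply/cvg_ex; exists (Lam alpha F a)%:E.
have h := pinned_log_mgf_cvgy halpha hD adm a0.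
rewrite (pinned_log_mgf_pinfty halpha hD adm a0).
by split=> //; apply/cvg_ex; exists +oo%E.
Qed.
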